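(* Let $L$ be a Lie algebra over a field $F$ of characteristic zero. If $A$ is a finite dimensional $L$-algebra over $F$, then $\exp^L(A)=\exp(A)$.
   Context: All algebras $A$ are associative over $F$ (not necessarily unital). A derivation of $A$ is a linear map $\delta:A\to A$ with $(ab)^\delta=a^\delta b+ab^\delta$ (exponential notation, maps compose from left to right); $\mathrm{Der}(A)$ is the Lie algebra of all derivations. An $L$-algebra is an associative algebra $A$ together with a Lie algebra homomorphism $L\to\mathrm{Der}(A)$. The action extends to the universal enveloping algebra $U(L)$, making $A$ a right $U(L)$-module, $a\mapsto a^d$, $d\in U(L)$. Given a basis $\mathcal{B}_{U(L)}=\{d_i\}$ of $U(L)$ containing $d_0=1$, the free $L$-algebra $F\langle X|L\rangle$ is the free associative algebra on the formal generators $x_i^{d_j}$ ($i\ge 1$, $d_j\in\mathcal{B}_{U(L)}$), with $x_i=x_i^{1}$ and $x^d:=\sum_i\alpha_i x^{d_i}$ for $d=\sum_i \alpha_i d_i\in U(L)$, and with $L$ acting by derivations so that $(x_i^{d})^\delta=x_i^{d\delta}$ for $\delta\in L$. An element $f(x_1,\dots,x_n)\in F\langle X|L\rangle$ is a differential identity of $A$ if $f(a_1,\dots,a_n)=0$ for all $a_i\in A$; $\mathrm{Id}^L(A)$ is the set of differential identities of $A$. Let $P_n^L=\mathrm{span}_F\{x_{\sigma(1)}^{d_{i_1}}\cdots x_{\sigma(n)}^{d_{i_n}} \mid \sigma\in S_n,\ d_{i_k}\in\mathcal{B}_{U(L)}\}$ and $c_n^L(A)=\dim_F P_n^L/(P_n^L\cap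 \mathrm{Id}^L(A))$, $n\ge1$, which is finite when $A$ is finite dimensional. The differential exponent is $\exp^L(A)=\lim_{n\to\infty}\sqrt[n]{c_n^L(A)}$; it is known that for finite dimensional $A$ this limit exists and is a non-negative integer. The ordinary codimensions are $c_n(A)=\dim_F P_n/(P_n\cap \mathrm{Id}(A))$, where $P_n$ is the space of ordinary multilinear polynomials in non-commuting variables $x_1,\dots,x_n$ and $\mathrm{Id}(A)$ is the ideal of ordinary polynomial identities of $A$. The exponent is $\exp(A)=\lim_{n\to\infty}\sqrt[n]{c_n(A)}$, known to exist and to be a non-negative integer. *)

(* Defs.v *)
From HB Require Import structures.
From mathcomp Require Import all_boot all_order all_algebra perm.
From mathcomp Require Import generic_quotient ring_quotient.
From mathcomp Require Import finmap.
From mathcomp Require Import all_classical all_reals.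
From mathcomp Require Import topology normedtype sequences exp.
(* The notations of monalg are incompatible with those of analysis. *)
From mathcomp.multinomials Require Import -(notations) monalg.

Set Implicit Arguments.
Unset Strict Implicit.
Unset Printing Implicit Defensive.

Import GRing.Theory Num.Theory numFieldNormedType.Exports.
Local Open Scope quotient_scope.
Local Open Scope ring_scope.

(* Lie algebras over F, of arbitrary dimension. *)
HB.mixin Record Lmodule_isLieAlgebra (F : fieldType) L of GRing.Lmodule F L := {
  lie : L -> L -> L;
  lie_linearl : forall y, linear (fun x => lie x y);
  lie_linearr : forall x, linear (lie x);
  liexx : forall x, lie x x = 0;
  jacobi : forall x y z,
    lie x (lie y z) + lie y (lie z x) + lie z (lie x y) = 0
}.

#[short(type="lieAlgType")]
HB.structure Definition LieAlgebra (F : fieldType) :=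
  { L of Lmodule_isLieAlgebra F L & GRing.Lmodule F L }.

(* Associative algebras over F, not necessarily unital. *)
HB.mixin Record Lmodule_isAssocAlgebra (F : fieldType) A
    of GRing.Lmodule F A := {
  amul : A -> A -> A;
  amul_linearl : forall b, linear (fun a => amul a b);
  amul_linearr : forall a, linear (amul a);
  amulA : associative amul
}.

#[short(type="assocAlgType")]
HB.structure Definition AssocAlgebra (F : fieldType) :=
  { A of Lmodule_isAssocAlgebra F A & GRing.Lmodule F A }.

Definition derivation (F : fieldType) (A : assocAlgType F) (delta : A -> A) :=
  linear delta /\
  forall a b, delta (amul a b) = amul (delta a) b + amul a (delta b).

(* [dact a x] is a^x.  Maps compose from left to right, so the commutator of
   the derivations of x and y is a |-> (a^x)^y - (a^y)^x. *)
HB.mixin Record AssocAlgebra_isLAlgebra (F : fieldType) (L : lieAlgType F) A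
    of AssocAlgebra F A := {
  dact : A -> L -> A;
  dact_derivation : forall x, derivation (fun a => dact a x);
  dact_linear : forall a, linear (dact a);
  dact_lie : forall a x y,
    dact a (lie x y) = dact (dact a x) y - dact (dact a y) x
}.

#[short(type="lAlgType")]
HB.structure Definition LAlgebra (F : fieldType) (L : lieAlgType F) :=
  { A of AssocAlgebra_isLAlgebra F L A & AssocAlgebra F A }.

#[short(type="fdLAlgType")]
HB.structure Definition FdLAlgebra (F : fieldType) (L : lieAlgType F) :=
  { A of LAlgebra F L A & Vector F A }.

(* The free unital associative F-algebra on X: finitely supported functions
   from words in X to F. *)
Notation freeAlg F X := (malg (fmonom X) F).

Definition fgen (F : fieldType) (X : choiceType) (x : X) : freeAlg F X :=
  mkmalgU (fmu x) 1.

(* Linear combination with finitely supported coefficients. *)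
Definition lincomb (F : fieldType) (K : choiceType) (V : lmodType F)
    (v : K -> V) (c : malg K F) : V :=
  \sum_(k <- msupp c) mcoeff k c *: v k.

Lemma lincombEw (F : fieldType) (K : choiceType) (V : lmodType F)
    (v : K -> V) (d : {fset K}) (c : malg K F) : fsubset (msupp c) d ->
  lincomb v c = \sum_(k <- d) mcoeff k c *: v k.
Proof.
move=> le; rewrite /lincomb [LHS](big_fset_incl _ le) //= => k kd.
by move/mcoeff_outdom=> ->; rewrite scale0r.
Qed.

Lemma lincomb_linear (F : fieldType) (K : choiceType) (V : lmodType F)
  (v : K -> V) : linear (lincomb v).
Proof.
move=> a c1 c2.
pose d := (msupp c1 `|` msupp c2)%fset.
rewrite !(@lincombEw F K V v d) ?fsubsetUl ?fsubsetUr //.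
  rewrite scaler_sumr -big_split /=; apply: eq_bigr => k _.
  by rewrite mcoeffD mcoeffZ scalerDl scalerA.
apply: fsubset_trans (msuppD_le _ _) _.
by apply: fsetSU; apply: msuppZ_le.
Qed.

Lemma freeAlg_scalerAr (F : fieldType) (X : choiceType) (a : F)
  (f g : freeAlg F X) : a *: (f * g) = f * (a *: g).
Proof.
apply/malgP => k; rewrite mcoeffZ mcoeffMl.
rewrite (mcoeffMlw _ (fsubset_refl _) (msuppZ_le a g)) mulr_sumr.
apply: eq_bigr => k1 _; rewrite mulr_sumr; apply: eq_bigr => k2 _.
by rewrite mcoeffZ mulrnAr mulrCA.
Qed.

Section UniversalEnveloping.
Variables (F : fieldType) (L : lieAlgType F).

Local Notation T := (freeAlg F L).
Local Notation gen := (@fgen F L).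

(* The two-sided ideal I such that U(L) = T / I; since T is the free algebra
   on the set L, I also contains the linearity relations. *)
Inductive uideal : T -> Prop :=
| uideal_lin a x y : uideal (gen (a *: x + y) - (a *: gen x + gen y))
| uideal_lie x y : uideal (gen x * gen y - gen y * gen x - gen (lie x y))
| uideal_add u v : uideal u -> uideal v -> uideal (u + v)
| uideal_mul u v w : uideal v -> uideal (u * v * w).

Lemma uideal0 : uideal 0.
Proof. by have := uideal_mul 0 0 (uideal_lie 0 0); rewrite mulr0. Qed.

Lemma uidealMl u v : uideal v -> uideal (u * v).
Proof. by move=> /(uideal_mul u 1); rewrite mulr1. Qed.

Lemma uidealMr u v : uideal u -> uideal (u * v).
Proof. by move=> /(uideal_mul 1 v); rewrite mul1r. Qed.

Lemma uidealZ a u : uideal u -> uideal (a *: u).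
Proof. by rewrite -mul_malgC; exact: uidealMl. Qed.

Lemma uideal_mcoeff1 u : uideal u -> mcoeff mone u = 0.
Proof.
have gen0 x : mcoeff mone (gen x) = 0.
  by rewrite mcoeffU -val_eqE /= fmU fm1.
elim=> [a x y|x y|{}u v _ IHu _ IHv|{}u v w _ IHv].
- by rewrite mcoeffB mcoeffD mcoeffZ !gen0 mulr0 addr0 subr0.
- by rewrite !mcoeffB !rmorphM /= !gen0 mulr0 !subr0.
- by rewrite mcoeffD IHu IHv addr0.
- by rewrite !rmorphM /= IHv mulr0 mul0r.
Qed.

Definition in_uideal : {pred T} := fun u => `[< uideal u >].

Lemma in_uideal_zmod_closed : zmod_closed in_uideal.
Proof.
split=> [|u v /asboolP hu /asboolP hv]; first exact/asboolP/uideal0.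
by apply/asboolP/uideal_add => //; rewrite -scaleN1r; apply: uidealZ.
Qed.

HB.instance Definition _ := GRing.isZmodClosed.Build T in_uideal
  in_uideal_zmod_closed.

Definition uea : Type := (Quotient.quot in_uideal).
HB.instance Definition _ := GRing.Zmodule.on uea.

Definition upi (t : T) : uea := \pi_(Quotient.quot in_uideal) t.
Definition urep (u : uea) : T := repr (u : (Quotient.quot in_uideal)).

Lemma urepK u : upi (urep u) = u.
Proof. exact: reprK. Qed.

Lemma upiP t1 t2 : reflect (upi t1 = upi t2) (`[< uideal (t1 - t2) >]).
Proof.
have -> : `[< uideal (t1 - t2) >] = (upi t1 == upi t2).
  by rewrite /upi -Quotient.idealrBE.
exact: eqP.
Qed.

Lemma upi_eq t1 t2 : uideal (t1 - t2) -> upi t1 = upi t2.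
Proof. by move=> h; apply/upiP/asboolP. Qed.

Lemma upi_uideal t1 t2 : upi t1 = upi t2 -> uideal (t1 - t2).
Proof. by move=> h; apply/asboolP/upiP. Qed.

Lemma upiD t1 t2 : upi (t1 + t2) = upi t1 + upi t2.
Proof. by rewrite /upi !piE. Qed.

Lemma upiN t : upi (- t) = - upi t.
Proof. by rewrite /upi !piE. Qed.

Lemma upi0 : upi 0 = 0.
Proof. by rewrite /upi !piE. Qed.

Lemma urep_upi t : uideal (urep (upi t) - t).
Proof. by apply: upi_uideal; rewrite urepK. Qed.

Definition uone : uea := upi 1.
Definition umul (u v : uea) : uea := upi (urep u * urep v).
Definition uscale (a : F) (u : uea) : uea := upi (a *: urep u).

Lemma upiM t1 t2 : upi (t1 * t2) = umul (upi t1) (upi t2).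
Proof.
apply/esym/upi_eq.
have -> : urep (upi t1) * urep (upi t2) - t1 * t2 =
    (urep (upi t1) - t1) * urep (upi t2) + t1 * (urep (upi t2) - t2).
  by rewrite mulrBl mulrBr addrA subrK.
by apply: uideal_add; [apply: uidealMr|apply: uidealMl]; apply: urep_upi.
Qed.

Lemma upiZ a t : upi (a *: t) = uscale a (upi t).
Proof.
by apply/esym/upi_eq; rewrite -scalerBr; apply: uidealZ; apply: urep_upi.
Qed.

Lemma umulA : associative umul.
Proof.
by move=> u v w; rewrite -[u]urepK -[v]urepK -[w]urepK -!upiM mulrA.
Qed.

Lemma umul1 : left_id uone umul.
Proof. by move=> u; rewrite -[u]urepK -upiM mul1r. Qed.

Lemma umulr1 : right_id uone umul.
Proof. by move=> u; rewrite -[u]urepK -upiM mulr1. Qed.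

Lemma umulDl : left_distributive umul +%R.
Proof.
move=> u v w; rewrite -[u]urepK -[v]urepK -[w]urepK.
by rewrite -upiD -!upiM -upiD mulrDl.
Qed.

Lemma umulDr : right_distributive umul +%R.
Proof.
move=> u v w; rewrite -[u]urepK -[v]urepK -[w]urepK.
by rewrite -upiD -!upiM -upiD mulrDr.
Qed.

Lemma uone_neq0 : uone != 0.
Proof.
apply/eqP; rewrite -upi0 => /upi_uideal /uideal_mcoeff1; rewrite subr0 rmorph1.
by apply/eqP; rewrite oner_eq0.
Qed.

HB.instance Definition _ := GRing.Zmodule_isNzRing.Build uea
  umulA umul1 umulr1 umulDl umulDr uone_neq0.

Lemma uscaleA a b u : uscale a (uscale b u) = uscale (a * b) u.
Proof. by rewrite -[u]urepK -!upiZ scalerA. Qed.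

Lemma uscale1 : left_id 1 uscale.
Proof. by move=> u; rewrite -[u]urepK -upiZ scale1r. Qed.

Lemma uscaleDr : right_distributive uscale +%R.
Proof.
by move=> a u v; rewrite -[u]urepK -[v]urepK -upiD -!upiZ -upiD scalerDr.
Qed.

Lemma uscaleDl u : {morph uscale^~ u : a b / a + b}.
Proof. by move=> a b; rewrite -[u]urepK -!upiZ -upiD scalerDl. Qed.

HB.instance Definition _ := GRing.Zmodule_isLmodule.Build F uea
  uscaleA uscale1 uscaleDr uscaleDl.

Lemma uscaleAl (a : F) (u v : uea) : a *: (u * v) = (a *: u) * v.
Proof.
by rewrite -[u]urepK -[v]urepK -[LHS]/(uscale _ (umul _ _))
  -[RHS]/(umul (uscale _ _) _) -!(upiM, upiZ) scalerAl.
Qed.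

HB.instance Definition _ := GRing.Lmodule_isLalgebra.Build F uea uscaleAl.

Lemma uscaleAr (a : F) (u v : uea) : a *: (u * v) = u * (a *: v).
Proof.
rewrite -[u]urepK -[v]urepK -[LHS]/(uscale _ (umul _ _)).
by rewrite -[RHS]/(umul _ (uscale _ _)) -!(upiM, upiZ) freeAlg_scalerAr.
Qed.

HB.instance Definition _ := GRing.Lalgebra_isAlgebra.Build F uea uscaleAr.

Lemma upi_linear : linear upi.
Proof. by move=> a t1 t2; rewrite upiD upiZ. Qed.

Definition uin (x : L) : uea := upi (gen x).

Lemma uin_linear : linear uin.
Proof.
move=> a x y; rewrite /uin (upi_eq (uideal_lin a x y)); exact: upi_linear.
Qed.

Lemma uin_lie x y : uin (lie x y) = uin x * uin y - uin y * uin x.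
Proof.
rewrite /uin -(upi_eq (uideal_lie x y)) upiD upiN.
by congr (_ - _); apply: upiM.
Qed.

End UniversalEnveloping.

Section EnvelopingAction.
Variables (F : fieldType) (L : lieAlgType F) (A : lAlgType L).

Local Notation T := (freeAlg F L).

Definition word_act (a : A) (w : fmonom L) : A := foldl (@dact F L A) a w.
Definition free_act (a : A) (t : T) : A := lincomb (word_act a) t.

(* [uact a u] is a^u for u in U(L). *)
Definition uact (a : A) (u : uea L) : A := free_act a (urep u).

Lemma free_actP a : linear (free_act a).
Proof. exact: lincomb_linear. Qed.

HB.instance Definition _ a :=
  GRing.isLinear.Build F T A *:%R (free_act a) (free_actP a).

Lemma free_actU a c w : free_act a (mkmalgU w c) = c *: word_act a w.
Proof.
rewrite /free_act (lincombEw _ msuppU_le) big_seq_fset1.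
by rewrite mcoeffUU.
Qed.

Lemma free_act1 a : free_act a 1 = a.
Proof.
rewrite -[1 : T]/(mkmalgU mone 1) free_actU scale1r.
by rewrite /word_act fm1.
Qed.

Lemma free_act_gen a x : free_act a (fgen F x) = dact a x.
Proof. by rewrite free_actU scale1r /word_act fmU. Qed.

Lemma dact_linearl x : linear (fun a : A => dact a x).
Proof. exact: (dact_derivation x).1. Qed.

Lemma word_act_linearl w : linear (fun a : A => word_act a w).
Proof.
rewrite /word_act; elim: (w : seq L) => [|x s IH] //= c a b.
by rewrite dact_linearl IH.
Qed.

Lemma free_act_linearl t : linear (fun a : A => free_act a t).
Proof.
move=> c a b; rewrite /free_act /lincomb scaler_sumr -big_split /=.
apply: eq_bigr => w _.
by rewrite word_act_linearl scalerDr !scalerA mulrC.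
Qed.

Lemma free_actDl t : {morph free_act^~ t : a b / a + b}.
Proof. by move=> a b; rewrite -[a]scale1r free_act_linearl !scale1r. Qed.

Lemma free_act0l t : free_act 0 t = 0.
Proof. by apply: (addrI (free_act 0 t)); rewrite -free_actDl !addr0. Qed.

Lemma free_actZl t c a : free_act (c *: a) t = c *: free_act a t.
Proof. by rewrite -[c *: a]addr0 free_act_linearl free_act0l addr0. Qed.

Lemma free_actM a t1 t2 : free_act a (t1 * t2) = free_act (free_act a t1) t2.
Proof.
rewrite malgME linear_sum /= [in RHS](monalgE t1) [in RHS]linear_sum /=.
rewrite (big_morph _ (free_actDl t2) (free_act0l t2)); apply: eq_bigr => w1 _.
rewrite linear_sum /= [in RHS](monalgE t2) [in RHS]linear_sum /=.
apply: eq_bigr => w2 _.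
rewrite free_actU [X in _ = free_act X _]free_actU free_actZl free_actU.
by rewrite scalerA /word_act fmM foldl_cat.
Qed.

Lemma free_act_uideal t : uideal t -> forall a, free_act a t = 0.
Proof.
elim=> [c x y|x y|{}t u _ IHt _ IHu|t1 {}t t2 _ IH] a.
- by rewrite linearB linearP /= !free_act_gen dact_linear subrr.
- by rewrite !linearB /= !free_actM !free_act_gen dact_lie subrr.
- by rewrite linearD /= IHt IHu addr0.
- by rewrite !free_actM IH free_act0l.
Qed.

Lemma uact_upi a t : uact a (upi t) = free_act a t.
Proof.
by apply/eqP; rewrite -subr_eq0 -linearB /= (free_act_uideal (urep_upi t)).
Qed.

Lemma uact_linear a : linear (uact a).
Proof.
move=> c u v; rewrite -[u]urepK -[v]urepK -upi_linear !uact_upi.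
exact: free_actP.
Qed.

Lemma uact_linearl u : linear (fun a : A => uact a u).
Proof. exact: free_act_linearl. Qed.

Lemma uact1 a : uact a 1 = a.
Proof. by rewrite -[1 : uea L]/(upi 1) uact_upi free_act1. Qed.

Lemma uactM a u v : uact a (u * v) = uact (uact a u) v.
Proof.
rewrite -[u]urepK -[v]urepK -[_ * _]/(umul _ _) -upiM !uact_upi.
exact: free_actM.
Qed.

Lemma uact_uin a x : uact a (uin x) = dact a x.
Proof. by rewrite uact_upi free_act_gen. Qed.

End EnvelopingAction.

(* A basis of U(L) indexed by [ub_index] and containing 1; [lincomb] ranges
   over finite linear combinations. *)
Record uea_basis (F : fieldType) (L : lieAlgType F) := UeaBasis {
  ub_index : choiceType;
  ub_vect :> ub_index -> uea L;
  ub_basis : forall u : uea L, exists! c : malg ub_index F,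
    lincomb ub_vect c = u;
  ub_one : exists i, ub_vect i = 1
}.

Section Codimensions.
Variable F : fieldType.

Local Open Scope classical_set_scope.

Definition span_set (V : lmodType F) (S : set V) : set V :=
  [set v | exists n (c : 'I_n -> F) (w : 'I_n -> V),
    (forall i, S (w i)) /\ v = \sum_(i < n) c i *: w i].

(* e is a basis of P modulo Q, for subspaces Q of P. *)
Definition quot_basis (V : lmodType F) (P Q : set V) n (e : 'I_n -> V) :=
  (forall i, P (e i)) /\
  (forall v, P v -> exists! c : {ffun 'I_n -> F},
     Q (v - \sum_(i < n) c i *: e i)).

(* dim_F (P / Q), for subspaces Q of P such that P / Q is finite dimensional;
   0 if it is not. *)
Definition quot_dim (V : lmodType F) (P Q : set V) : nat :=
  xget 0%N [set n | exists e : 'I_n -> V, quot_basis P Q e].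

(* Evaluation at v of the elements without constant term of the free algebra.
   The value of the empty word is irrelevant. *)
Definition word_eval (A : assocAlgType F) (X : choiceType) (v : X -> A)
    (w : fmonom X) : A :=
  if fmonom_val w is x :: s then foldl (fun a y => amul a (v y)) (v x) s
  else 0.

Definition free_eval (A : assocAlgType F) (X : choiceType) (v : X -> A)
    (f : freeAlg F X) : A := lincomb (word_eval v) f.

(* Algebras are not unital: identities have no constant term. *)
Definition poly_ids (A : assocAlgType F) : set (freeAlg F nat) :=
  [set f | mcoeff mone f = 0 /\ forall a : nat -> A, free_eval a f = 0].

Definition multilinear (n : nat) : set (freeAlg F nat) :=
  span_set [set f | exists s : 'S_n, f = \prod_(k < n) fgen F (s k : nat)].

Definition codim (A : assocAlgType F) (n : nat) : nat :=
  quot_dim (multilinear n) (multilinear n `&` poly_ids A).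

Variables (L : lieAlgType F) (B : uea_basis L).

(* The algebra F<X|L>: the generator (i, j) is x_i^{d_j}. *)
Notation freeLAlg := (freeAlg F (nat * ub_index B)%type).

Definition diff_ids (A : lAlgType L) : set freeLAlg :=
  [set f | mcoeff mone f = 0 /\
    forall a : nat -> A, free_eval (fun g => uact (a g.1) (B g.2)) f = 0].

Definition diff_multilinear (n : nat) : set freeLAlg :=
  span_set [set f | exists (s : 'S_n) (d : 'I_n -> ub_index B),
    f = \prod_(k < n) fgen F (s k : nat, d k)].

Definition diff_codim (A : lAlgType L) (n : nat) : nat :=
  quot_dim (diff_multilinear n) (diff_multilinear n `&` diff_ids A).

End Codimensions.

(* [limn] takes a junk value on divergent sequences; the two sequences below
   are known to converge for finite dimensional A.  Their term at n = 0 is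
   irrelevant. *)
Section Exponents.
Variables (R : realType) (F : fieldType).

Definition exponent (A : assocAlgType F) : R :=
  limn (fun n => (codim A n)%:R `^ n%:R^-1 : R).

Definition diff_exponent (L : lieAlgType F) (B : uea_basis L) 
    (A : lAlgType L) : R :=
  limn (fun n => (diff_codim B A n)%:R `^ n%:R^-1 : R).
End Exponents.

(* Main.v *)
Require Import Defs.
From HB Require Import structures.
From mathcomp Require Import all_classical all_reals.
From mathcomp Require Import topology normedtype sequences exp.
From mathcomp Require Import all_boot all_order all_algebra all_fingroup all_field.
From mathcomp Require Import zify ring lra.
From mathcomp.multinomials Require Import -(notations) monalg.

(** The codimensions and the differential codimensions of A both lie between
    [d ^ n] divided by a polynomial in n and [d ^ n] times a polynomial in n,
    for one and the same integer d ([codim_growth]); so the n-th roots of both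
    converge to d.

    A acts faithfully on F + A by right multiplications. This turns A into an
    algebra of matrices and a derivation into x |-> x D - D x for a matrix D
    ([reg_rep], [reg_rep_der]). The codimensions become the ranks of matrices
    whose rows are the monomials and whose columns are the entries of their
    values at words in a basis of A ([quot_dim_rows]). Ranks do not change under
    field extensions, nor grow under linear substitutions, so the basis may be
    replaced by any spanning family over an extension, and lower bounds may be
    read off from any words in A.

    Structure of A. Let K be an extension of F over which the extension of A has
    as many orthogonal idempotents e_i as possible ([exists_max_idems]). These
    cannot be refined over any further extension, so that each element of e_i A
    e_i is a scalar multiple of e_i plus a nilpotent element. It follows that
    matrix units between equivalent idempotents span A modulo the radical J of
    the trace form ([exists_matrix_units]). In characteristic zero J is a nil
    ideal ([nil_trace_radical]), hence nilpotent, and it is stable under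
    derivations, because traces of commutators vanish ([trace_radical_ad]). The
    integer d is the largest dimension of a sum of distinct simple components of
    A modulo J whose idempotents occur in a nonzero product y0 e_1 y1 e_2 ...
    e_t yt ([exists_best_chain]).

    Upper bound. A derivation maps an idempotent e into A e + e A, so the action
    of U(L) preserves not only J but also the ideals A e A ([der_op_stable]).
    The value of a differential monomial at a word in matrix units and elements
    of J thus vanishes if too many letters are in J, or if the components of the
    other letters are not connected by a nonzero product ([nonzero_word_good]).
    Up to a polynomial factor there are [d ^ n] words left ([card_good_words]).
    Nothing in this argument distinguishes derivations from the identity, which
    is the reason why the two exponents agree.

    Lower bound. Substitute the inner factors of a nonzero product as above for
    some variables, the markers, and matrix units for the others. The monomial
    x_s(1) ... x_s(n), multiplied on both sides by the outer factors, then takes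
    a fixed nonzero value if the matrix units form a path along s, and vanishes
    otherwise ([word_value]). It remains to bound from below the rank of a
    matrix of zeros and ones. Its Gram matrix G satisfies (tr G)^2 <= rank G *
    tr (G G^T) by the Cauchy-Schwarz inequality ([incidence_rank]). Here tr G
    counts the paths, while tr (G G^T) counts the pairs of words that are paths
    along two permutations at once. For each choice of the first permutation the
    second number is at most the sum of the orders of the stabilizers of certain
    pairs of words ([sum_paths_le]). By the Cauchy-Frobenius formula this is the
    order of a group times a number of orbits, which is bounded by a polynomial
    in n ([sum_stab_le]). The lengths of the blocks between the markers are
    chosen by the pigeonhole principle ([pigeonhole_lab]). *)

Set Implicit Arguments.
Unset Strict Implicit.
Unset Printing Implicit Defensive.
Import Order.TTheory GRing.Theory Num.Theory numFieldNormedType.Exports.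
Local Open Scope ring_scope.

(** * Ranks of incidence matrices *)

Section TraceRank.
Variable R : realFieldType.

Lemma mxtrace_mulT m n (A : 'M[R]_(m, n)) :
  \tr (A *m A^T) = \sum_i \sum_j A i j ^+ 2.
Proof.
apply: eq_bigr => i _; rewrite mxE; apply: eq_bigr => j _.
by rewrite mxE expr2.
Qed.

Lemma mxtrace_mulT_ge0 m n (A : 'M[R]_(m, n)) : 0 <= \tr (A *m A^T).
Proof.
by rewrite mxtrace_mulT; do 2!apply: sumr_ge0 => ? _; exact: sqr_ge0.
Qed.

Lemma mxtrace_mulT_eq0 m n (A : 'M[R]_(m, n)) : \tr (A *m A^T) = 0 -> A = 0.
Proof.
rewrite mxtrace_mulT => /eqP.
rewrite psumr_eq0; last by move=> i _; apply: sumr_ge0 => j _; exact: sqr_ge0.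
move=> /allP h; apply/matrixP => i j; rewrite mxE.
have := h i (mem_index_enum _); rewrite /= psumr_eq0; last first.
  by move=> k _; exact: sqr_ge0.
move=> /allP /(_ j (mem_index_enum _)); rewrite /= sqrf_eq0.
by move/eqP.
Qed.

(** If K annihilates C^T C, then the rows of K C^T have norm zero. *)
Lemma gram_unitmx n r (C : 'M[R]_(n, r)) : \rank C = r -> C^T *m C \in unitmx.
Proof.
move=> rC; rewrite -row_free_unit -kermx_eq0; apply/eqP.
set K := kermx _.
have KC : K *m C^T = 0.
  apply: mxtrace_mulT_eq0.
  by rewrite trmx_mul trmxK mulmxA -(mulmxA K) mulmx_ker mul0mx mxtrace0.
have fC : row_free C^T by rewrite /row_free mxrank_tr rC.
by apply: (row_free_inj fC); rewrite KC mul0mx.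
Qed.

(** The orthogonal projection P on the column space of M satisfies P M = M and
    has trace [\rank M], so this is the Cauchy-Schwarz inequality for P and M in
    the Hilbert-Schmidt inner product. *)
Lemma mxtrace_sqr_le_rank n (M : 'M[R]_n) :
  \tr M ^+ 2 <= (\rank M)%:R * \tr (M *m M^T).
Proof.
have [r [C [B [MCB rC ->]]]] : exists r (C : 'M[R]_(n, r)) (B : 'M_(r, n)),
    [/\ M = C *m B, \rank C = r & \rank M = r].
  exists (\rank M), (col_base M), (row_base M); split=> //.
    by rewrite mulmx_base.
  by apply/eqP; exact: col_base_full.
have uG := gram_unitmx rC; set G := C^T *m C in uG.
pose P := C *m invmx G *m C^T.
have PM : P *m M = M.
  rewrite MCB /P !mulmxA -(mulmxA _ C^T C) -/G.
  by rewrite -(mulmxA C) mulVmx // mulmx1.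
have GT : G^T = G by rewrite trmx_mul trmxK.
have PT : P^T = P.
  by rewrite /P !trmx_mul trmxK trmx_inv GT mulmxA.
have PP : P *m P = P.
  by rewrite /P !mulmxA -(mulmxA _ C^T C) -/G -(mulmxA C) mulVmx // mulmx1.
have trP : \tr P = r%:R.
  by rewrite /P -mulmxA mxtrace_mulC -mulmxA -/G mulVmx // mxtrace1.
have [r0|r0] := posnP r.
  have -> : M = 0.
    by apply/matrixP => i j; rewrite MCB !mxE big1 // => k; have := ltn_ord k; rewrite {2}r0.
  by rewrite mxtrace0 expr0n mul0mx mxtrace0 mulr0.
have r0' : (0 : R) < r%:R by rewrite ltr0n.
(* this multiple of P is the projection of M on the line through P *)
pose c := \tr M / r%:R.
have := mxtrace_mulT_ge0 (M - c *: P).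
have -> : \tr ((M - c *: P) *m (M - c *: P)^T) =
    \tr (M *m M^T) - \tr M ^+ 2 / r%:R.
  have -> : (M - c *: P)^T = M^T - c *: P.
    by rewrite -{2}PT; apply/matrixP=> i j; rewrite !mxE.
  rewrite mulmxBl !mulmxBr -!scalemxAl -!scalemxAr PP.
  rewrite !(raddfB (@mxtrace _ _)) /= !mxtraceZ trP.
  have -> : \tr (M *m P) = \tr M by rewrite mxtrace_mulC PM.
  have -> : \tr (P *m M^T) = \tr M.
    by rewrite -mxtrace_tr trmx_mul trmxK PT mxtrace_mulC PM.
  rewrite /c; field; exact: lt0r_neq0.
by rewrite subr_ge0 ler_pdivrMr // mulrC.
Qed.

End TraceRank.

Lemma big_enum_valT (V : nmodType) (T : finType) (F : T -> V) :
  \sum_x F x = \sum_(i < #|T|) F (enum_val i).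
Proof. by rewrite -(big_enum_val (A := T) F); apply: eq_bigl. Qed.

Definition incidence_mx (K : fieldType) (T W : finType) (H : {set T})
    (f : T -> {set W}) : 'M[K]_(#|H|, #|W|) :=
  \matrix_(i, j) (enum_val j \in f (enum_val i))%:R.

(** The Gram matrix of the rows has entries [#|f s :&: f t|], so the two sums are
    its trace and the square of its Hilbert-Schmidt norm. *)
Lemma incidence_rank_rat (T W : finType) (H : {set T}) (f : T -> {set W}) :
  ((\sum_(s in H) #|f s|) ^ 2 <=
   \rank (incidence_mx rat H f) *
     \sum_(s in H) \sum_(t in H) #|f s :&: f t| ^ 2)%N.
Proof.
set V := incidence_mx rat H f.
have GE i j : (V *m V^T) i j = #|f (enum_val i) :&: f (enum_val j)|%:R.
  have -> : #|f (enum_val i) :&: f (enum_val j)|%:R =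
    \sum_(k : W) ((k \in f (enum_val i)) && (k \in f (enum_val j)))%:R :> rat.
    rewrite -sum1_card natr_sum big_mkcond /=.
    by apply: eq_bigr => k _; rewrite inE; case: ifP.
  rewrite mxE; apply: etrans (esym (big_enum_valT _)); apply: eq_bigr => k _.
  by rewrite !mxE -natrM mulnb.
have h1 := mxtrace_sqr_le_rank (V *m V^T).
rewrite -(ler_nat rat) natrX natrM !natr_sum.
have -> : \sum_(s in H) #|f s|%:R = \tr (V *m V^T).
  rewrite big_enum_val; apply: eq_bigr => i _.
  by rewrite GE setIid.
apply: le_trans h1 _.
have -> : \tr (V *m V^T *m (V *m V^T)^T) =
    \sum_(s in H) (\sum_(t in H) #|f s :&: f t| ^ 2)%N%:R.
  rewrite mxtrace_mulT; apply: esym; rewrite big_enum_val; apply: eq_bigr => i _.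
  rewrite natr_sum big_enum_val; apply: eq_bigr => j _.
  by rewrite GE natrX.
apply: ler_wpM2r; first by apply: sumr_ge0 => s _; exact: ler0n.
by rewrite ler_nat; exact: mxrankM_maxl.
Qed.

Section CharZero.
Variables (K : fieldType) (charK : [pchar K] =i pred0).

Lemma intr_eq0_char0 (z : int) : (z%:~R == 0 :> K) = (z == 0).
Proof.
have nat0 n : (n%:R == 0 :> K) = (n == 0)%N by exact: (pcharf0P K).1.
case: z => n; first by rewrite -pmulrn nat0.
by rewrite NegzE mulrNz oppr_eq0 -pmulrn nat0 oppr_eq0.
Qed.

Lemma ratrE_char0 (x : rat) (a b : int) : b != 0 -> x = a%:~R / b%:~R ->
  ratr x = a%:~R / b%:~R :> K.
Proof.
move=> b0 xE.
have d0 : (denq x)%:~R != 0 :> K by rewrite intr_eq0_char0 denq_eq0.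
have b0' : b%:~R != 0 :> K by rewrite intr_eq0_char0.
rewrite /ratr; apply/eqP; rewrite eqr_div // -!intrM; apply/eqP; congr (_%:~R).
apply: (@intr_inj rat); rewrite !intrM numqE {1}xE.
by rewrite mulrAC divfK ?intr_eq0.
Qed.

Lemma ratr_zmod_char0 : zmod_morphism (@ratr K).
Proof.
move=> x y.
have dx : (denq x)%:~R != 0 :> K by rewrite intr_eq0_char0 denq_eq0.
have dy : (denq y)%:~R != 0 :> K by rewrite intr_eq0_char0 denq_eq0.
have qx : (denq x)%:~R != 0 :> rat by rewrite intr_eq0 denq_eq0.
have qy : (denq y)%:~R != 0 :> rat by rewrite intr_eq0 denq_eq0.
rewrite (@ratrE_char0 (x - y) (numq x * denq y - numq y * denq x)
  (denq x * denq y)) ?mulf_neq0 ?denq_eq0 //.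
  rewrite /ratr rmorphB /= !intrM; field; exact/andP.
rewrite rmorphB /= !intrM -{1}(divq_num_den x) -{1}(divq_num_den y).
field; exact/andP.
Qed.

Lemma ratr_monoid_char0 : monoid_morphism (@ratr K).
Proof.
split=> [|x y]; first by rewrite (@ratrE_char0 1 1 1) ?divr1.
have dx : (denq x)%:~R != 0 :> K by rewrite intr_eq0_char0 denq_eq0.
have dy : (denq y)%:~R != 0 :> K by rewrite intr_eq0_char0 denq_eq0.
have qx : (denq x)%:~R != 0 :> rat by rewrite intr_eq0 denq_eq0.
have qy : (denq y)%:~R != 0 :> rat by rewrite intr_eq0 denq_eq0.
rewrite (@ratrE_char0 (x * y) (numq x * numq y)
  (denq x * denq y)) ?mulf_neq0 ?denq_eq0 //.
  rewrite /ratr !intrM; field; exact/andP.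
rewrite !intrM -{1}(divq_num_den x) -{1}(divq_num_den y).
field; exact/andP.
Qed.

(** The embedding of the rationals carries the bound, which is proved in an
    ordered field, to any field of characteristic zero. *)
Definition ratr_char0 := @ratr K.
HB.instance Definition _ :=
  GRing.isZmodMorphism.Build rat K ratr_char0 ratr_zmod_char0.
HB.instance Definition _ :=
  GRing.isMonoidMorphism.Build rat K ratr_char0 ratr_monoid_char0.

Lemma incidence_rank (T W : finType) (H : {set T}) (f : T -> {set W}) :
  ((\sum_(s in H) #|f s|) ^ 2 <=
   \rank (incidence_mx K H f) *
     \sum_(s in H) \sum_(t in H) #|f s :&: f t| ^ 2)%N.
Proof.
have -> : incidence_mx K H f =
    map_mx ratr_char0 (incidence_mx rat H f).
  by apply/matrixP => i j; rewrite !mxE rmorph_nat.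
by rewrite mxrank_map; exact: incidence_rank_rat.
Qed.

End CharZero.

(** * Words and their contents *)

Section Combinatorics.
Local Open Scope nat_scope.

Section Content.
Variable N : nat.

(** The multiplicities of the letters of a word. Two words have the same content
    if and only if they are conjugate under the symmetric group; there are
    polynomially many contents. *)
Definition content (T : finType) (R : {ffun 'I_N -> T}) : {ffun T -> 'I_N.+1} :=
  [ffun x => inord #|[set p | R p == x]|].

Lemma contentE (T : finType) (R : {ffun 'I_N -> T}) x :
  content R x = #|[set p | R p == x]| :> nat.
Proof.
rewrite ffunE inordK // ltnS; apply: leq_trans (max_card _) _.
by rewrite card_ord.
Qed.

Lemma content_perm (T : finType) (R R' : {ffun 'I_N -> T}) :
  content R = content R' -> exists s : 'S_N, forall p, R' p = R (s p).
Proof.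
move=> eqR.
have cnt (Q : {ffun 'I_N -> T}) x :
    count_mem x [tuple Q i | i < N] = content Q x.
  rewrite contentE count_map -sum1_count -sum1_card big_enum_cond /=.
  by apply: eq_bigl => p; rewrite inE.
have /tuple_permP[s hs] :
    perm_eq [tuple R' i | i < N] [tuple R i | i < N].
  apply/allP => x _ /=; apply/eqP.
  by rewrite (cnt R') (cnt R) eqR.
exists s => p.
have := congr1 (fun u => nth (R' p) u p) hs.
by rewrite -!tnth_nth !tnth_mktuple.
Qed.

Lemma content_comp (T : finType) (R : {ffun 'I_N -> T}) (s : 'S_N) :
  content [ffun p => R (s p)] = content R.
Proof.
apply/ffunP => x; apply: val_inj; rewrite /= !contentE.
rewrite -[RHS](card_imset _ (@perm_inj _ (s^-1)%g)).
apply: eq_card => p; rewrite !inE ffunE.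
apply/eqP/imsetP => [<-|[q]].
  by exists (s p); rewrite ?inE ?permK.
by rewrite inE => /eqP <- ->; rewrite permKV.
Qed.

Lemma card_factor (T U V : finType) (A : {set T}) (f : T -> U) (g : T -> V) :
  {in A &, forall x y, g x = g y -> f x = f y} ->
  #|[set f x | x in A]| <= #|[set g x | x in A]|.
Proof.
move=> h; have [->|[x0 x0A]] := set_0Vmem A; first by rewrite !imset0 !cards0.
pose k v := if [pick x in A | g x == v] is Some x then f x else f x0.
suff -> : [set f x | x in A] = [set k v | v in [set g x | x in A]].
  exact: leq_imset_card.
rewrite -imset_comp; apply: eq_in_imset => x xA /=.
rewrite /k; case: pickP => [y /andP[yA /eqP e]|/(_ x)]; first exact: h.
by rewrite xA eqxx.
Qed.

Section Action.
Variable T : finType.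
Implicit Type R : {ffun 'I_N -> T}.

Definition word_perm R (s : 'S_N) : {ffun 'I_N -> T} :=
  [ffun p => R (s^-1 p)%g].

Fact word_perm_is_action : is_action [set: 'S_N] word_perm.
Proof.
split=> [s R R' /ffunP h|R s s' _ _].
  by apply/ffunP => p; have := h (s p); rewrite !ffunE permK.
by apply/ffunP => p; rewrite !ffunE invMg permM.
Qed.

Definition word_action := Action word_perm_is_action.

End Action.

(** A permutation that fixes a word over l fixes l. So this is the
    Cauchy-Frobenius formula for the stabilizer of l acting on the words over l:
    the orbits are determined by the contents, and the orbit of l consists of the
    words with its content. *)
Lemma sum_stab_le (L T : finType) (P : T -> L -> bool) (l : {ffun 'I_N -> L}) :
  (forall x a b, P x a -> P x b -> a = b) ->
  (\sum_(R : {ffun 'I_N -> T} | [forall p, P (R p) (l p)])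
     #|[set s : 'S_N | [forall p, R (s p) == R p]]|) *
  #|[set m : {ffun 'I_N -> L} | content m == content l]| <=
  N`! * N.+1 ^ #|T|.
Proof.
move=> Pfun.
pose S := [set R : {ffun 'I_N -> T} | [forall p, P (R p) (l p)]].
pose G := ('C_[set: 'S_N][l | word_action L])%G.
have inG s : (s \in G) = [forall p, l (s p) == l p].
  rewrite inE in_setT /= [LHS]andTb.
  apply/astab1P/forallP => [/ffunP h p|h]; last first.
    apply/ffunP => p; rewrite ffunE.
    by have /eqP <- := h ((s^-1)%g p); rewrite permKV.
  by have := h (s p); rewrite ffunE permK => <-.
have actsG : [acts G, on S | word_action T].
  apply/subsetP => s sG; rewrite !inE /=; apply/subsetP => R.
  rewrite !inE => /forallP h; apply/forallP => p; rewrite ffunE.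
  have := sG; rewrite inG => /forallP /(_ ((s^-1)%g p)).
  by rewrite permKV => /eqP ->.
have sumE : \sum_(R : {ffun 'I_N -> T} | [forall p, P (R p) (l p)])
     #|[set s : 'S_N | [forall p, R (s p) == R p]]| =
   \sum_(s in G) #|'Fix_(S | word_action T)[s]%g|.
  transitivity (\sum_(R in S) \sum_(s in G) ([forall p, R (s p) == R p] : nat)).
    apply: eq_big => [R|R hR]; first by rewrite inE.
    rewrite -sum1_card big_mkcond [in RHS]big_mkcond /=.
    apply: eq_bigr => s _; rewrite inE; case: ifP => [/forallP h|_].
      rewrite inG (_ : [forall p, _]) //; apply/forallP => p; apply/eqP.
      apply: (Pfun (R p)); last exact: (forallP hR).
      by rewrite -(eqP (h p)); exact: (forallP hR).
    by case: ifP.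
  rewrite exchange_big /=; apply: eq_bigr => s sG.
  rewrite -sum1_card big_mkcond [in RHS]big_mkcond /=.
  apply: eq_bigr => R _; rewrite in_setI; case: (boolP (R \in S)) => //= _.
  have -> : (R \in afix (word_action T) [set s]) = [forall p, R (s p) == R p].
    apply/afix1P/forallP => [/ffunP h p|h].
      by have := h (s p); rewrite ffunE permK => <-.
    by apply/ffunP => p; rewrite ffunE; have /eqP <- := h ((s^-1)%g p); rewrite permKV.
  by case: ifP.
rewrite sumE (Frobenius_Cauchy actsG) -mulnA.
have orbG : #|G| * #|[set m : {ffun 'I_N -> L} | content m == content l]| <= N`!.
  have := card_orbit_stab (word_action L) [set: 'S_N]%G l.
  rewrite -/G cardsT card_Sn => <-; rewrite mulnC leq_mul2r; apply/orP; right.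
  apply: subset_leq_card; apply/subsetP => m; rewrite inE => /eqP h.
  have [s hs] := content_perm (esym h).
  apply/orbitP; exists (s^-1)%g; rewrite ?inE //.
  by apply/ffunP => p; rewrite ffunE invgK hs.
rewrite mulnC; apply: leq_mul => //.
apply: leq_trans (card_factor (g := @content T) _) _ => [R R'|]; last first.
  by apply: leq_trans (max_card _) _; rewrite card_ffun card_ord.
rewrite !inE => /forallP hR /forallP hR' eqc.
have [s hs] := content_perm eqc.
apply/orbit_eqP/orbitP; exists s.
  rewrite inG; apply/forallP => p; apply/eqP; apply: (Pfun (R (s p))) => //.
  by rewrite -hs.
by apply/ffunP => p; rewrite ffunE hs permKV.
Qed.

End Content.

(** * Closed paths through words *)

Section Paths.
Variables (I : finType) (t : nat) (cl : I -> 'I_t.+1) (base : 'I_t.+1 -> I).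
Hypothesis clbase : cancel base cl.
Variables (n : nat) (lab : {ffun 'I_n.+1 -> 'I_t.+1}).

(** The positions of a word are arranged in a cycle, so that the condition at the end
    of the last block has the same form as at the end of the other blocks. *)
Definition cnext : 'S_n.+1 := perm (@ordS_inj n.+1).
Definition cprev : 'S_n.+1 := (cnext^-1)%g.

Lemma cnextK : cancel cnext cprev.
Proof. exact: permK. Qed.

Lemma cprevK : cancel cprev cnext.
Proof. exact: permKV. Qed.

Lemma cnextE (p : 'I_n.+1) : cnext p = p.+1 %% n.+1 :> nat.
Proof. by rewrite permE. Qed.

Lemma cprev_neq0 (p : 'I_n.+1) : p != ord0 -> p = (cprev p).+1 :> nat.
Proof.
move=> p0; have h := cnextE (cprev p); rewrite cprevK in h.
move: (cprev p) h => q h.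
have [qn|] := ltnP q.+1 n.+1; first by rewrite modn_small in h.
move=> qn; have qE : q.+1 = n.+1 by apply/eqP; rewrite eqn_leq qn ltn_ord.
by move: p0; rewrite -val_eqE /= h qE modnn.
Qed.

(** Markers separate the blocks of constant label. The first position is one even if
    all labels are equal, so that each path has a prescribed start. *)
Definition marker (p : 'I_n.+1) := (p == ord0) || (lab (cprev p) != lab p).
(** Holds for sorted words of labels, whose blocks have distinct labels. *)
Hypothesis markers_le : #|[set p | marker p]| <= t.+1.

Lemma lab_cprev p : ~~ marker p -> lab (cprev p) = lab p.
Proof. by rewrite negb_or negbK => /andP[_ /eqP]. Qed.

(** The letters of a word are edges of the graph that joins i to j when
    [cl i = cl j]; the letter at a marker is a fixed edge from one class to the
    next. *)
Definition admissible (w : {ffun 'I_n.+1 -> I * I}) :=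
  [forall p, if marker p then w p == (base (lab (cprev p)), base (lab p))
             else cl (w p).1 == cl (w p).2].

Definition closed_path (s : 'S_n.+1) (w : {ffun 'I_n.+1 -> I * I}) :=
  [forall p, (w (s p)).2 == (w (s (cnext p))).1].

Definition paths (s : 'S_n.+1) : {set {ffun 'I_n.+1 -> I * I}} :=
  [set w | admissible w && closed_path s w].

Definition fix_markers : {set 'S_n.+1} :=
  [set s | perm_on [set p | ~~ marker p] s].

Lemma fix_markersP s p : s \in fix_markers -> marker p -> s p = p.
Proof. by rewrite inE => sH mp; apply: (out_perm sH); rewrite inE mp. Qed.

Lemma marker_perm s p : s \in fix_markers -> marker (s p) = marker p.
Proof.
by rewrite inE => /(@perm_closed _ _ _ p); rewrite !inE => /negb_inj.
Qed.

Lemma marker0 : marker ord0.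
Proof. by rewrite /marker eqxx. Qed.

(** Fixing boundedly many points costs only a polynomial factor. *)
Lemma card_fix_markers : n.+1`! <= n.+1 ^ t.+1 * #|fix_markers|.
Proof.
have -> : #|fix_markers| = (#|[set p | ~~ marker p]|)`!.
  by rewrite -card_perm; apply: eq_card => s; rewrite inE.
set m := #|_|.
have mE : #|[set p | marker p]| + m = n.+1.
  rewrite -[RHS](card_ord n.+1) -(cardsC [set p | marker p]).
  by congr (_ + _); apply: eq_card => p; rewrite !inE.
have mn : m <= n.+1 by rewrite -mE leq_addl.
rewrite -(bin_fact mn) mulnCA mulnC leq_mul2r; apply/orP; right.
have -> : n.+1 - m = #|[set p | marker p]| by apply/eqP; rewrite -(eqn_add2r m) subnK // mE.
have := markers_le; move: (#|[set p | marker p]|) mE => k mE kt.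
have -> : 'C(n.+1, m) = 'C(n.+1, k) by rewrite -mE -bin_sub ?leq_addl // addnK.
rewrite bin_ffact; apply: leq_trans (leq_pexp2l _ kt) => //.
elim: k {mE kt} => [|k IH]; first by rewrite ffactn0.
by rewrite ffactnSr expnSr; apply: leq_mul => //; exact: leq_subr.
Qed.

Lemma admissible_marker w p : admissible w -> marker p ->
  w p = (base (lab (cprev p)), base (lab p)).
Proof. by move=> /forallP /(_ p); case: ifP => // _ /eqP. Qed.

Lemma admissible_edge w p : admissible w -> ~~ marker p ->
  cl (w p).1 = cl (w p).2.
Proof. by move=> /forallP /(_ p); case: ifP => // _ /eqP. Qed.

(** By induction on the position: the class can only change at a marker, where the
    letter is prescribed. *)
Lemma paths_lab s w p : s \in fix_markers -> w \in paths s ->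
  cl (w (s p)).2 = lab p.
Proof.
move=> sH; rewrite inE => /andP[aw /forallP pw].
elim: {p}(val p) {-2}p (erefl (val p)) => [|k IH] p pk.
  have -> : p = ord0 by apply: val_inj.
  rewrite (fix_markersP sH marker0) (admissible_marker aw marker0) /=.
  exact: clbase.
have [mp|mp] := boolP (marker p).
  by rewrite (fix_markersP sH mp) (admissible_marker aw mp) /= clbase.
have p0 : p != ord0 by rewrite -val_eqE /= pk.
have ps : cl (w (s (cprev p))).2 = lab p.
  by rewrite IH ?lab_cprev //; apply: succn_inj; rewrite -cprev_neq0.
rewrite -ps (eqP (pw (cprev p))) cprevK (admissible_edge aw) // marker_perm //.
Qed.

(** Along a closed path the second ends of the edges can be chosen freely in
    the class of their label, except at the at most [2 * t.+1] positions next
    to a marker. *)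
Lemma card_paths s : s \in fix_markers ->
  \prod_p #|[set i | cl i == lab p]| <= #|I| ^ (2 * t.+1) * #|paths s|.
Proof.
move=> sH; pose forced p := marker p || marker (cnext p).
(* the values allowed for the second end of the edge at position p *)
pose Fm p : pred I :=
  if forced p then pred1 (base (lab p)) else [pred i | cl i == lab p].
have I_gt0 : 0 < #|I| by apply/card_gt0P; exists (base ord0).
have le1 : \prod_p #|[set i | cl i == lab p]| <=
    \prod_p ((if forced p then #|I| else 1) * #|Fm p|).
  apply: leq_prod => p _; rewrite /Fm; case: ifP => _.
    by rewrite card1 muln1 max_card.
  by rewrite mul1n; apply: subset_leq_card; apply/subsetP => i; rewrite inE.
apply: leq_trans le1 _; rewrite big_split /= leq_mul //.
  rewrite -big_mkcond /= prod_nat_const leq_pexp2l //.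
  have -> : #|[pred p | forced p]| =
      #|[set p | marker p] :|: cnext @^-1: [set p | marker p]|.
    by apply: eq_card => p; rewrite !inE.
  apply: leq_trans (leq_card_setU _ _) _.
  rewrite card_preimset; last exact: perm_inj.
  by rewrite mul2n -addnn leq_add.
have -> : \prod_p #|Fm p| = #|family Fm|.
  by rewrite card_family foldrE big_map big_enum.
pose mk (g : {ffun 'I_n.+1 -> I}) : {ffun 'I_n.+1 -> I * I} :=
  [ffun q => (g (cprev ((s^-1)%g q)), g ((s^-1)%g q))].
have mk_inj : injective mk.
  move=> g g' /ffunP h; apply/ffunP => p.
  by have := h (s p); rewrite !ffunE permK => -[].
rewrite -(card_imset _ mk_inj); apply: subset_leq_card.
apply/subsetP => _ /imsetP[g /familyP gF ->].
have gforced p : forced p -> g p = base (lab p).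
  by move=> fp; have := gF p; rewrite /Fm fp => /eqP.
have glab p : cl (g p) = lab p.
  have := gF p; rewrite /Fm; case: ifP => _; last by move/eqP.
  by move=> /eqP ->; rewrite clbase.
rewrite inE; apply/andP; split; last first.
  by apply/forallP => p; rewrite !ffunE /= !permK eqxx.
apply/forallP => p; rewrite ffunE /=; case: ifP => mp.
  have -> : (s^-1)%g p = p by rewrite -{1}(fix_markersP sH mp) permK.
  by rewrite !gforced // /forced ?cprevK ?mp ?orbT.
rewrite !glab lab_cprev //.
by rewrite -(marker_perm _ sH) permKV mp.
Qed.

Definition path_next (s : 'S_n.+1) : 'S_n.+1 := (s^-1 * cnext * s)%g.

Lemma path_nextE s p : path_next s (s p) = s (cnext p).
Proof. by rewrite !permM permK. Qed.

(** [path_next s] is a conjugate of the long cycle [cnext], and [s] fixes the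
    first position. *)
Lemma path_next_inj : {in fix_markers &, injective path_next}.
Proof.
move=> s s' sH s'H eqn; apply/permP => p.
elim: {p}(val p) {-2}p (erefl (val p)) => [|k IH] p pk.
  have -> : p = ord0 by apply: val_inj.
  by rewrite !(fix_markersP _ marker0).
have p0 : p != ord0 by rewrite -val_eqE /= pk.
rewrite -(cprevK p) -!path_nextE eqn IH //.
by apply: succn_inj; rewrite -cprev_neq0.
Qed.

Lemma paths_next s w q : w \in paths s -> (w (path_next s q)).1 = (w q).2.
Proof.
rewrite inE => /andP[_ /forallP /(_ ((s^-1)%g q)) /eqP].
by rewrite permKV => ->; rewrite !permM.
Qed.

Definition over_lab (s : 'S_n.+1) (x : I * I) (l : 'I_t.+1) :=
  (cl x.1 == l) && (cl x.2 == l).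

(** A pair of words that are paths both along [s] and along [s'] is determined
    by the second ends of its edges, which are invariant under the permutation
    [path_next s * (path_next s')^-1]; the latter determines [s']. *)
Lemma sum_paths_le s : s \in fix_markers ->
  \sum_(s' in fix_markers) #|paths s :&: paths s'| ^ 2 <=
  \sum_(R : {ffun 'I_n.+1 -> I * I} |
        [forall p, over_lab s (R p) ([ffun p => lab ((s^-1)%g p)] p)])
     #|[set u : 'S_n.+1 | [forall p, R (u p) == R p]]|.
Proof.
move=> sH; pose th s' : 'S_n.+1 := (path_next s * (path_next s')^-1)%g.
have th_inj : {in fix_markers &, injective th}.
  by move=> a b aH bH /mulgI /invg_inj; apply: path_next_inj.
pose V (R : {ffun 'I_n.+1 -> I * I}) :=
  [forall p, over_lab s (R p) ([ffun p => lab ((s^-1)%g p)] p)].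
pose X (u : 'S_n.+1) := [set R : {ffun 'I_n.+1 -> I * I} |
  V R && [forall p, R (u p) == R p]].
have le1 s' : s' \in fix_markers -> #|paths s :&: paths s'| ^ 2 <= #|X (th s')|.
  move=> s'H; rewrite -mulnn -cardsX.
  pose mk (ww : {ffun 'I_n.+1 -> I * I} * {ffun 'I_n.+1 -> I * I}) :
    {ffun 'I_n.+1 -> I * I} := [ffun p => ((ww.1 p).2, (ww.2 p).2)].
  rewrite -(@card_in_imset _ _ mk); last first.
    move=> [a b] [a' b']; rewrite !in_setX !in_setI /= => /andP[].
    move=> /andP[ap _] /andP[bp _] /andP[/andP[ap' _] /andP[bp' _]] /ffunP h.
    have h2 p : (a p).2 = (a' p).2 /\ (b p).2 = (b' p).2.
      by have := h p; rewrite !ffunE /= => -[-> ->].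
    have ext c c' : c \in paths s -> c' \in paths s ->
        (forall p, (c p).2 = (c' p).2) -> c = c'.
      move=> cp cp' e; apply/ffunP => p; rewrite [LHS]surjective_pairing.
      rewrite [RHS]surjective_pairing e; congr (_, _).
      by rewrite -(permKV (path_next s) p) !paths_next.
    have -> : a = a' by apply: ext => // p; have [] := h2 p.
    by have -> : b = b' by apply: ext => // p; have [] := h2 p.
  apply: subset_leq_card; apply/subsetP => _ /imsetP[[a b] + ->].
  rewrite !in_setX !in_setI /= => /andP[/andP[ap ap'] /andP[bp bp']].
  rewrite inE; apply/andP; split; apply/forallP => p; last first.
    rewrite !ffunE /=.
    have e c : c \in paths s -> c \in paths s' -> (c (th s' p)).2 = (c p).2.
      move=> cp cp'; rewrite -(paths_next _ cp') /th permM permKV.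
      by rewrite (paths_next _ cp).
    by rewrite !e.
  have e c : c \in paths s -> cl (c p).2 = lab ((s^-1)%g p).
    by move=> cp; have := @paths_lab s c ((s^-1)%g p) sH cp; rewrite permKV.
  by rewrite /over_lab !ffunE /= !e ?eqxx.
apply: (@leq_trans (\sum_(s' in fix_markers) #|X (th s')|)).
  exact: leq_sum.
rewrite -(big_imset (fun u => #|X u|) th_inj) /=.
have -> : \sum_(R | V R) #|[set u : 'S_n.+1 | [forall p, R (u p) == R p]]| =
    \sum_(u : 'S_n.+1) #|X u|.
  transitivity (\sum_(R | V R) \sum_(u : 'S_n.+1) ([forall p, R (u p) == R p] : nat)).
    apply: eq_bigr => R _; rewrite -sum1_card big_mkcond /=.
    by apply: eq_bigr => u _; rewrite inE; case: ifP.
  rewrite exchange_big /=; apply: eq_bigr => u _.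
  rewrite -sum1_card big_mkcond [RHS]big_mkcond /=.
  apply: eq_bigr => R _.
  have -> : (R \in X u) = V R && [forall p, R (u p) == R p] by rewrite inE.
  by case: (V R) => //=; case: [forall p, _].
by rewrite [leqRHS](bigID [in [set th x | x in fix_markers]]) /= leq_addr.
Qed.

Variables (K : fieldType) (charK : [pchar K]%R =i pred0).

(** In [incidence_rank] the diagonal sum is at least the order of [fix_markers] times
    the number of paths, and each inner sum is at most the order of a stabilizer
    times a number of orbits. The quotient of the two group orders is the number of
    words with the content of [lab], up to a polynomial factor. *)
Lemma path_rank :
  (\prod_p #|[set i | cl i == lab p]|) ^ 2 *
    #|[set m : {ffun 'I_n.+1 -> 'I_t.+1} | content m == content lab]| <=
  #|I| ^ (4 * t.+1) * n.+1 ^ t.+1 * n.+2 ^ (#|I| * #|I|) *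
    \rank (incidence_mx K fix_markers paths).
Proof.
set Pi := \prod_p _; set M := #|[set m | _]|; set H := fix_markers.
set r := \rank _; set e := #|I| ^ _.
have S1 : #|H| * Pi <= #|I| ^ (2 * t.+1) * \sum_(s in H) #|paths s|.
  rewrite -sum_nat_const big_distrr /=; apply: leq_sum => s sH.
  exact: card_paths.
have S2 : (\sum_(s in H) \sum_(s' in H) #|paths s :&: paths s'| ^ 2) * M <=
    #|H| * (n.+1`! * n.+2 ^ (#|I| * #|I|)).
  apply: (@leq_trans (\sum_(s in H) (n.+1`! * n.+2 ^ (#|I| * #|I|))));
    last by rewrite sum_nat_const.
  rewrite big_distrl /=; apply: leq_sum => s sH.
  apply: leq_trans (leq_mul (sum_paths_le sH) (leqnn M)) _.
  set l : {ffun 'I_n.+1 -> 'I_t.+1} := [ffun p => lab ((s^-1)%g p)].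
  have -> : M = #|[set m : {ffun 'I_n.+1 -> 'I_t.+1} | content m == content l]|.
    by apply: eq_card => m; rewrite !inE content_comp.
  rewrite -card_prod; apply: sum_stab_le => x a b.
  by rewrite /over_lab => /andP[/eqP <- _] /andP[/eqP <- _].
have H_gt0 : 0 < #|H|.
  by apply/card_gt0P; exists 1%g; rewrite inE perm_on1.
have rk := incidence_rank charK H paths; rewrite -/r in rk.
set S := \sum_(s in H) #|paths s| in S1 rk.
set Q := \sum_(s in H) _ in S2 rk.
have h1 : (#|H| * Pi) ^ 2 * M <= e * (r * Q) * M.
  rewrite leq_mul2r; apply/orP; right.
  apply: (@leq_trans ((#|I| ^ (2 * t.+1) * S) ^ 2)); first by rewrite leq_sqr.
  by rewrite expnMn -expnM mulnAC leq_mul2l rk orbT.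
have h2 : e * (r * Q) * M <= e * r * (#|H| * (n.+1 ^ t.+1 * #|H| * n.+2 ^ (#|I| * #|I|))).
  rewrite mulnA -mulnA leq_mul2l; apply/orP; right.
  apply: leq_trans S2 _; rewrite leq_mul2l leq_mul2r card_fix_markers.
  by rewrite !orbT.
have := leq_trans h1 h2.
rewrite expnMn.
have -> : #|H| ^ 2 * Pi ^ 2 * M = (Pi ^ 2 * M) * (#|H| ^ 2) by lia.
have -> : e * r * (#|H| * (n.+1 ^ t.+1 * #|H| * n.+2 ^ (#|I| * #|I|))) =
  (e * n.+1 ^ t.+1 * n.+2 ^ (#|I| * #|I|) * r) * #|H| ^ 2 by lia.
by rewrite leq_pmul2r // expn_gt0 H_gt0.
Qed.

End Paths.

Section SortedLabels.
Variables (t n : nat).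

Definition nondecreasing_lab (lab : {ffun 'I_n.+1 -> 'I_t.+1}) :=
  forall p q : 'I_n.+1, p <= q -> lab p <= lab q.

Definition onto_lab (lab : {ffun 'I_n.+1 -> 'I_t.+1}) :=
  [forall l, exists p, lab p == l].

Lemma sort_lab (lab : {ffun 'I_n.+1 -> 'I_t.+1}) :
  exists2 lab' : {ffun 'I_n.+1 -> 'I_t.+1},
    content lab' = content lab & nondecreasing_lab lab'.
Proof.
pose le (a b : 'I_t.+1) := a <= b.
have le_total : total le by move=> a b; exact: leq_total.
have le_trans : transitive le by move=> a b c; exact: leq_trans.
pose s := sort le (codom lab).
have sz : size s = n.+1 by rewrite size_sort size_codom card_ord.
have srt : sorted le s by exact: sort_sorted.
pose lab' : {ffun 'I_n.+1 -> 'I_t.+1} := [ffun p => nth ord0 s (val p)].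
have cod : codom lab' = s.
  apply: (@eq_from_nth _ ord0); rewrite ?size_codom ?card_ord ?sz // => i lti.
  rewrite (nth_map ord0) ?size_enum_ord // ffunE.
  by congr (nth _ _ _); exact: nth_enum_ord.
exists lab'.
  apply/ffunP => x; apply: val_inj; rewrite /= !contentE.
  have cnt (Q : {ffun 'I_n.+1 -> 'I_t.+1}) :
      #|[set p | Q p == x]| = count_mem x (codom Q).
    rewrite count_map -sum1_count -sum1_card big_enum_cond /=.
    by apply: eq_bigl => p; rewrite inE.
  by rewrite !cnt cod; have /seq.permP -> : perm_eq s (codom lab) by rewrite perm_sort.
move=> p q pq; rewrite !ffunE.
have le_refl : reflexive le by move=> a; exact: leqnn.
by apply: (sorted_leq_nth le_trans le_refl ord0 srt); rewrite ?inE ?sz ?ltn_ord.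
Qed.

Lemma onto_content (lab lab' : {ffun 'I_n.+1 -> 'I_t.+1}) :
  content lab = content lab' -> onto_lab lab -> onto_lab lab'.
Proof.
move=> /content_perm[s hs] /forallP h; apply/forallP => l.
have /existsP[p /eqP <-] := h l; apply/existsP; exists ((s^-1)%g p).
by rewrite hs permKV.
Qed.

Section Sorted.
Variable lab : {ffun 'I_n.+1 -> 'I_t.+1}.
Hypotheses (mono : nondecreasing_lab lab) (onto : onto_lab lab).

Lemma lab_first : lab ord0 = ord0.
Proof.
have /existsP[p /eqP pE] := forallP onto ord0.
by apply: val_inj; apply/eqP; rewrite /= -leqn0 -[0]/(val (@ord0 t)) -pE mono.
Qed.

Lemma lab_last : lab ord_max = ord_max.
Proof.
have /existsP[p /eqP pE] := forallP onto ord_max.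
apply: val_inj; apply/eqP; rewrite /= eqn_leq -ltnS ltn_ord /=.
by rewrite -[X in X <= _]/(val (@ord_max t)) -pE mono // -ltnS ltn_ord.
Qed.

(** Otherwise the label in between would not occur. *)
Lemma lab_marker (p : 'I_n.+1) : marker lab p -> p != ord0 ->
  lab p = (lab (cprev n p)).+1 :> nat.
Proof.
rewrite /marker => + p0; rewrite (negbTE p0) /= => neq.
have pE := cprev_neq0 p0.
have lt : lab (cprev n p) < lab p.
  by rewrite ltn_neqAle neq /= mono // pE.
apply/eqP; rewrite eqn_leq lt andbT leqNgt; apply/negP => lt2.
have [l lE] : exists l : 'I_t.+1, l = (lab (cprev n p)).+1 :> nat.
  by exists (Ordinal (ltn_trans lt2 (ltn_ord _))).
have /existsP[q /eqP qE] := forallP onto l.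
have [pq|qp] := leqP p q.
  by have := mono pq; rewrite qE lE leqNgt lt2.
have : q <= cprev n p by rewrite -ltnS -pE.
by move/mono; rewrite qE lE ltnn.
Qed.

Lemma card_marker : #|[set p | marker lab p]| <= t.+1.
Proof.
rewrite -[leqRHS](card_ord t.+1).
apply: (@leq_card_in _ _ lab) => p q; rewrite !inE => mp mq e.
wlog pq : p q mp mq e / p < q.
  move=> W; case: (ltngtP p q) => [pq|pq|/val_inj //]; first exact: W.
  by apply/esym/W.
have q0 : q != ord0 by rewrite -val_eqE -lt0n /=; exact: leq_ltn_trans pq.
have := lab_marker mq q0; rewrite -e => lE.
have : p <= cprev n q by rewrite -ltnS -(cprev_neq0 q0).
by move/mono; rewrite lE ltnn.
Qed.

End Sorted.
End SortedLabels.

(** Expanding the power gives the sum of the products over all words of labels, and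
    a word and its rearrangements contribute equally. There are polynomially many
    contents, so one of them contributes its share. The words that begin with each
    label once ensure that every label occurs. *)
Lemma pigeonhole_lab t n (k : 'I_t.+1 -> nat) : (forall l, 0 < k l) ->
  exists lab : {ffun 'I_(t + n).+1 -> 'I_t.+1},
    [/\ nondecreasing_lab lab, onto_lab lab &
     (\sum_l k l ^ 2) ^ n <= (t + n).+2 ^ t.+1 * ((\prod_p k (lab p)) ^ 2 *
      #|[set m : {ffun 'I_(t + n).+1 -> 'I_t.+1} | content m == content lab]|)].
Proof.
move=> k_gt0; pose LF := {ffun 'I_(t + n).+1 -> 'I_t.+1}.
pose Fw (l : LF) := \prod_p k (l p) ^ 2.
have Fw_content l l' : content l = content l' -> Fw l = Fw l'.
  move=> /content_perm[s hs]; rewrite /Fw (reindex_inj (@perm_inj _ s)).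
  by apply: eq_bigr => p _; rewrite hs.
have sumF : (\sum_l k l ^ 2) ^ n <= \sum_(l : LF | onto_lab l) Fw l.
  have -> : (\sum_l k l ^ 2) ^ n =
      \sum_(g : {ffun 'I_n -> 'I_t.+1}) \prod_p k (g p) ^ 2.
    rewrite -[in LHS](card_ord n) -prod_nat_const.
    by rewrite (bigA_distr_bigA (fun (_ : 'I_n) l => k l ^ 2)).
  pose ext (g : {ffun 'I_n -> 'I_t.+1}) : LF :=
    [ffun p : 'I_(t.+1 + n) =>
      match fintype.split p with inl l => l | inr q => g q end].
  have extl g (l : 'I_t.+1) : ext g (lshift n l) = l.
    by rewrite ffunE (unsplitK (inl _ l)).
  have extr g (q : 'I_n) : ext g (rshift t.+1 q) = g q.
    by rewrite ffunE (unsplitK (inr _ q)).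
  have ext_inj : injective ext.
    by move=> g g' e; apply/ffunP => q; rewrite -!extr e.
  apply: (@leq_trans (\sum_g Fw (ext g))).
    apply: leq_sum => g _; rewrite /Fw (@big_split_ord _ _ _ t.+1 n) /=.
    rewrite -[leqLHS]mul1n; apply: leq_mul.
      by apply: prodn_gt0 => l; rewrite expn_gt0 k_gt0.
    by apply: eq_leq; apply: eq_bigr => q _; rewrite extr.
  rewrite -(big_imset Fw (in2W ext_inj)) /=.
  rewrite [leqRHS](bigID [in [set ext g | g in {ffun 'I_n -> 'I_t.+1}]]) /=.
  apply: leq_trans (leq_addr _ _); apply: eq_leq; apply: eq_bigl => l.
  case: (boolP (l \in _)); rewrite ?andbF ?andbT //.
  move=> /imsetP[g _ ->]; apply/esym/forallP => x; apply/existsP.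
  by exists (lshift n x); rewrite extl.
pose G (c : {ffun 'I_t.+1 -> 'I_(t + n).+2}) :=
  \sum_(l : LF | onto_lab l && (content l == c)) Fw l.
have [c0 c0P] : exists c0, forall c, G c <= G c0.
  have c1 : {ffun 'I_t.+1 -> 'I_(t + n).+2} := [ffun=> ord0].
  by exists [arg max_(c > c1) G c]; case: arg_maxnP => // c _ h c'; exact: h.
have leG : \sum_(l : LF | onto_lab l) Fw l <= (t + n).+2 ^ t.+1 * G c0.
  rewrite (partition_big (@content _ _) predT) //=.
  apply: (@leq_trans (\sum_(c : {ffun 'I_t.+1 -> 'I_(t + n).+2}) G c0)).
    by apply: leq_sum => c _; exact: c0P.
  by rewrite sum_nat_const card_ffun !card_ord.
have G_gt0 : 0 < G c0.
  have d_gt0 : 0 < (\sum_l k l ^ 2) ^ n.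
    by rewrite expn_gt0 (bigD1 ord0) //= addn_gt0 expn_gt0 k_gt0.
  have := leq_trans d_gt0 (leq_trans sumF leG).
  by rewrite muln_gt0 => /andP[].
have [l0 /andP[l0o /eqP l0c]] : exists l0 : LF, onto_lab l0 && (content l0 == c0).
  apply/existsP; move: G_gt0; apply: contraLR; rewrite negb_exists => /forallP h.
  by rewrite -leqNgt /G big_pred0 // => l; apply/negbTE; exact: h.
have [lab labc labm] := sort_lab l0.
exists lab; split=> //; first exact: onto_content (esym labc) l0o.
apply: leq_trans sumF (leq_trans leG _); rewrite leq_mul2l; apply/orP; right.
have -> : (\prod_p k (lab p)) ^ 2 = Fw lab.
  by rewrite /Fw -!mulnn -big_split /=; apply: eq_bigr => p _; rewrite mulnn.
rewrite mulnC -sum_nat_const /G.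
rewrite [leqLHS](eq_bigr (fun=> Fw lab)); last first.
  by move=> l /andP[_ /eqP lc]; apply: Fw_content; rewrite lc labc.
rewrite !sum_nat_const leq_mul2r; apply/orP; right.
apply: subset_leq_card; apply/subsetP => l; rewrite !inE => /andP[_ /eqP ->].
by rewrite labc l0c.
Qed.

Section PathRank.
Variables (I : finType) (t : nat) (cl : I -> 'I_t.+1) (base : 'I_t.+1 -> I).
Hypothesis clbase : cancel base cl.
Variables (K : fieldType) (charK : [pchar K]%R =i pred0).

Lemma exists_path_rank n : exists lab : {ffun 'I_(t + n).+1 -> 'I_t.+1},
  [/\ nondecreasing_lab lab, onto_lab lab &
   #|[set x : I * I | cl x.1 == cl x.2]| ^ n <=
     #|I| ^ (4 * t.+1) * (t + n).+2 ^ (2 * t.+1 + #|I| * #|I|) *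
     \rank (incidence_mx K (fix_markers lab) (paths cl base lab))].
Proof.
have k_gt0 l : 0 < #|[set i | cl i == l]|.
  by apply/card_gt0P; exists (base l); rewrite inE clbase.
have [lab [labm labo h]] := pigeonhole_lab n k_gt0.
exists lab; split=> //.
have -> : #|[set x : I * I | cl x.1 == cl x.2]| =
    \sum_l #|[set i | cl i == l]| ^ 2.
  rewrite -sum1_card (partition_big (fun x : I * I => cl x.1) predT) //=.
  apply: eq_bigr => l _; rewrite -mulnn -cardsX -sum1_card.
  apply: eq_bigl => -[i j]; rewrite !inE /=.
  by case: (cl i =P l) => [->|]; rewrite ?andbF ?andbT // eq_sym.
apply: leq_trans h _.
have pr := path_rank clbase (card_marker labm labo) charK.
apply: leq_trans (leq_mul (leqnn _) pr) _.
rewrite !mulnA leq_mul2r; apply/orP; right.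
rewrite expnD mul2n -addnn expnD.
set a := #|I| ^ _; set b := _ ^ t.+1; set e := _ ^ (_ * _); set f := (t + n).+1 ^ _.
have fb : f <= b by rewrite leq_exp2r.
have -> : b * a * f * e = (b * a * e) * f by lia.
have -> : a * (b * b * e) = (b * a * e) * b by lia.
by rewrite leq_mul2l fb orbT.
Qed.

End PathRank.

End Combinatorics.

(** * Idempotents attached to eigenvalues *)

Section MatrixTrace.
Variable K : fieldType.

Definition nilmx n (x : 'M[K]_n) := exists k, x ^+ k = 0.

Lemma expr_mulmx_rot n r (C : 'M[K]_(n, r)) (B : 'M_(r, n)) k :
  (B *m C) ^+ k.+1 = B *m (C *m B) ^+ k *m C.
Proof.
elim: k => [|k IH]; first by rewrite expr1 expr0 mulmx1.
rewrite exprS IH [in RHS]exprS -![_ * _]/(_ *m _) !mulmxA.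
by rewrite -!mulmxA.
Qed.

(** A singular matrix C B has the trace of the smaller matrix B C, which is nilpotent
    as well. *)
Lemma mxtrace_nil n (x : 'M[K]_n) : nilmx x -> \tr x = 0.
Proof.
elim/ltn_ind: n x => n IH x [k xk].
have [ux|nux] := boolP (x \in unitmx).
  have h : (x ^+ k) \in unitmx.
    elim: k {xk} => [|k IHk]; first by rewrite expr0 unitmx1.
    by rewrite exprS -[_ * _]/(_ *m _) unitmx_mul ux.
  rewrite /mxtrace big1 // => i _.
  have := mulVmx h; rewrite xk mulmx0 => /matrixP /(_ i i).
  by rewrite !mxE eqxx => /eqP; rewrite eq_sym oner_eq0.
have ltr : (\rank x < n)%N.
  by rewrite ltn_neqAle rank_leq_row andbT -[_ == _]/(row_free x) row_free_unit.
rewrite -(mulmx_base x) mxtrace_mulC; apply: IH => //.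
by exists k.+1; rewrite expr_mulmx_rot mulmx_base xk mulmx0 mul0mx.
Qed.

Lemma mxtrace_idem n (e : 'M[K]_n) : e *m e = e -> \tr e = (\rank e)%:R.
Proof.
move=> ee; rewrite -{1}(mulmx_base e) mxtrace_mulC.
suff -> : row_base e *m col_base e = 1%:M by rewrite mxtrace1.
have := row_base_free e; have := col_base_full e.
have : col_base e *m row_base e *m (col_base e *m row_base e) =
  col_base e *m row_base e by rewrite mulmx_base.
move: (col_base e) (row_base e) => C B h fC fB.
apply: (row_free_inj fB); apply: (row_full_inj fC).
by rewrite /= mul1mx -[RHS]h !mulmxA.
Qed.

Lemma mxtrace_idem_neq0 n (e : 'M[K]_n) : [pchar K] =i pred0 ->
  e *m e = e -> e != 0 -> \tr e != 0.
Proof.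
move=> charK ee e0; rewrite mxtrace_idem //.
by rewrite (pcharf0P K).1 // mxrank_eq0.
Qed.

End MatrixTrace.

Section RootExtension.

Lemma irreducible_factor (K : fieldType) (p : {poly K}) : (1 < size p)%N ->
  exists2 g : {poly K}, irreducible_poly g & g %| p.
Proof.
elim/ltn_ind: {p}(size p) {-2}p (erefl (size p)) => n IH p pn p1.
have [irr|] := pselect (irreducible_poly p); first by exists p => //; exact: dvdpp.
move=> nirr.
have [g [g1 gp ng]] : exists g : {poly K}, [/\ size g != 1%N, g %| p & ~~ (g %= p)].
  apply: contra_notP nirr => nex; split=> // g g1 gp.
  by apply: contraT => ng; case: nex; exists g.
have p0 : p != 0 by rewrite -size_poly_gt0 ltnW.
have g0 : g != 0 by apply: contraNneq p0 => g0; move: gp; rewrite g0 dvd0p.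
have lt : (size g < n)%N.
  rewrite -pn ltn_neqAle dvdp_leq // andbT.
  by apply: contra ng => e; rewrite -dvdp_size_eqp.
have g2 : (1 < size g)%N by rewrite ltn_neqAle eq_sym g1 size_poly_gt0.
have [h irrh hg] := IH _ lt g (erefl _) g2.
by exists h => //; exact: dvdp_trans hg gp.
Qed.

Lemma root_extension (K : fieldType) (p : {poly K}) : (1 < size p)%N ->
  exists (K' : fieldType) (psi : {rmorphism K -> K'}) (mu : K'),
    root (map_poly psi p) mu.
Proof.
move=> p1; have [g irrg gp] := irreducible_factor p1.
have [K' _ [z rz _]] := irredp_FAdjoin irrg.
exists K', (GRing.in_alg K' : {rmorphism K -> K'}), z.
have /dvdpP[q ->] := gp.
by rewrite rmorphM /= rootM rz orbT.
Qed.

End RootExtension.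

(** A matrix that is not nilpotent has a nonzero eigenvalue in some extension;
    the projection on its generalized eigenspace is a polynomial in the matrix,
    without constant term. *)
Lemma nonnil_idempotent (K : fieldType) q (y : 'M[K]_q.+1) : ~ nilmx y ->
  exists (K' : fieldType) (psi : {rmorphism K -> K'}) (h : {poly K'}),
    let y' := map_mx psi y in let f := y' * horner_mx y' h in
    [/\ f * f = f, f != 0 &
      exists (mu : K') (a : nat), mu != 0 /\ (y' - mu%:M) ^+ a * f = 0].
Proof.
move=> nny; pose chi := char_poly y.
have chi0 : chi != 0 by rewrite monic_neq0 // char_poly_monic.
have [j [g]] := multiplicity_XsubC chi 0; rewrite chi0 /= => g0 chiE.
have g1 : (1 < size g)%N.
  rewrite ltnNge; apply/negP => /size1_polyC gC; apply: nny; exists j.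
  have c0 : g`_0 != 0 by move: g0; rewrite rootE gC hornerC coefC.
  have := Cayley_Hamilton y; rewrite -/chi chiE gC rmorphM /= horner_mx_C.
  rewrite subr0 rmorphXn /= horner_mx_X -[_ * _]/(_ *m _) mul_scalar_mx.
  by move/eqP; rewrite scaler_eq0 (negbTE c0) => /eqP.
have [K' [psi [mu rmu]]] := root_extension g1.
pose y' := map_mx psi y.
have mu0 : mu != 0.
  apply: contraNneq g0 => mu0; move: rmu.
  by rewrite mu0 -(rmorph0 psi) fmorph_root.
(* the factor 'X makes 0 a root, so that the idempotent below has no constant term *)
pose p := 'X * map_poly psi chi.
have chi'0 : map_poly psi chi != 0 by rewrite map_poly_eq0.
have p0 : p != 0 by rewrite mulf_neq0 // polyX_eq0.
have py : horner_mx y' p = 0.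
  rewrite /p rmorphM /= -map_horner_mx.
  by rewrite Cayley_Hamilton map_mx0 mulr0.
have [a [g2]] := multiplicity_XsubC p mu; rewrite p0 /= => g2mu pE.
have g20 : root g2 0.
  have : root p 0 by rewrite /p rootM rootX eqxx.
  rewrite pE rootM => /orP[//|].
  by rewrite rootE horner_exp hornerXsubC sub0r expf_eq0 oppr_eq0 (negbTE mu0) andbF.
have [g3 g2E] := factor_theorem g2 0 g20; rewrite subr0 in g2E.
(* f is u g2 evaluated at y', where u g2 + v (X - mu)^a = 1 *)
have cop : coprimep g2 (('X - mu%:P) ^+ a).
  by apply: coprimep_expr; rewrite coprimep_XsubC.
have /Bezout_eq1_coprimepP[[u v] /= uv1] := cop.
exists K', psi, (u * g3) => /=; rewrite -/y'.
have -> : y' * horner_mx y' (u * g3) = horner_mx y' (u * g2).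
  by rewrite -{1}(horner_mx_X y') -rmorphM g2E; congr horner_mx; ring.
set f := horner_mx y' (u * g2).
have fXmu : horner_mx y' (('X - mu%:P) ^+ a * (u * g2)) = 0.
  have -> : ('X - mu%:P) ^+ a * (u * g2) = u * p by rewrite pE; ring.
  by rewrite rmorphM /= py mulr0.
split.
- apply/eqP; rewrite -subr_eq0 -rmorphM -rmorphB /=.
  have -> : u * g2 * (u * g2) - u * g2 =
      - v * (('X - mu%:P) ^+ a * (u * g2)).
    by rewrite -[X in _ - X]mulr1 -uv1; ring.
  by rewrite rmorphM /= fXmu mulr0.
- have ev : eigenvalue y' mu.
    rewrite eigenvalue_root_char /y' -map_char_poly.
    by rewrite -/chi chiE rmorphM /= rootM rmu.
  have /eigenvalueP[w wy w0] := ev.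
  have ww (r : {poly K'}) : w *m horner_mx y' r = r.[mu] *: w.
    elim/poly_ind: r => [|r c IH]; first by rewrite rmorph0 mulmx0 horner0 scale0r.
    rewrite rmorphD rmorphM /= horner_mx_X horner_mx_C mulmxDr mulmxA IH.
    by rewrite -scalemxAl wy mul_mx_scalar scalerA hornerMXaddC scalerDl.
  apply: contraNneq w0 => f0; have := ww (u * g2); rewrite -/f f0 mulmx0.
  have -> : (u * g2).[mu] = 1.
    have := congr1 (horner^~ mu) uv1; rewrite hornerD hornerM [in LHS]hornerM.
    have a0 : (0 < a)%N.
      rewrite lt0n; apply: contraNneq g2mu => a0.
      move: pE; rewrite a0 mulr1 => <-; rewrite /p rootM.
      by rewrite chiE rmorphM /= rootM rmu orbT.
    by rewrite horner_exp hornerXsubC subrr expr0n eqn0Ngt a0 mulr0 addr0 hornerC.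
  by rewrite scale1r => <-.
- exists mu, a; split=> //.
  have -> : (y' - mu%:M) ^+ a = horner_mx y' (('X - mu%:P) ^+ a).
    by rewrite rmorphXn /= rmorphB /= horner_mx_X horner_mx_C.
  by rewrite -rmorphM.
Qed.

(** * Extension of scalars *)

Lemma mxtraceM_comm (K : fieldType) q (x y : 'M[K]_q.+1) : \tr (x * y) = \tr (y * x).
Proof. exact: mxtrace_mulC. Qed.

Lemma map_mx_lin (F K : fieldType) (phi : {rmorphism F -> K}) p q I (r : seq I)
    (c : I -> F) (X : I -> 'M[F]_(p, q)) :
  map_mx phi (\sum_(i <- r) c i *: X i) =
  \sum_(i <- r) phi (c i) *: map_mx phi (X i).
Proof. by rewrite map_mx_sum; apply: eq_bigr => i _; rewrite map_mxZ. Qed.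

Lemma horner_mx_commute (K : fieldType) q (x : 'M[K]_q.+1) h :
  x * horner_mx x h = horner_mx x h * x.
Proof.
rewrite -[X in X * _]horner_mx_X -[X in _ = _ * X]horner_mx_X.
by rewrite -!rmorphM mulrC.
Qed.

Section ScalarExtension.
Variables (F : fieldType) (q m : nat) (R : 'I_m -> 'M[F]_q.+1).
Hypothesis mulR : forall i j, exists c : 'I_m -> F, R i * R j = \sum_k c k *: R k.

Section Space.
Variables (K : fieldType) (phi : {rmorphism F -> K}).

Definition ext_space : {vspace 'M[K]_q.+1} := (\sum_i <[map_mx phi (R i)]>)%VS.
Local Notation A := ext_space.

Lemma ext_spaceP x :
  reflect (exists c : 'I_m -> K, x = \sum_i c i *: map_mx phi (R i)) (x \in A).
Proof.
apply: (iffP memv_sumP) => [[v hv ->]|[c ->]].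
  have /fin_all_exists[c hc] : forall i, exists a : K, v i = a *: map_mx phi (R i).
    by move=> i; have /vlineP := hv i isT.
  by exists c; apply: eq_bigr.
by exists (fun i => c i *: map_mx phi (R i)) => // i _; rewrite memvZ ?memv_line.
Qed.

Lemma mem_ext_gen i : map_mx phi (R i) \in A.
Proof. by rewrite memvE (sumv_sup i). Qed.

Lemma ext_mul x y : x \in A -> y \in A -> x * y \in A.
Proof.
move=> /ext_spaceP[a ->] /ext_spaceP[b ->].
rewrite mulr_suml memv_suml // => i _; rewrite mulr_sumr memv_suml // => j _.
rewrite -scalerAl -scalerAr memvZ // memvZ //.
have [c hc] := mulR i j.
rewrite -[_ * _]/(_ *m _) -map_mxM -[_ *m _]/(_ * _) hc map_mx_lin.
by rewrite memv_suml // => k _; rewrite memvZ // mem_ext_gen.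
Qed.

Lemma ext_horner y (h : {poly K}) : y \in A -> y * horner_mx y h \in A.
Proof.
move=> yA; elim/poly_ind: h => [|h c IH]; first by rewrite rmorph0 mulr0 mem0v.
rewrite rmorphD rmorphM /= horner_mx_X horner_mx_C mulrDr mulrA memvD //.
  exact: ext_mul.
by rewrite -[_ * _]/(_ *m _) mul_mx_scalar memvZ.
Qed.

End Space.

Lemma ext_map (K K' : fieldType) (phi : {rmorphism F -> K})
    (psi : {rmorphism K -> K'}) x :
  x \in ext_space phi -> map_mx psi x \in ext_space (psi \o phi).
Proof.
move=> /ext_spaceP[c ->]; rewrite map_mx_lin memv_suml // => i _.
by rewrite memvZ // -map_mx_comp mem_ext_gen.
Qed.

Definition orth_idems (K : fieldType) (phi : {rmorphism F -> K}) r
    (e : 'I_r -> 'M[K]_q.+1) :=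
  (forall i, e i \in ext_space phi) /\ (forall i, e i != 0) /\
  (forall i j, e i * e j = if i == j then e i else 0).

Lemma orth_idems_bound (K : fieldType) (phi : {rmorphism F -> K}) r
    (e : 'I_r -> 'M[K]_q.+1) : orth_idems phi e -> (r <= q.+1 * q.+1)%N.
Proof.
move=> [_ [e0 ee]].
pose X := [tuple e i | i < r].
have fX : free X.
  apply/freeP => k hk i.
  have := congr1 (fun x => e i * x) hk; rewrite mulr0 mulr_sumr (bigD1 i) //=.
  rewrite big1 => [|j ji]; last first.
    by rewrite nth_mktuple -scalerAr ee eq_sym (negbTE ji) scaler0.
  rewrite addr0 nth_mktuple -scalerAr ee eqxx => /eqP.
  by rewrite scaler_eq0 (negbTE (e0 i)) orbF => /eqP.
have dX : \dim <<X>> = r by move: fX; rewrite /free size_tuple => /eqP.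
have := dimvS (subvf <<X>>); rewrite dX dimvf.
by [].
Qed.

(** The number of orthogonal idempotents is bounded by the dimension of the matrix
    algebra, over all extensions. With the maximal number, no idempotent can be
    added or refined over any further extension. *)
Lemma exists_max_idems : exists (K : fieldType) (phi : {rmorphism F -> K}) r
    (e : 'I_r -> 'M[K]_q.+1), orth_idems phi e /\
  forall (K' : fieldType) (phi' : {rmorphism F -> K'})
    (e' : 'I_r.+1 -> 'M[K']_q.+1), ~ orth_idems phi' e'.
Proof.
apply: contrapT => nex.
have all r : exists (K : fieldType) (phi : {rmorphism F -> K})
    (e : 'I_r -> 'M[K]_q.+1), orth_idems phi e.
  elim: r => [|r [K [phi [e he]]]].
    by exists F, (idfun : {rmorphism F -> F}), (fun=> 0); split; [|split]; case.
  apply: contrapT => nex'; apply: nex; exists K, phi, r, e; split=> //.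
  by move=> K' phi' e' he'; apply: nex'; exists K', phi', e'.
have [K [phi [e /orth_idems_bound]]] := all (q.+1 * q.+1).+1.
by rewrite ltnn.
Qed.

Section MaxIdems.
Variables (K : fieldType) (phi : {rmorphism F -> K}) (r : nat).
Variable e : 'I_r -> 'M[K]_q.+1.
Hypothesis charK : [pchar K] =i pred0.
Hypothesis oe : orth_idems phi e.
Hypothesis max_e : forall (K' : fieldType) (phi' : {rmorphism F -> K'})
  (e' : 'I_r.+1 -> 'M[K']_q.+1), ~ orth_idems phi' e'.
Local Notation A := (ext_space phi).

(** Otherwise the idempotent attached to an eigenvalue of x is orthogonal to all the
    e_i. *)
Lemma nil_complement x : x \in A ->
  (forall i, e i * x = 0) -> (forall i, x * e i = 0) -> nilmx x.
Proof.
have [eA [e0 ee]] := oe.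
move=> xA ex xe; apply: contrapT => /nonnil_idempotent[K' [psi [h []]]].
set x' := map_mx psi x; set f := x' * horner_mx x' h => ff f0 _.
have fA : f \in ext_space (psi \o phi) by rewrite /f; apply: ext_horner; exact: ext_map.
have ef i : map_mx psi (e i) * f = 0.
  by rewrite mulrA -[_ * x']/(_ *m _) -map_mxM -[_ *m x]/(_ * _) ex map_mx0 mul0r.
have fe i : f * map_mx psi (e i) = 0.
  have -> : f = horner_mx x' h * x'.
    exact: horner_mx_commute.
  by rewrite -mulrA -[x' * _]/(_ *m _) -map_mxM -[_ *m e i]/(_ * _) xe map_mx0 mulr0.
pose e' (k : 'I_r.+1) := if unlift ord_max k is Some i then map_mx psi (e i) else f.
apply: (max_e (phi' := psi \o phi) (e' := e')); split; [|split].
- move=> k; rewrite /e'; case: unliftP => [i|] _ //.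
  exact: ext_map.
- move=> k; rewrite /e'; case: unliftP => [i|] _ //.
  by rewrite map_mx_eq0.
- move=> k l; rewrite /e'; case: unliftP => [i|] ->; case: unliftP => [j|] ->.
  + rewrite (inj_eq lift_inj) -[_ * _]/(_ *m _) -map_mxM -[_ *m _]/(_ * _) ee.
    by case: eqP => _ //; rewrite map_mx0.
  + by rewrite ef eq_sym (negbTE (neq_lift _ _)).
  + by rewrite fe (negbTE (neq_lift _ _)).
  + by rewrite ff eqxx.
Qed.

(** Otherwise x has a nonzero eigenvalue mu. Its idempotent f cannot split e_i, so
    f = e_i; then x - mu e_i is nilpotent and tr x = mu tr e_i is nonzero. *)
Lemma nil_corner i x : x \in A -> e i * x = x -> x * e i = x -> \tr x = 0 ->
  nilmx x.
Proof.
have [eA [e0 ee]] := oe.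
move=> xA ex xe trx; apply: contrapT => /nonnil_idempotent[K' [psi [h []]]].
set x' := map_mx psi x; set f := x' * horner_mx x' h => ff f0 [mu [a [mu0 muf]]].
have charK' : [pchar K'] =i pred0 by move=> p; rewrite (fmorph_pchar psi) charK.
have fA : f \in ext_space (psi \o phi) by rewrite /f; apply: ext_horner; exact: ext_map.
pose E j := map_mx psi (e j).
have EE j k : E j * E k = if j == k then E j else 0.
  rewrite /E -[_ * _]/(_ *m _) -map_mxM -[_ *m _]/(_ * _) ee.
  by case: eqP => _ //; rewrite map_mx0.
have ex' : E i * x' = x' by rewrite -[_ * _]/(_ *m _) -map_mxM -[_ *m _]/(_ * _) ex.
have xe' : x' * E i = x' by rewrite -[_ * _]/(_ *m _) -map_mxM -[_ *m _]/(_ * _) xe.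
have ef : E i * f = f by rewrite mulrA ex'.
have fe : f * E i = f.
  have -> : f = horner_mx x' h * x'.
    exact: horner_mx_commute.
  by rewrite -mulrA xe'.
have [fE|fE] := eqVneq f (E i).
  have nx : nilmx (x' - mu *: E i).
    exists a.+1.
    have step k : (x' - mu *: E i) ^+ k.+1 = (x' - mu%:M) ^+ k.+1 * E i.
      elim: k => [|k IH].
        by rewrite !expr1 mulrBl xe' -[mu%:M * _]/(_ *m _) mul_scalar_mx.
      rewrite exprSr IH [in RHS]exprSr -!mulrA; congr (_ * _).
      by rewrite !mulrBl mulrBr ex' -scalerAr EE eqxx xe' -[mu%:M * _]/(_ *m _) mul_scalar_mx.
    by rewrite step exprS -mulrA -fE muf mulr0.
  have := mxtrace_nil nx; rewrite raddfB /= mxtraceZ.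
  have -> : \tr x' = 0 by rewrite -[x']/(map_mx psi x) trace_map_mx trx rmorph0.
  rewrite sub0r => /eqP; rewrite oppr_eq0 mulf_eq0 (negbTE mu0) /=.
  rewrite (negbTE (mxtrace_idem_neq0 charK' _ _)) //.
    by rewrite -[_ *m _]/(_ * _) EE eqxx.
  by rewrite -fE.
pose e' (k : 'I_r.+1) :=
  if unlift ord_max k is Some j then (if j == i then f else E j) else E i - f.
have Ef j : j != i -> E j * f = 0 by move=> ji; rewrite -ef mulrA EE (negbTE ji) mul0r.
have fEj j : j != i -> f * E j = 0.
  by move=> ji; rewrite -fe -mulrA EE eq_sym (negbTE ji) mulr0.
apply: (max_e (phi' := psi \o phi) (e' := e')); split; [|split].
- move=> k; rewrite /e'; case: unliftP => [j|] _; last by rewrite memvB // ext_map.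
  by case: ifP => _ //; exact: ext_map.
- move=> k; rewrite /e'; case: unliftP => [j|] _; last by rewrite subr_eq0 eq_sym.
  by case: ifP => _ //; rewrite map_mx_eq0.
- move=> k l; rewrite /e'; case: unliftP => [j|] ->; case: unliftP => [j'|] ->.
  + rewrite (inj_eq lift_inj).
    have [je|ji] := eqVneq j i; have [je'|ji'] := eqVneq j' i.
    * by rewrite je je' eqxx.
    * by rewrite fEj // je eq_sym (negbTE ji').
    * by rewrite Ef // je' (negbTE ji).
    * by rewrite EE.
  + rewrite [lift _ _ == _]eq_sym (negbTE (neq_lift _ _)).
    have [_|ji] := eqVneq j i; first by rewrite mulrBr fe ff subrr.
    by rewrite mulrBr Ef // EE (negbTE ji) subrr.
  + rewrite (negbTE (neq_lift _ _)).
    have [_|ji] := eqVneq j' i; first by rewrite mulrBl ef ff subrr.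
    by rewrite mulrBl fEj // EE eq_sym (negbTE ji) subrr.
  + rewrite eqxx mulrBr !mulrBl EE eqxx ef fe ff subrr subr0.
    by [].
Qed.

(** Otherwise some x z is a nonzero idempotent, whose trace is its rank. *)
Lemma nil_trace_radical x : x \in A -> (forall y, y \in A -> \tr (x * y) = 0) ->
  nilmx x.
Proof.
move=> xA trx; apply: contrapT => /nonnil_idempotent[K' [psi [h []]]].
set x' := map_mx psi x; set f := x' * horner_mx x' h => ff f0 _.
have charK' : [pchar K'] =i pred0 by move=> p; rewrite (fmorph_pchar psi) charK.
have x'A : x' \in ext_space (psi \o phi) by exact: ext_map.
have := mxtrace_idem_neq0 charK' ff f0; rewrite -ff.
have -> : f * f = x' * (x' * horner_mx x' (h * h)).
  have -> : f * f = x' * (horner_mx x' h * x') * horner_mx x' h.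
    by rewrite /f !mulrA.
  have -> : horner_mx x' h * x' = x' * horner_mx x' h.
    by rewrite horner_mx_commute.
  by rewrite rmorphM /= !mulrA.
have /ext_spaceP[c ->] := ext_horner (h * h) x'A.
rewrite mulr_sumr raddf_sum big1 ?eqxx // => i _ /=.
rewrite -scalerAr mxtraceZ map_mx_comp -[x' * _]/(_ *m _) -map_mxM.
by rewrite trace_map_mx -[_ *m _]/(_ * _) trx ?rmorph0 ?mulr0 // mem_ext_gen.
Qed.

End MaxIdems.
End ScalarExtension.

(** * The radical and the matrix units *)

Section TraceRadical.
Variables (K : fieldType) (q : nat) (A : {vspace 'M[K]_q.+1}).

Definition trace_form_row (x : 'M[K]_q.+1) : 'rV[K]_(\dim A) :=
  \row_k \tr (x * (vbasis A)`_k).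

Fact trace_form_row_linear : linear trace_form_row.
Proof.
move=> a x y; apply/rowP => k; rewrite !mxE mulrDl -scalerAl.
by rewrite mxtraceD mxtraceZ.
Qed.

HB.instance Definition _ :=
  GRing.isLinear.Build K 'M[K]_q.+1 'rV[K]_(\dim A) *:%R trace_form_row
    trace_form_row_linear.

Definition trace_radical : {vspace 'M[K]_q.+1} :=
  (A :&: lker (linfun trace_form_row))%VS.

Lemma trace_radicalP x : reflect (x \in A /\ forall y, y \in A -> \tr (x * y) = 0)
  (x \in trace_radical).
Proof.
rewrite memv_cap memv_ker lfunE /=; apply: (iffP andP) => -[xA h]; split=> //.
  move=> y /coord_vbasis ->; rewrite mulr_sumr raddf_sum big1 // => k _ /=.
  rewrite -scalerAr mxtraceZ.
  by move/eqP/rowP/(_ k): h; rewrite !mxE => ->; rewrite mulr0.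
apply/eqP/rowP => k; rewrite !mxE h //.
by apply: vbasis_mem; rewrite mem_nth // size_tuple.
Qed.

Hypothesis mulA : forall x y, x \in A -> y \in A -> x * y \in A.

Lemma trace_radicalMr x y : x \in trace_radical -> y \in A -> x * y \in trace_radical.
Proof.
move=> /trace_radicalP[xA h] yA; apply/trace_radicalP; split; first exact: mulA.
by move=> z zA; rewrite -mulrA h // mulA.
Qed.

Lemma trace_radicalMl x y : x \in trace_radical -> y \in A -> y * x \in trace_radical.
Proof.
move=> /trace_radicalP[xA h] yA; apply/trace_radicalP; split; first exact: mulA.
by move=> z zA; rewrite -mulrA mxtraceM_comm -mulrA h // mulA.
Qed.

(** The trace of a commutator vanishes, so tr ((x D - D x) y) = - tr (x (y D - D y)). *)
Lemma trace_radical_ad D x :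
  (forall y, y \in A -> y * D - D * y \in A) ->
  x \in trace_radical -> x * D - D * x \in trace_radical.
Proof.
move=> AD /trace_radicalP[xA h]; apply/trace_radicalP; split; first exact: AD.
move=> y yA; have := h _ (AD y yA).
rewrite mulrBl mulrBr !raddfB /= => /eqP; rewrite subr_eq0 => /eqP e.
apply/eqP; rewrite subr_eq0 -mulrA -e mulrA mxtraceM_comm.
by rewrite mulrA.
Qed.

End TraceRadical.

Section NilAlgebra.
Variables (K : fieldType) (q : nat).
Implicit Type M I : {vspace 'M[K]_q.+1}.

Lemma mem_prod_line (x y : 'M[K]_q.+1) M : y \in (<[x]> * M)%VS ->
  exists2 z, z \in M & y = x * z.
Proof.
suff h : (<[x]> * M <= amull x @: M)%VS.
  by move=> /(subvP h) /memv_imgP[z zM ->]; exists z; rewrite // lfunE.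
apply/prodvP => _ z /vlineP[k ->] zM; rewrite -scalerAl scalerAr.
by apply/memv_imgP; exists (k *: z); rewrite ?memvZ // lfunE.
Qed.

(** Otherwise take I nonzero of minimal dimension with I M = I. Then x M = I for
    some x in I, so that x = x z = x z^k for all k, with z nilpotent. *)
Lemma nil_idempotent_vspace M : (forall x, x \in M -> nilmx x) ->
  (M * M)%VS = M -> M = 0%VS.
Proof.
move=> nilM MM; apply/eqP; apply: contraT => M0.
pose P n := `[< exists I, [/\ (I * M)%VS = I, I != 0%VS & \dim I = n] >].
have exP : exists n, P n by exists (\dim M); apply/asboolP; exists M.
have [n /asboolP[I [IM I0 dI]] minI] := ex_minnP exP.
have [x xI xM0] : exists2 x, x \in I & (<[x]> * M)%VS != 0%VS.
  apply: contra_notP (negP I0) => nex; rewrite -subv0 -IM; apply/prodvP => x z xI zM.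
  have : x * z \in (<[x]> * M)%VS by rewrite memv_mul ?memv_line.
  have -> : (<[x]> * M)%VS = 0%VS by apply/eqP; apply: contraT => h; case: nex; exists x.
  by [].
have sub : (<[x]> * M <= I)%VS by rewrite -IM prodvSl // -memvE.
have : (<[x]> * M)%VS == I.
  rewrite eqEdim sub dI; apply: minI; apply/asboolP; exists (<[x]> * M)%VS.
  by split=> //; rewrite -prodvA MM.
move=> /eqP xMI; move: xI; rewrite -xMI => /mem_prod_line[z zM xz].
have [k zk] := nilM z zM.
have xk j : x = x * z ^+ j.
  by elim: j => [|j IH]; rewrite ?mulr1 // exprSr mulrA -IH.
by move: xM0; rewrite (xk k) zk mulr0 prod0v eqxx.
Qed.

(** The powers of M decrease, so they become constant; the limit is idempotent. *)
Lemma nil_algebra_nilpotent M : (M * M <= M)%VS -> (forall x, x \in M -> nilmx x) ->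
  exists k, (M ^+ k)%VS = 0%VS.
Proof.
move=> MM nilM.
have subS k : (M ^+ k.+2 <= M ^+ k.+1)%VS.
  elim: k => [|k IH]; first by rewrite expvSl !expv1.
  by rewrite expvSl [X in (_ <= X)%VS]expvSl prodvSr.
have [k kE] : exists k, (M ^+ k.+1)%VS = (M ^+ k.+2)%VS.
  apply: contrapT => nex.
  have lt k : (\dim (M ^+ k.+2) < \dim (M ^+ k.+1))%N.
    rewrite ltnNge; apply/negP => le; apply: nex; exists k.
    by apply/esym/eqP; rewrite eqEdim subS.
  have bound k : (\dim (M ^+ k.+1) + k <= \dim (M ^+ 1))%N.
    by elim: k => [|k IH]; rewrite ?addn0 //; have := lt k; lia.
  by have := bound (\dim (M ^+ 1)).+1; lia.
have stab j : (M ^+ (k.+1 + j))%VS = (M ^+ k.+1)%VS.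
  elim: j => [|j IH]; first by rewrite addn0.
  by rewrite addnS expvSr IH -expvSr.
exists k.+1; apply: nil_idempotent_vspace; last by rewrite -expvD stab.
have sub1 : (M ^+ k.+1 <= M)%VS.
  by elim: (k) => [|j]; [rewrite expv1|apply: subv_trans; exact: subS].
by move=> x /(subvP sub1); exact: nilM.
Qed.

End NilAlgebra.

(** Matrix units for the simple components of A modulo its radical, one component for
    each value of [class_rep]. *)
Record matrix_units (K : fieldType) q (A : {vspace 'M[K]_q.+1}) := MatrixUnits {
  munit_size : nat;
  class_rep : 'I_munit_size -> 'I_munit_size;
  munit : 'I_munit_size -> 'I_munit_size -> 'M[K]_q.+1;
  class_repK : forall i, class_rep (class_rep i) = class_rep i;
  munit_mem : forall i j, class_rep i = class_rep j -> munit i j \in A;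
  munit_mul : forall i j k l, class_rep i = class_rep j -> class_rep k = class_rep l ->
    munit i j * munit k l = if j == k then munit i l else 0;
  munit_span : forall x, x \in A -> exists c : 'I_munit_size -> 'I_munit_size -> K,
    x - \sum_i \sum_(j | class_rep i == class_rep j) c i j *: munit i j \in trace_radical A
}.

Section Peirce.
Variables (K : fieldType) (charK : [pchar K] =i pred0).
Variables (q : nat) (A : {vspace 'M[K]_q.+1}).
Hypothesis mulA : forall x y, x \in A -> y \in A -> x * y \in A.
Variables (r : nat) (e : 'I_r -> 'M[K]_q.+1).
Hypotheses (eA : forall i, e i \in A) (e0 : forall i, e i != 0).
Hypothesis ee : forall i j, e i * e j = if i == j then e i else 0.
Hypothesis nil_comp : forall x, x \in A ->
  (forall i, e i * x = 0) -> (forall i, x * e i = 0) -> nilmx x.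
Hypothesis nil_corn : forall i x, x \in A -> e i * x = x -> x * e i = x ->
  \tr x = 0 -> nilmx x.

Let eii i : e i * e i = e i. Proof. by rewrite ee eqxx. Qed.

Let tr_e i : \tr (e i) != 0.
Proof. by apply: mxtrace_idem_neq0 => //; exact: eii. Qed.

(** Up to a nonzero scalar, x is e_i - v with v nilpotent, and a geometric series
    inverts it. *)
Lemma corner_unit i x : x \in A -> e i * x = x -> x * e i = x -> \tr x != 0 ->
  exists z, [/\ z \in A, e i * z = z, z * e i = z & x * z = e i].
Proof.
move=> xA ex xe trx; pose a := \tr x / \tr (e i).
have a0 : a != 0 by rewrite mulf_neq0 // invr_eq0.
pose v := e i - a^-1 *: x.
have vA : v \in A by rewrite memvB // memvZ.
have ev : e i * v = v by rewrite mulrBr eii -scalerAr ex.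
have ve : v * e i = v by rewrite mulrBl eii -scalerAl xe.
have [k vk] : nilmx v.
  apply: (nil_corn vA ev ve); rewrite raddfB /= mxtraceZ /a.
  by field; rewrite tr_e trx.
have xE : x = a *: ((1 - v) * e i).
  by rewrite mulrBl mul1r ve opprB addrC subrK scalerA divff ?scale1r.
have xE' : x = a *: (e i * (1 - v)).
  by rewrite mulrBr mulr1 ev opprB addrC subrK scalerA divff ?scale1r.
have vjA j : v ^+ j * e i \in A.
  by elim: j => [|j IH]; rewrite ?mul1r // exprS -mulrA mulA.
have vje j : e i * (v ^+ j * e i) = v ^+ j * e i.
  by case: j => [|j]; rewrite ?expr0 ?mul1r ?eii // exprS -mulrA mulrA ev.
exists (a^-1 *: \sum_(j < k) v ^+ j * e i); split.
- by rewrite memvZ // memv_suml.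
- by rewrite -scalerAr mulr_sumr; congr (_ *: _); apply: eq_bigr.
- rewrite -scalerAl mulr_suml; congr (_ *: _); apply: eq_bigr => j _.
  by rewrite -mulrA eii.
- rewrite xE' -scalerAl -scalerAr scalerA divff // scale1r.
  rewrite -mulr_suml -mulrA [(1 - v) * _]mulrA -[1 - v]opprB mulNr -subrX1 vk.
  by rewrite sub0r opprK mul1r eii.
Qed.

(** Otherwise v g would be invertible in the corner, and so v would have a right
    inverse there. *)
Lemma corner_nil_trace i v g : v \in A -> g \in A -> e i * v = v -> v * e i = v ->
  e i * g = g -> g * e i = g -> nilmx v -> \tr (v * g) = 0.
Proof.
move=> vA gA ev ve eg ge [k vk]; apply/eqP; apply: contraT => h.
have [||||z [zA ez ze vgz]] := @corner_unit i (v * g).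
- exact: mulA.
- by rewrite mulrA ev.
- by rewrite -mulrA ge.
- exact: h.
have step j : v ^+ j * e i * (g * z) ^+ j = e i.
  elim: j => [|j IH]; first by rewrite mulr1 mul1r.
  rewrite exprSr exprS -!mulrA [e i * (g * _)]mulrA eg.
  by rewrite [v * _]mulrA [v * g * _]mulrA vgz mulrA.
by have := step k; rewrite vk !mul0r => /esym/eqP; rewrite (negbTE (e0 i)).
Qed.

(** Mutually inverse elements of e_i A e_j and e_j A e_i. *)
Definition iso i j (a b : 'M[K]_q.+1) :=
  [/\ a \in A, b \in A, e i * a = a /\ a * e j = a, e j * b = b /\ b * e i = b &
      a * b = e i /\ b * a = e j].

Lemma iso_refl i : iso i i (e i) (e i).
Proof. by split; rewrite ?eA ?eii. Qed.

Lemma iso_sym i j a b : iso i j a b -> iso j i b a.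
Proof. by case=> aA bA ? ? [? ?]; split. Qed.

Lemma iso_trans i j k a b a' b' : iso i j a b -> iso j k a' b' ->
  iso i k (a * a') (b' * b).
Proof.
case=> aA bA [ea ae] [eb be] [ab ba] [a'A b'A [ea' ae'] [eb' be'] [ab' ba']].
split; rewrite ?mulA //; first by rewrite mulrA ea -mulrA ae'.
  by rewrite mulrA eb' -mulrA be.
split.
  by rewrite -mulrA [a' * _]mulrA ab' eb ab.
by rewrite -mulrA [b * _]mulrA ba ea' ba'.
Qed.

(** By [corner_unit], e_i x e_j y e_i is invertible in the corner of e_i. This gives a
    right inverse b of a = e_i x e_j; and b a, an idempotent with nonzero trace, is
    invertible in the corner of e_j, hence equal to e_j. *)
Lemma trace_iso i j x y : x \in A -> y \in A -> \tr (e i * x * e j * y) != 0 ->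
  exists a b, iso i j a b.
Proof.
move=> xA yA h; pose z0 := e i * x * e j * (e j * y * e i).
have z0A : z0 \in A by rewrite /z0 !mulA.
have tz0 : \tr z0 != 0.
  rewrite /z0 mulrA mxtraceM_comm !mulrA eii -[e i * x * e j * e j]mulrA eii.
  exact: h.
have [||||z [zA ez ze z0z]] := @corner_unit i z0 => //.
- by rewrite /z0 !mulrA eii.
- by rewrite /z0 -!mulrA eii.
pose a := e i * x * e j; pose b := e j * y * e i * z.
have ab : a * b = e i by rewrite /a /b mulrA.
have aA : a \in A by rewrite /a !mulA.
have bA : b \in A by rewrite /b !mulA.
have ea : e i * a = a by rewrite /a !mulrA eii.
have ae : a * e j = a by rewrite /a -mulrA eii.
have eb : e j * b = b by rewrite /b !mulrA eii.
have be : b * e i = b by rewrite /b -mulrA ze.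
exists a, b; split=> //; split=> //.
have ff : b * a * (b * a) = b * a.
  by rewrite -mulrA [a * _]mulrA ab ea.
have [||||z' [z'A ez' ze' fz']] := @corner_unit j (b * a).
- exact: mulA.
- by rewrite mulrA eb.
- by rewrite -mulrA ae.
- by rewrite mxtraceM_comm ab.
have fe : b * a * e j = b * a by rewrite -mulrA ae.
by rewrite -{1}fe -{1}fz' mulrA ff.
Qed.

(** The corner of 1 - s, where s is the sum of the e_i, is nil. *)
Lemma trace_peirce z : z \in A -> \tr z = \sum_i \tr (e i * z).
Proof.
move=> zA; pose s := \sum_i e i.
have es i : e i * s = e i.
  rewrite /s mulr_sumr (bigD1 i) //= big1 ?addr0 // => j ji.
  by rewrite ee eq_sym (negbTE ji).
have se i : s * e i = e i.
  rewrite /s mulr_suml (bigD1 i) //= big1 ?addr0 // => j ji.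
  by rewrite ee (negbTE ji).
have ss : s * s = s by rewrite {2}/s mulr_sumr; apply: eq_bigr => i _; rewrite se.
have sA : s \in A by rewrite memv_suml.
have trs : \tr (z - s * z) = 0.
  pose z' := z - s * z - z * s + s * z * s.
  have z'A : z' \in A by rewrite memvD ?memvB ?mulA.
  have <- : \tr z' = \tr (z - s * z).
    rewrite /z' mxtraceD raddfB /=.
    have -> : \tr (s * z * s) = \tr (z * s) by rewrite -mulrA mxtraceM_comm -mulrA ss.
    by rewrite subrK.
  apply: mxtrace_nil; apply: nil_comp => // i.
    by rewrite /z' mulrDr !mulrBr !mulrA es subrr sub0r addNr.
  by rewrite /z' mulrDl !mulrBl -!mulrA se [_ - _ - _]addrAC subrr sub0r addNr.
move/eqP: trs; rewrite raddfB /= subr_eq0 => /eqP ->.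
by rewrite /s mulr_suml raddf_sum.
Qed.

(** The matrix unit [E i j] is the composite of the isomorphisms of i and j with
    the representative of their class. *)
Lemma exists_matrix_units : inhabited (matrix_units A).
Proof.
pose isob i j := `[< exists a b, iso i j a b >].
have isoP i j : reflect (exists a b, iso i j a b) (isob i j) by exact: asboolP.
have isoxx i : isob i i by apply/isoP; exists (e i), (e i); exact: iso_refl.
have isoC i j : isob i j -> isob j i.
  by move/isoP => [a [b h]]; apply/isoP; exists b, a; exact: iso_sym.
have isoT i j k : isob i j -> isob j k -> isob i k.
  move/isoP => [a [b h]] /isoP[a' [b' h']]; apply/isoP.
  by exists (a * a'), (b' * b); exact: iso_trans h h'.
pose rho i := odflt i [pick j | isob i j].
have rho_iso i : isob i (rho i).
  by rewrite /rho; case: pickP => [j|/(_ i)] //=.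
have rho_eq i j : isob i j -> rho i = rho j.
  move=> ij; rewrite /rho.
  have -> : [pick k | isob i k] = [pick k | isob j k].
    apply: eq_pick => k; apply/idP/idP; apply: isoT => //; exact: isoC.
  by case: pickP => // /(_ j); rewrite isoxx.
have iso_rho i j : rho i = rho j -> isob i j.
  by move=> h; apply: (isoT _ (rho i)) => //; rewrite h; exact: isoC.
have /fin_all_exists[b /fin_all_exists[a ab]] :
    forall i, exists b, exists a, iso i (rho i) b a.
  by move=> i; have /isoP := rho_iso i.
pose E i j := b i * a j.
have aE i : [/\ a i \in A, b i \in A, e i * b i = b i, a i * e i = a i &
    b i * a i = e i].
  by case: (ab i) => ? ? [? ?] [? ?] [? ?]; split.
have abE i : a i * b i = e (rho i) by case: (ab i) => ? ? [? ?] [? ?] [? ?].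
have ae i j : rho i = rho j -> e (rho j) * a i = a i.
  by move=> <-; case: (ab i) => ? ? [? ?] [? ?] [? ?].
have EA i j : E i j \in A by case: (aE i) => ? ? ? ? ?; case: (aE j) => ? ? ? ? ?; exact: mulA.
have Emul i j k l : rho i = rho j -> rho k = rho l ->
    E i j * E k l = if j == k then E i l else 0.
  move=> ij kl; case: (aE j) => _ _ _ aej _; case: (aE k) => _ _ ebk _ _.
  rewrite /E -mulrA [a j * _]mulrA.
  case: eqP => [jk|/eqP jk]; first by rewrite -jk abE jk kl ae.
  rewrite -aej -ebk -[a j * e j * _]mulrA [e j * (_ * _)]mulrA ee (negbTE jk).
  by rewrite mul0r !mulr0 mul0r mulr0.
have Eii i : E i i = e i by case: (aE i).
have eE i j : e i * E i j = E i j by case: (aE i) => ? ? h ? ?; rewrite /E mulrA h.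
have Ee i j : E i j * e j = E i j by case: (aE j) => ? ? ? h ?; rewrite /E -mulrA h.
clearbody E.
have trE i j : i != j -> \tr (E i j) = 0.
  move=> ij; rewrite -(eE i j) -(Ee i j) mulrA mxtraceM_comm mulrA ee eq_sym.
  by rewrite (negbTE ij) mul0r mxtrace0.
(* an element is in the radical if its pairings with all matrix units vanish:
   decompose both factors by the idempotents, and use trace_iso for pairs that are
   not equivalent and corner_nil_trace for the others *)
have radE x : x \in A -> (forall i j, rho i = rho j -> \tr (x * E j i) = 0) ->
    x \in trace_radical A.
  move=> xA hx; apply/trace_radicalP; split=> // y yA.
  rewrite trace_peirce ?mulA // big1 // => i _.
  rewrite mulrA mxtraceM_comm trace_peirce ?mulA // big1 // => j _.
  rewrite mulrA mxtraceM_comm !mulrA.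
  have [ij|ij] := eqVneq (rho i) (rho j); last first.
    apply/eqP; apply: contraR ij => /trace_iso h; apply/eqP/rho_eq/isoP.
    exact: h.
  have -> : e i * x * e j * y = (e i * x * E j i) * (E i j * y).
    by rewrite -!mulrA [E j i * _]mulrA Emul // eqxx Eii.
  set v := e i * x * E j i.
  have ve : v * e i = v by rewrite /v -mulrA Ee.
  have ev : e i * v = v by rewrite /v !mulrA eii.
  have -> : \tr (v * (E i j * y)) = \tr (v * (E i j * y * e i)).
    by rewrite -{1}ev -mulrA mxtraceM_comm -mulrA.
  have vA : v \in A by apply: mulA => //; exact: mulA.
  apply: (@corner_nil_trace i) => //.
  - by apply: mulA => //; exact: mulA.
  - by rewrite !mulrA eE.
  - by rewrite -!mulrA eii.
  - apply: (@nil_corn i) => //.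
    by rewrite /v -mulrA mxtraceM_comm -mulrA Ee hx.
have Espan x : x \in A -> exists c : 'I_r -> 'I_r -> K,
    x - \sum_i \sum_(j | rho i == rho j) c i j *: E i j \in trace_radical A.
  move=> xA; pose c i j := \tr (x * E j i) / \tr (e i).
  exists c; apply: radE.
    by rewrite memvB // memv_suml // => i _; rewrite memv_suml // => j _; rewrite memvZ.
  move=> k l kl; rewrite mulrBl raddfB /=; apply/eqP; rewrite subr_eq0; apply/eqP.
  rewrite mulr_suml raddf_sum (bigD1 k) //= [X in _ + X]big1 ?addr0; last first.
    move=> i ik; rewrite mulr_suml raddf_sum big1 // => j /eqP ij.
    rewrite /= -scalerAl mxtraceZ Emul //; case: eqP => [jl|_]; last by rewrite mxtrace0 mulr0.
    by rewrite trE ?mulr0.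
  rewrite mulr_suml raddf_sum (bigD1 l) /=; last exact/eqP.
  rewrite big1 ?addr0; last first.
    move=> j /andP[/eqP kj jl]; rewrite -scalerAl mxtraceZ Emul //.
    by rewrite (negbTE jl) mxtrace0 mulr0.
  by rewrite -scalerAl mxtraceZ Emul // eqxx Eii /c divfK.
have rhoK i : rho (rho i) = rho i by apply/esym/rho_eq/rho_iso.
exact: inhabits (MatrixUnits rhoK (fun i j _ => EA i j) Emul Espan).
Qed.

End Peirce.

(** * Chains of idempotents and the words that they allow *)

Section CountWords.
Local Open Scope nat_scope.

Lemma bin_le_expn n k : 'C(n, k) <= n.+1 ^ k.
Proof.
apply: (@leq_trans (n ^_ k)); first by rewrite -bin_ffact leq_pmulr // fact_gt0.
elim: k => [|k IH]; first by rewrite ffactn0.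
by rewrite ffactnSr expnSr; apply: leq_mul => //; rewrite leqW // leq_subr.
Qed.

Lemma card_small_sets n N0 : #|[set Y : {set 'I_n} | #|Y| < N0]| <= N0 * n.+1 ^ N0.
Proof.
rewrite -sum1_card (eq_bigl (fun Y : {set 'I_n} => #|Y| < N0)); last by move=> Y; rewrite inE.
elim: N0 => [|N IH]; first by rewrite big_pred0.
have -> : \sum_(Y : {set 'I_n} | #|Y| < N.+1) 1 =
    \sum_(Y : {set 'I_n} | #|Y| < N) 1 + \sum_(Y : {set 'I_n} | #|Y| == N) 1.
  rewrite (bigID (fun Y : {set 'I_n} => #|Y| < N)) /=; congr (_ + _).
    by apply: eq_bigl => Y; rewrite ltnS; case: ltngtP.
  by apply: eq_bigl => Y; rewrite ltnS; case: ltngtP.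
rewrite mulSn addnC leq_add //.
  rewrite sum1_card; have -> : #|[pred Y : {set 'I_n} | #|Y| == N]| = 'C(n, N).
    by rewrite -[in RHS](card_ord n) -card_draws; apply: eq_card => Y; rewrite !inE.
  by apply: leq_trans (bin_le_expn _ _) _; rewrite leq_pexp2l.
by apply: leq_trans IH _; rewrite leq_mul2l leq_pexp2l ?orbT.
Qed.

Lemma card_bigcup_le (T I : finType) (D : {set I}) (W : I -> {set T}) :
  #|\bigcup_(i in D) W i| <= \sum_(i in D) #|W i|.
Proof.
elim/big_rec2: _ => [|i k S _ IH]; first by rewrite cards0.
by apply: leq_trans (leq_card_setU _ _) _; rewrite leq_add2l.
Qed.

Definition good_word (T1 T2 : finType) n N0 d (a : {ffun 'I_n -> T1 + T2}) :=
  (#|[set p | if a p is inr _ then true else false]| < N0) &&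
  [exists X : {set T1}, (#|X| <= d) &&
    [forall p, if a p is inl x then x \in X else true]].

(** The letters in [T2] and their positions are chosen in polynomially many ways. *)
Lemma card_good_words (T1 T2 : finType) n N0 d : N0 <= n ->
  #|[set a : {ffun 'I_n -> T1 + T2} | good_word N0 d a]| <=
  2 ^ #|T1| * (N0 * n.+1 ^ N0 * #|T2|.+1 ^ N0) * d ^ n.
Proof.
move=> N0n.
pose Fm (X : {set T1}) (Y : {set 'I_n}) (p : 'I_n) : pred (T1 + T2)%type :=
  fun z => match z with inl x => (p \notin Y) && (x \in X) | inr _ => p \in Y end.
pose W XY := [set a : {ffun 'I_n -> T1 + T2} | a \in family (Fm XY.1 XY.2)].
pose D := [set XY : {set T1} * {set 'I_n} | (#|XY.1| <= d) && (#|XY.2| < N0)].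
have sub : [set a : {ffun 'I_n -> T1 + T2} | good_word N0 d a] \subset
    \bigcup_(XY in D) W XY.
  apply/subsetP => a; rewrite inE => /andP[Ya /existsP[X /andP[Xd /forallP Xa]]].
  apply/bigcupP; exists (X, [set p | if a p is inr _ then true else false]).
    by rewrite inE Xd.
  rewrite inE; apply/familyP => p; have := Xa p.
  by rewrite /Fm unfold_in /= !inE; case: (a p).
apply: leq_trans (subset_leq_card sub) _.
apply: leq_trans (card_bigcup_le _ _) _.
have leW XY : XY \in D -> #|W XY| <= #|T2|.+1 ^ N0 * d ^ n.
  case: XY => X Y; rewrite inE /= => /andP[Xd YN].
  have -> : #|W (X, Y)| = \prod_p #|Fm X Y p|.
    have -> : #|W (X, Y)| = #|family (Fm X Y)| by apply: eq_card => a; rewrite inE.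
    by rewrite card_family foldrE big_map big_enum.
  apply: (@leq_trans (\prod_p (if p \in Y then #|T2| else d))).
    apply: leq_prod => p _; case: ifP => pY.
      rewrite -(card_codom (@inr_inj T1 T2)); apply: subset_leq_card.
      apply/subsetP => -[x|y]; rewrite unfold_in /= pY // => _.
      exact: codom_f.
    apply: leq_trans Xd; rewrite -(card_imset _ (@inl_inj T1 T2)).
    apply: subset_leq_card; apply/subsetP => -[x|y]; rewrite unfold_in /= pY //=.
    by move=> xX; apply/imsetP; exists x.
  rewrite (bigID [in Y]) /=.
  rewrite (eq_bigr (fun=> #|T2|)) => [|p ->//].
  rewrite [X in _ * X](eq_bigr (fun=> d)) => [|p /negbTE ->//].
  rewrite !prod_nat_const; apply: leq_mul.
    apply: (@leq_trans (#|T2|.+1 ^ #|Y|)); last by rewrite leq_pexp2l // ltnW.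
    by have [->//|Y0] := posnP #|Y|; rewrite leq_exp2r.
  have cY : #|[pred p | p \notin Y]| = n - #|Y|.
    have /eqP := cardC Y; rewrite card_ord addnC => /eqP h.
    have -> : #|[pred p | p \notin Y]| = #|[predC Y]| by apply: eq_card => p.
    by move: h; lia.
  have nY : #|Y| < n by exact: leq_trans YN N0n.
  rewrite cY; have [->|d0] := posnP d; last by rewrite leq_pexp2l // leq_subr.
  by rewrite exp0n // subn_gt0.
apply: (@leq_trans (\sum_(XY in D) (#|T2|.+1 ^ N0 * d ^ n))); first exact: leq_sum.
rewrite sum_nat_const !mulnA !leq_mul2r; apply/orP; right; apply/orP; right.
apply: (@leq_trans #|setX [set: {set T1}] [set Y : {set 'I_n} | #|Y| < N0]|).
  by apply: subset_leq_card; apply/subsetP => -[X Y]; rewrite !inE /= => /andP[].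
have c2 : #|[set: {set T1}]| = 2 ^ #|T1| by rewrite -powersetT card_powerset cardsT.
rewrite cardsX c2 -mulnA leq_mul2l; apply/orP; right.
exact: card_small_sets.
Qed.

End CountWords.

Section UpperBound.
Variables (K : fieldType) (q : nat) (A : {vspace 'M[K]_q.+1}).
Hypothesis mulA : forall x y, x \in A -> y \in A -> x * y \in A.
Variable U : matrix_units A.
Local Notation r := (munit_size U).
Local Notation rho := (@class_rep _ _ _ U).
Local Notation E := (@munit _ _ _ U).
Local Notation J := (trace_radical A).

Definition unital_hull : {vspace 'M[K]_q.+1} := (A + 1)%VS.
Local Notation A1 := unital_hull.

(** [chain [:: i1; ...; it]] is spanned by the products y0 e_i1 y1 ... e_it yt, where
    the y's belong to A with a unit adjoined. *)
Definition chain (s : seq 'I_r) : {vspace 'M[K]_q.+1} :=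
  foldr (fun i V => A1 * <[E i i]> * V)%VS A1 s.

Lemma subv_hull : (A <= A1)%VS.
Proof. exact: addvSl. Qed.

Lemma hull1 : 1 \in A1.
Proof. by rewrite memvE -[<[1]>%VS]/(1%VS) addvSr. Qed.

Lemma prod_sub_A V W : (V <= A)%VS -> (W <= A)%VS -> (V * W <= A)%VS.
Proof. by move=> VA WA; apply/prodvP => x y /(subvP VA) xA /(subvP WA) yA; exact: mulA. Qed.

Lemma hullMr : (A * A1 <= A)%VS.
Proof. by rewrite prodvDr prodv1 subv_add subvv andbT prod_sub_A. Qed.

Lemma hullMl : (A1 * A <= A)%VS.
Proof. by rewrite prodvDl prod1v subv_add subvv andbT prod_sub_A. Qed.

Lemma hullM : (A1 * A1 <= A1)%VS.
Proof.
rewrite {1}/A1 prodvDl prod1v subv_add subvv andbT.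
exact: subv_trans hullMr subv_hull.
Qed.

Lemma chain_hull s : (A1 * chain s <= chain s)%VS.
Proof.
case: s => [|i s] /=; first exact: hullM.
by rewrite !prodvA !prodvSl // hullM.
Qed.

Lemma E_A i : E i i \in A. Proof. exact: munit_mem. Qed.

Lemma chain_cons i s : (chain (i :: s) <= chain s)%VS.
Proof.
apply: subv_trans (chain_hull s); rewrite /= prodvSl //.
by apply: subv_trans (prodvSr _ _) (subv_trans hullMl subv_hull); rewrite -memvE E_A.
Qed.

Lemma chain_subseq s s' : subseq s' s -> (chain s <= chain s')%VS.
Proof.
elim: s s' => [|i s IH] [|j s'] //= h.
  by apply: subv_trans (chain_cons i s) (IH [::] _); rewrite sub0seq.
move: h; case: eqP => [->|_] h; first by rewrite prodvSr // IH.
exact: subv_trans (chain_cons i s) (IH _ h).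
Qed.

(** The number of these pairs is the dimension of the sum of the simple components
    with representatives in s. *)
Definition edges (s : seq 'I_r) : {set 'I_r * 'I_r} :=
  [set x | (rho x.1 == rho x.2) && (rho x.1 \in s)].

(** The common exponent is [#|edges s0|]. Repetitions can be removed from [s0], because
    chains grow when indices are dropped. *)
Lemma exists_best_chain : exists s0 : seq 'I_r,
  [/\ uniq s0, all (fun i => rho i == i) s0, chain s0 != 0%VS &
  forall s, all (fun i => rho i == i) s -> chain s != 0%VS ->
    (#|edges s| <= #|edges s0|)%N].
Proof.
pose P n := `[< exists s, [/\ all (fun i => rho i == i) s, chain s != 0%VS &
  #|edges s| = n] >].
have exP : exists n, P n.
  exists #|edges [::]|; apply/asboolP; exists [::]; split=> //.
  apply/eqP => h; have := hull1; rewrite -[unital_hull]/(chain [::]) h memv0.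
  by rewrite oner_eq0.
have ub n : P n -> (n <= #|{: 'I_r * 'I_r}|)%N.
  by move=> /asboolP[s [_ _ <-]]; exact: max_card.
have [n /asboolP[s [sr s0 sn]] maxn] := ex_maxnP exP ub.
exists (undup s); split.
- exact: undup_uniq.
- by apply/allP => i; rewrite mem_undup; exact: (allP sr).
- apply: contraNneq s0 => h; rewrite -subv0 -h.
  by apply: chain_subseq; exact: undup_subseq.
- move=> s' s'r s'0.
  have -> : #|edges (undup s)| = n.
    by rewrite -sn; apply: eq_card => x; rewrite !inE mem_undup.
  by apply: maxn; apply/asboolP; exists s'.
Qed.

Variables (N0 d : nat).
Hypothesis J_nil : (J ^+ N0)%VS = 0%VS.
Hypothesis d_max : forall s, all (fun i => rho i == i) s -> chain s != 0%VS ->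
    (#|edges s| <= d)%N.

Definition letter : finType := ('I_r * 'I_r + 'I_(\dim J))%type.

Definition letter_mx (z : letter) : 'M[K]_q.+1 :=
  match z with
  | inl x => if rho x.1 == rho x.2 then E x.1 x.2 else 0
  | inr k => (vbasis J)`_k
  end.

Lemma letter_span x : x \in A -> exists c : letter -> K,
  x = \sum_z c z *: letter_mx z.
Proof.
move=> /(munit_span U)[c]; set y := \sum_i _ => /coord_vbasis h.
exists (fun z => match z with inl x => c x.1 x.2 | inr k => coord (vbasis J) k (x - y) end).
rewrite big_sumType /= -h /y.
rewrite (eq_bigr (fun x : 'I_r * 'I_r =>
   if rho x.1 == rho x.2 then c x.1 x.2 *: E x.1 x.2 else 0)); last first.
  by move=> z _; case: ifP; rewrite ?scaler0.
rewrite -(pair_bigA _ (fun i j => if rho i == rho j then c i j *: E i j else 0)) /=.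
under eq_bigr do rewrite -big_mkcond.
by rewrite addrC subrK.
Qed.

(** All that the upper bound uses about the operators applied to the variables. *)
Definition ideal_stable (T : 'M[K]_q.+1 -> 'M[K]_q.+1) :=
  [/\ T 0 = 0, forall x, x \in J -> T x \in J &
   forall i x, x \in (A * <[E i i]> * A)%VS -> T x \in (A * <[E i i]> * A)%VS].

Definition label (z : letter) : option 'I_r :=
  if z is inl x then Some (rho x.1) else None.

Lemma letter_label T z : ideal_stable T -> T (letter_mx z) != 0 ->
  if label z is Some i then T (letter_mx z) \in (A * <[E i i]> * A)%VS
  else T (letter_mx z) \in J.
Proof.
case=> T0 TJ TE; case: z => [[i j]|k] /=; last first.
  by move=> _; apply/TJ/vbasis_mem/mem_nth; rewrite size_tuple.
case: (rho i =P rho j) => [ij|_]; last by rewrite T0 eqxx.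
move=> _; apply: TE.
have ri : rho (rho i) = rho i by exact: class_repK.
have -> : E i j = E i (rho i) * E (rho i) (rho i) * E (rho i) j.
  by rewrite munit_mul ?ri // eqxx munit_mul ?ri // eqxx.
by rewrite !memv_mul ?memv_line ?munit_mem ?ri.
Qed.

(** A factor in A e_i A contributes the index i to the chain, and a factor in J is
    absorbed by the element of A between two idempotents while it raises the power
    of J. *)
Lemma prod_letters_chain (X : eqType) (ps : seq X) (o : X -> option 'I_r)
    (x : X -> 'M[K]_q.+1) :
  (forall p, p \in ps ->
     if o p is Some i then x p \in (A * <[E i i]> * A)%VS else x p \in J) ->
  \prod_(p <- ps) x p \in chain (pmap o ps) /\
  \prod_(p <- ps) x p \in (J ^+ (count (fun p => o p == None) ps) * A1)%VS.
Proof.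
elim: ps => [|p ps IH] h; first by rewrite big_nil /= expv0 prod1v hull1.
have [|IH1 IH2] := IH; first by move=> p' hp; apply: h; rewrite inE hp orbT.
have := h p (mem_head _ _); rewrite big_cons /=.
case op : (o p) => [i|] /= xp.
  have xA : x p \in A.
    have : (A * <[E i i]> * A <= A)%VS.
      by rewrite !prod_sub_A ?subvv // -memvE E_A.
    by move/subvP; apply.
  split.
    have sub : (A * <[E i i]> * A * chain (pmap o ps) <= A1 * <[E i i]> * chain (pmap o ps))%VS.
      have AC := subv_trans (prodvSl _ subv_hull) (chain_hull (pmap o ps)).
      rewrite -prodvA; apply: subv_trans (prodvSr _ AC) _.
      by rewrite !prodvSl // subv_hull.
    by apply: (subvP sub); rewrite memv_mul.
  rewrite add0n.
  have sub k : (A * (J ^+ k * A1) <= J ^+ k * A1)%VS.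
    case: k => [|k]; first by rewrite expv0 prod1v; exact: subv_trans hullMr subv_hull.
    rewrite expvSl -!prodvA prodvA; apply: prodvSl.
    by apply/prodvP => a b aA bJ; exact: trace_radicalMl.
  by apply: (subvP (sub _)); rewrite memv_mul.
split.
  apply: (subvP (chain_hull _)); rewrite memv_mul //.
  by apply: (subvP subv_hull); case/trace_radicalP: xp.
by rewrite expvSl -prodvA memv_mul.
Qed.

(** The factors of a nonzero product are nonzero, their labels form a nonzero chain,
    and less than [N0] of them are in J. *)
Lemma nonzero_word_good n (T : 'I_n -> 'M[K]_q.+1 -> 'M[K]_q.+1)
    (s : 'S_n) (a : {ffun 'I_n -> letter}) :
  (forall p, ideal_stable (T p)) ->
  \prod_p T p (letter_mx (a (s p))) != 0 -> good_word N0 d a.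
Proof.
move=> hT nz.
have fac0 p : T p (letter_mx (a (s p))) != 0.
  apply: contraNneq nz => Tp.
  have := mem_index_enum p; move: (index_enum _) => ps; elim: ps => [|p' ps IH] //=.
  rewrite inE big_cons => /orP[/eqP <-|/IH /eqP ->]; last by rewrite mulr0.
  by rewrite Tp mul0r.
have [] := @prod_letters_chain _ (index_enum 'I_n) (fun p => label (a (s p)))
  (fun p => T p (letter_mx (a (s p)))).
  by move=> p _; exact: letter_label.
set l := pmap _ _; set k := count _ _; set P := \prod_(p <- _) _ => Pl Pk.
apply/andP; split.
  have -> : #|[set p | if a p is inr _ then true else false]| = k.
    rewrite -(card_imset _ (@perm_inj _ (s^-1)%g)) /k -sum1_count -sum1_card.
    apply: eq_bigl => p.
    apply/imsetP/idP => [[p' + ->]|].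
      by rewrite inE permKV; case: (a p').
    move=> h; exists (s p); last by rewrite permK.
    by rewrite inE; move: h; case: (a (s p)).
  rewrite ltnNge; apply: contra nz => N0k; move: Pk.
  by rewrite -(subnKC N0k) expvD J_nil !prod0v memv0.
apply/existsP; exists (edges l); apply/andP; split.
  apply: d_max; last by apply: contraNneq nz => l0; move: Pl; rewrite l0 memv0.
  apply/allP => i; rewrite mem_pmap => /mapP[p _].
  by rewrite /label; case: (a (s p)) => // x [->]; rewrite class_repK.
apply/forallP => p; case ap : (a p) => [x|] //.
have := fac0 ((s^-1)%g p); rewrite permKV ap /=.
case: (rho x.1 =P rho x.2) => [e _|_]; last by case: (hT ((s^-1)%g p)) => -> _ _; rewrite eqxx.
rewrite inE e eqxx /= mem_pmap; apply/mapP; exists ((s^-1)%g p).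
  exact: mem_index_enum.
by rewrite permKV ap /= e.
Qed.

End UpperBound.

(** * Evaluation of monomials along chains *)

Section LowerBound.
Variables (K : fieldType) (charK : [pchar K] =i pred0).
Variables (q : nat) (A : {vspace 'M[K]_q.+1}).
Hypothesis mulA : forall x y, x \in A -> y \in A -> x * y \in A.
Variable U : matrix_units A.
Local Notation r := (munit_size U).
Local Notation rho := (@class_rep _ _ _ U).
Local Notation E := (@munit _ _ _ U).
Local Notation A1 := (unital_hull A).

Section Chain.
Variables (i0 : 'I_r) (s : seq 'I_r).

(** The product of the first factors of a chain, up to the idempotent with number
    [l - 1]. *)
Fixpoint partial_chain (y : nat -> 'M[K]_q.+1) l : 'M[K]_q.+1 :=
  if l is k.+1 then partial_chain y k * y k * E (nth i0 s k) (nth i0 s k) else 1.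

Lemma partial_chain_ext y y' l : (forall k, (k < l)%N -> y k = y' k) ->
  partial_chain y l = partial_chain y' l.
Proof.
elim: l => //= l IH h; rewrite h // IH // => k kl.
by apply: h; rewrite ltnS ltnW.
Qed.

Lemma partial_chain_E y l :
  partial_chain y l.+1 * E (nth i0 s l) (nth i0 s l) = partial_chain y l.+1.
Proof. by rewrite /= -mulrA munit_mul // eqxx. Qed.

(** A nonzero space of products contains a nonzero product; the factors y are found
    one after the other, and c is the last of them. *)
Lemma exists_partial_chain : chain s != 0%VS ->
  exists (y : nat -> 'M[K]_q.+1) (c : 'M[K]_q.+1),
    [/\ forall k, y k \in A1, c \in A1 & partial_chain y (size s) * c != 0].
Proof.
move=> s0.
suff step l : (l <= size s)%N -> exists (y : nat -> 'M[K]_q.+1) (c : 'M[K]_q.+1),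
    [/\ forall k, y k \in A1, c \in chain (drop l s) & partial_chain y l * c != 0].
  have [y [c]] := step _ (leqnn _); rewrite drop_size => -[yA cA nz].
  by exists y, c.
elim: l => [|l IH] ls.
  exists (fun=> 1), (vpick (chain s)); rewrite drop0 memv_pick mul1r vpick0.
  by split=> // k; exact: hull1.
have [y [c [yA cA nz]]] := IH (ltnW ls).
move: cA; rewrite (drop_nth i0) //=; set i := nth i0 s l => cA.
have [y1 [c' [y1A c'A nz']]] : exists y1 c', [/\ y1 \in A1, c' \in chain (drop l.+1 s) &
    partial_chain y l * y1 * E i i * c' != 0].
  apply: contra_notP (negP nz) => nex.
  have sub : (A1 * <[E i i]> * chain (drop l.+1 s) <= lker (amull (partial_chain y l)))%VS.
    apply/prodvP => v c' vA c'A.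
    have sub' : (A1 * <[E i i]> <= lker (amulr c' \o amull (partial_chain y l)))%VS.
      apply/prodvP => y1 _ y1A /vlineP[k ->]; rewrite memv_ker.
      rewrite comp_lfunE !lfunE /= -!scalerAr -scalerAl.
      rewrite scaler_eq0; apply/orP; right; apply: contraT => h; case: nex.
      by exists y1, c'; split=> //; rewrite !mulrA in h *.
    have := subvP sub' _ vA; rewrite !memv_ker comp_lfunE !lfunE /=.
    by rewrite mulrA.
  by have := subvP sub _ cA; rewrite memv_ker lfunE.
exists (fun k => if k == l then y1 else y k), c'; split=> //.
  by move=> k; case: ifP.
rewrite /= eqxx -(@partial_chain_ext y) // => k kl.
by rewrite ltn_eqF.
Qed.

End Chain.

Section Evaluation.
Variables (t : nat) (s : seq 'I_r).
Hypotheses (us : uniq s) (rs : all (fun i => rho i == i) s) (szs : size s = t.+1).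
Hypothesis s_nz : chain s != 0%VS.

(** The idempotents whose class occurs in the chain. *)
Definition vertex : finType := {i : 'I_r | rho i \in s}.

Definition vclass (i : vertex) : 'I_t.+1 := inord (index (rho (val i)) s).

Lemma vclassE (i : vertex) : vclass i = index (rho (val i)) s :> nat.
Proof. by rewrite inordK // -szs index_mem (valP i). Qed.

Lemma vclass_rho (i j : vertex) : vclass i = vclass j -> rho (val i) = rho (val j).
Proof.
move=> h; have := congr1 val h; rewrite /= !vclassE => e.
by rewrite -(nth_index (rho (val i)) (valP i)) e nth_index // (valP j).
Qed.

Let i0 : 'I_r := tnth (in_tuple s) (cast_ord (esym szs) ord0).

Lemma rho_nth (l : 'I_t.+1) : rho (nth i0 s l) = nth i0 s l.
Proof. by apply/eqP; apply: (allP rs); rewrite mem_nth // szs. Qed.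

Fact base_in (l : 'I_t.+1) : rho (nth i0 s l) \in s.
Proof. by rewrite rho_nth mem_nth // szs. Qed.

Definition vbase (l : 'I_t.+1) : vertex := Sub (nth i0 s l) (base_in l).

Lemma vbaseK : cancel vbase vclass.
Proof.
move=> l; apply: val_inj; rewrite /= vclassE /= rho_nth index_uniq // szs.
exact: ltn_ord.
Qed.

Lemma card_edges_le :
  (#|edges s| <= #|[set x : vertex * vertex | vclass x.1 == vclass x.2]|)%N.
Proof.
pose f (x : vertex * vertex) := (val x.1, val x.2).
apply: (@leq_trans #|[set f x | x in [set x | vclass x.1 == vclass x.2]]|);
  last exact: leq_imset_card.
apply: subset_leq_card; apply/subsetP => -[i j]; rewrite inE /= => /andP[/eqP ij is_].
have js : rho j \in s by rewrite -ij.
apply/imsetP; exists (Sub i is_, Sub j js) => //.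
by rewrite inE /= -val_eqE /= !vclassE /= ij.
Qed.

Variables (y : nat -> 'M[K]_q.+1) (c : 'M[K]_q.+1).
Hypotheses (yA : forall k, y k \in A1).
Local Notation W := (partial_chain i0 s y).
Variables (n : nat) (lab : {ffun 'I_n.+1 -> 'I_t.+1}).
Hypotheses (labm : nondecreasing_lab lab) (labo : onto_lab lab).

(** The markers carry the factors of the chain and the other variables carry matrix
    units. The value zero at words that are not admissible makes the test in
    [word_value] valid for all words. *)
Definition letter_value (w : {ffun 'I_n.+1 -> vertex * vertex}) (p : 'I_n.+1) :
    'M[K]_q.+1 :=
  if ~~ admissible vclass vbase lab w then 0 else
  if marker lab p then
    if p == ord0 then E (nth i0 s 0) (nth i0 s 0)
    else E (val (w p).1) (val (w p).1) * y (lab p) * E (val (w p).2) (val (w p).2)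
  else E (val (w p).1) (val (w p).2).

Lemma letter_value_A w p : letter_value w p \in A.
Proof.
rewrite /letter_value; case: ifP => [|/negbFE aw]; first by rewrite mem0v.
case: ifP => mp; last first.
  by apply: munit_mem; apply: vclass_rho; apply: (admissible_edge aw); rewrite mp.
case: ifP => _; first exact: munit_mem.
apply: mulA; last exact: munit_mem.
apply: (subvP (hullMr mulA)); rewrite memv_mul //; exact: munit_mem.
Qed.

Lemma cnext_lt (p : 'I_n.+1) : (p.+1 < n.+1)%N -> cnext n p = p.+1 :> nat.
Proof. by move=> h; rewrite cnextE modn_small. Qed.

(** The product telescopes as long as the edges compose: it is the part of the chain
    up to the current block, times one matrix unit that starts at the base of
    the block. *)
Lemma prefix_value (u : 'S_n.+1) (w : {ffun 'I_n.+1 -> vertex * vertex}) k :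
  u \in fix_markers lab -> admissible vclass vbase lab w -> (k <= n)%N ->
  y 0 * \prod_(j < k.+1) letter_value w (u (inord j)) =
    (if [forall p : 'I_n.+1, (p < k)%N ==> ((w (u p)).2 == (w (u (cnext n p))).1)]
     then W (lab (inord k)).+1 * E (val (vbase (lab (inord k)))) (val (w (u (inord k))).2)
     else 0) /\
  ([forall p : 'I_n.+1, (p < k)%N ==> ((w (u p)).2 == (w (u (cnext n p))).1)] ->
   vclass (w (u (inord k))).2 = lab (inord k)).
Proof.
move=> uH aw; elim: k => [|k IH] kn.
  have m0 : marker lab ord0 by exact: marker0.
  have i00 : inord 0 = ord0 :> 'I_n.+1 by apply: val_inj; rewrite /= inordK.
  rewrite ifT; last by apply/forallP.
  rewrite big_ord1 /= !i00 !(fix_markersP uH m0) /letter_value aw /=.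
  rewrite (admissible_marker aw m0) (lab_first labm labo) /= mul1r.
  rewrite -mulrA munit_mul // eqxx; split=> // _.
  exact: vbaseK.
have [IH1 IH2] := IH (ltnW kn).
rewrite big_ord_recr /= mulrA IH1.
have ik : nat_of_ord (inord k : 'I_n.+1) = k by rewrite inordK // ltnS ltnW.
have ik1 : nat_of_ord (inord k.+1 : 'I_n.+1) = k.+1 by rewrite inordK // ltnS.
have nk : cnext n (inord k) = inord k.+1.
  by apply: val_inj; rewrite /= cnext_lt ik // ik1.
have pk : cprev n (inord k.+1) = inord k by rewrite -nk cnextK.
set P := [forall p : 'I_n.+1, (p < k)%N ==> _] in IH1 IH2 *.
set p := inord k.+1 in nk pk ik1 *; set p' := inord k in nk pk ik IH1 IH2 *.
have -> : [forall p : 'I_n.+1, (p < k.+1)%N ==> ((w (u p)).2 == (w (u (cnext n p))).1)] =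
    P && ((w (u p')).2 == (w (u p)).1).
  apply/forallP/andP => [h|[/forallP h1 h2] x].
    split; last by have := h p'; rewrite ik ltnSn nk.
    apply/forallP => x; apply/implyP => xk; have := h x.
    by rewrite (ltn_trans xk).
  apply/implyP; rewrite ltnS leq_eqVlt => /orP[/eqP xk|xk]; last by have := h1 x; rewrite xk.
  have -> : x = p' by apply: val_inj; rewrite /= xk ik.
  by rewrite nk.
case: (boolP P) => [hP|_]; last by rewrite mul0r.
have cls := IH2 hP.
have p0 : p != ord0 by rewrite -val_eqE /= ik1.
have rb : rho (val (vbase (lab p'))) = rho (val (w (u p')).2).
  by apply: vclass_rho; rewrite vbaseK cls.
have [mp|mp] := boolP (marker lab p).
  have up : u p = p by exact: fix_markersP uH mp.
  have lE := lab_marker labm labo mp p0; rewrite pk in lE.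
  have lv : letter_value w (u p) = E (val (vbase (lab p'))) (val (vbase (lab p'))) *
      y (lab p) * E (val (vbase (lab p))) (val (vbase (lab p))).
    by rewrite up /letter_value aw mp (negbTE p0) (admissible_marker aw mp) pk.
  have wp : w (u p) = (vbase (lab p'), vbase (lab p)).
    by rewrite up (admissible_marker aw mp) pk.
  rewrite lv wp; split; last by move=> _; exact: vbaseK.
  rewrite !mulrA -[_ * E _ _ * E _ _ * y _]mulrA -[_ * E _ _ * _]mulrA [E _ _ * (_ * _)]mulrA.
  rewrite (munit_mul rb (erefl _)) val_eqE.
  case: eqP => _; last by rewrite mul0r mulr0 mul0r.
  rewrite (partial_chain_E _ _ y (lab p)) mulrA (partial_chain_E _ _ y (lab p')).
  by rewrite -lE.
have rw : rho (val (w (u p)).1) = rho (val (w (u p)).2).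
  by apply: vclass_rho; apply: (admissible_edge aw); rewrite marker_perm // mp.
rewrite /letter_value aw /= marker_perm // (negbTE mp).
rewrite -mulrA (munit_mul rb rw) val_eqE.
have labp : lab p' = lab p by rewrite -pk lab_cprev.
case: eqP => e; last by rewrite mulr0.
rewrite -labp; split=> // _.
by rewrite -(admissible_edge aw) ?marker_perm // -e.
Qed.

Lemma word_value (u : 'S_n.+1) (w : {ffun 'I_n.+1 -> vertex * vertex}) :
  u \in fix_markers lab ->
  y 0 * (\prod_p letter_value w (u p)) * (E (nth i0 s t) (nth i0 s t) * c) =
  (w \in paths vclass vbase lab u)%:R *: (W t.+1 * c).
Proof.
move=> uH; rewrite inE.
have [aw|naw] := boolP (admissible vclass vbase lab w); last first.
  by rewrite /= scale0r big_ord_recl {1}/letter_value naw mul0r mulr0 mul0r.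
have [] := prefix_value uH aw (leqnn n).
have inn : inord n = ord_max :> 'I_n.+1 by apply: val_inj; rewrite /= inordK.
rewrite inn (lab_last labm labo).
have -> : \prod_(j < n.+1) letter_value w (u (inord j)) =
    \prod_p letter_value w (u p).
  by apply: eq_bigr => j _; rewrite inord_val.
move=> -> cls; set P := [forall p : 'I_n.+1, _] in cls *.
have cm : cnext n ord_max = ord0.
  by apply: val_inj; rewrite /= cnextE modnn.
have m0 : marker lab ord0 by exact: marker0.
have w0 : (w (u (cnext n ord_max))).1 = vbase ord_max.
  rewrite cm (fix_markersP uH m0) (admissible_marker aw m0) /=.
  by rewrite -cm cnextK (lab_last labm labo).
have -> : closed_path u w = P && ((w (u ord_max)).2 == vbase ord_max).
  apply/forallP/andP => [h|[/forallP h1 /eqP h2] p].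
    split; last by rewrite -w0.
    by apply/forallP => p; apply/implyP.
  have := ltn_ord p; rewrite ltnS leq_eqVlt => /orP[/eqP pn|pn].
    have -> : p = ord_max by apply: val_inj.
    by rewrite h2 w0.
  by have := h1 p; rewrite pn.
case: (boolP P) => [hP|_]; last by rewrite mul0r scale0r.
have rb : rho (val (vbase ord_max)) = rho (val (w (u ord_max)).2).
  by apply: vclass_rho; rewrite vbaseK cls.
rewrite !andTb -[nth i0 s t]/(val (vbase ord_max)).
rewrite mulrA -[W _ * _ * _]mulrA (munit_mul rb (erefl _)) val_eqE.
case: eqP => _; last by rewrite mulr0 mul0r scale0r.
by rewrite scale1r (partial_chain_E _ _ y t).
Qed.

End Evaluation.

(** The lower bound in a form that only refers to the values of monomials: an
    entry of the value of a monomial, multiplied on both sides by fixed matrices,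
    tests whether a word is a path. *)
Lemma exists_evaluation (s : seq 'I_r) (t : nat) : uniq s ->
  all (fun i => rho i == i) s -> size s = t.+1 -> chain s != 0%VS ->
  exists2 C : nat, (0 < C)%N & forall n, exists (W : finType)
    (H : {set 'S_(t + n).+1}) (f : 'S_(t + n).+1 -> {set W})
    (v : W -> 'I_(t + n).+1 -> 'M[K]_q.+1) (x y : 'M[K]_q.+1) (i j : 'I_q.+1),
  [/\ forall w p, v w p \in A,
    exists2 z, z != 0 & forall u w, u \in H ->
      (x * (\prod_p v w (u p)) * y) i j = (w \in f u)%:R * z &
    (#|edges s| ^ n <= C * (t + n).+2 ^ C * \rank (incidence_mx K H f))%N].
Proof.
move=> us rs szs snz.
pose i0 : 'I_r := tnth (in_tuple s) (cast_ord (esym szs) ord0).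
have [y [c [yA cA nz]]] := exists_partial_chain i0 snz.
pose V := vertex s.
pose C := (#|V| ^ (4 * t.+1) + (2 * t.+1 + #|V| * #|V|))%N.
exists C.+1 => // n.
have [lab [labm labo rk]] := exists_path_rank (vbaseK us rs szs) charK n.
exists _, (fix_markers lab), (paths (vclass t (s := s)) (vbase rs szs) lab),
  (letter_value rs szs y lab), (y 0), (E (nth i0 s t) (nth i0 s t) * c).
move: nz; rewrite szs => nz.
have [i [j zij]] : exists i j, (partial_chain i0 s y t.+1 * c) i j != 0.
  apply: contra_notP (negP nz) => h; apply/eqP/matrixP => i j; rewrite [RHS]mxE.
  by apply/eqP; apply: contraT => hij; case: h; exists i, j.
exists i, j; split.
- by move=> w p; exact: letter_value_A.
- exists ((partial_chain i0 s y t.+1 * c) i j) => // u w uH.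
  by rewrite word_value // mxE.
apply: (@leq_trans (#|[set x : V * V | vclass t x.1 == vclass t x.2]| ^ n)%N).
  have mono (a b k : nat) : (a <= b)%N -> (a ^ k <= b ^ k)%N.
    by case: k => // k ab; rewrite leq_exp2r.
  by apply: mono; exact: card_edges_le.
apply: leq_trans rk _; rewrite leq_mul2r; apply/orP; right.
by apply: leq_mul; [exact: leqW (leq_addr _ _)|rewrite leq_pexp2l // leqW // leq_addl].
Qed.

End LowerBound.

(** * Growth of the multilinear monomials of a matrix algebra *)

Section AdOperators.
Variables (K : fieldType) (q : nat).

Definition ad_word (x : 'M[K]_q.+1) (s : seq 'M[K]_q.+1) : 'M[K]_q.+1 :=
  foldl (fun y D => y * D - D * y) x s.

(** The operators are given by coefficients and lists of matrices, so that they can be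
    extended to larger fields. *)
Definition ad_op (l : seq (K * seq 'M[K]_q.+1)) (x : 'M[K]_q.+1) : 'M[K]_q.+1 :=
  \sum_(cs <- l) cs.1 *: ad_word x cs.2.

Lemma ad_word_linear s : linear (ad_word^~ s).
Proof.
rewrite /ad_word; elim: s => [|D s IH] a x y //=.
rewrite -IH; congr foldl.
by rewrite mulrDl mulrDr -scalerAl -scalerAr scalerBr opprD addrACA.
Qed.

Fact ad_op_linear l : linear (ad_op l).
Proof.
move=> a x y; rewrite /ad_op scaler_sumr -big_split /=; apply: eq_bigr => cs _.
by rewrite ad_word_linear scalerDr !scalerA mulrC.
Qed.

HB.instance Definition _ l :=
  GRing.isLinear.Build K 'M[K]_q.+1 'M[K]_q.+1 *:%R (ad_op l) (ad_op_linear l).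

Lemma ad_op_id x : ad_op [:: (1, [::])] x = x.
Proof. by rewrite /ad_op big_seq1 scale1r. Qed.

Lemma ad_op_stable (V : {vspace 'M[K]_q.+1}) (l : seq (K * seq 'M[K]_q.+1)) x :
  (forall cs, cs \in l -> forall D, D \in cs.2 ->
    forall y, y \in V -> y * D - D * y \in V) ->
  x \in V -> ad_op l x \in V.
Proof.
move=> h xV; rewrite /ad_op big_seq memv_suml // => cs csl; rewrite memvZ //.
have := h cs csl; move: (cs.2) x xV => s; elim: s => [|D s IH] x xV hs //=.
apply: IH => [|D' D's]; first by apply: hs; rewrite ?mem_head.
by apply: hs; rewrite inE D's orbT.
Qed.

(** Multilinearity of the monomial given by s. *)
Lemma prod_linear_expand (J : finType) n (T : 'I_n -> {linear 'M[K]_q.+1 -> 'M[K]_q.+1})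
    (s : 'S_n) (c : 'I_n -> J -> K) (y : J -> 'M[K]_q.+1) :
  \prod_p T p (\sum_j c (s p) j *: y j) =
  \sum_(f : {ffun 'I_n -> J})
    (\prod_p c p (f p)) *: \prod_p T p (y (f (s p))).
Proof.
under eq_bigr => p _ do rewrite linear_sum.
rewrite bigA_distr_bigA /=.
pose h (f : {ffun 'I_n -> J}) : {ffun 'I_n -> J} := [ffun p => f (s p)].
have h_bij : bijective h.
  exists (fun f : {ffun 'I_n -> J} => [ffun p => f ((s^-1)%g p)] : {ffun 'I_n -> J}) => f;
    apply/ffunP => p.
    by rewrite !ffunE permKV.
  by rewrite !ffunE permK.
rewrite (reindex h) /=; last exact: onW_bij.
apply: eq_bigr => f _.
under eq_bigr => p _ do rewrite linearZ ffunE.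
rewrite scaler_prod [in RHS](reindex_inj (@perm_inj _ s)).
by [].
Qed.

End AdOperators.

Definition map_ad (F K : fieldType) (phi : {rmorphism F -> K}) q
    (l : seq (F * seq 'M[F]_q.+1)) : seq (K * seq 'M[K]_q.+1) :=
  [seq (phi cs.1, [seq map_mx phi D | D <- cs.2]) | cs <- l].

Lemma map_ad_op (F K : fieldType) (phi : {rmorphism F -> K}) q l (x : 'M[F]_q.+1) :
  map_mx phi (ad_op l x) = ad_op (map_ad phi l) (map_mx phi x).
Proof.
rewrite /ad_op big_map map_mx_sum; apply: eq_bigr => cs _ /=.
rewrite map_mxZ; congr (_ *: _).
elim: (cs.2) x => [|D s IH] x //=.
by rewrite /ad_word /= -!/(ad_word _ _) IH map_mxB; congr (ad_word (_ - _) _); exact: map_mxM.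
Qed.

Lemma map_mx_prod (F K : fieldType) (phi : {rmorphism F -> K}) q I (s : seq I)
    (X : I -> 'M[F]_q.+1) :
  map_mx phi (\prod_(i <- s) X i) = \prod_(i <- s) map_mx phi (X i).
Proof.
elim: s => [|i s IH]; first by rewrite !big_nil map_mx1.
by rewrite !big_cons -IH; exact: map_mxM.
Qed.

Section Growth.
Variables (F : fieldType) (charF : [pchar F] =i pred0) (q m : nat).
Variable R : 'I_m -> 'M[F]_q.+1.
Hypothesis mulR : forall i j, exists c : 'I_m -> F, R i * R j = \sum_k c k *: R k.

Definition der_mx (D : 'M[F]_q.+1) :=
  forall i, exists c : 'I_m -> F, R i * D - D * R i = \sum_k c k *: R k.

Definition der_op (l : seq (F * seq 'M[F]_q.+1)) :=
  forall cs, cs \in l -> forall D, D \in cs.2 -> der_mx D.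

(** A column is a word in the matrices R together with the place of an entry. *)
Definition entries n : finType := ({ffun 'I_n -> 'I_m} * ('I_q.+1 * 'I_q.+1))%type.

Definition monomial_entry n (l : 'I_n -> seq (F * seq 'M[F]_q.+1)) (s : 'S_n)
    (x : entries n) : F :=
  (\prod_p ad_op (l p) (R (x.1 (s p)))) x.2.1 x.2.2.

Definition monomial_row n (l : 'I_n -> seq (F * seq 'M[F]_q.+1)) (s : 'S_n) :
    'rV[F]_#|entries n| :=
  \row_k monomial_entry l s (enum_val k).

Section Split.
Variables (K : fieldType) (phi : {rmorphism F -> K}).
Local Notation A := (ext_space R phi).
Local Notation mulA := (ext_mul mulR (phi := phi)).
Variable U : matrix_units A.
Local Notation J := (trace_radical A).
Variables (N0 d : nat).
Hypothesis J_nil : (J ^+ N0)%VS = 0%VS.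
Hypothesis d_max : forall s, all (fun i => @class_rep _ _ _ U i == i) s ->
  chain (U := U) s != 0%VS -> (#|edges (U := U) s| <= d)%N.

Lemma der_mx_ext D : der_mx D -> forall y, y \in A -> y * map_mx phi D - map_mx phi D * y \in A.
Proof.
move=> hD y /ext_spaceP[c ->]; rewrite mulr_suml mulr_sumr -sumrB memv_suml // => i _.
rewrite -scalerAl -scalerAr -scalerBr memvZ //.
have [b hb] := hD i.
have -> : map_mx phi (R i) * map_mx phi D - map_mx phi D * map_mx phi (R i) =
    map_mx phi (R i * D - D * R i).
  by rewrite map_mxB; congr (_ - _); apply/esym/map_mxM.
by rewrite hb map_mx_lin memv_suml // => k _; rewrite memvZ // mem_ext_gen.
Qed.

(** The ideal generated by an idempotent e is stable under derivations, because
    a derivation maps e = e e to an element of A e + e A. *)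
Lemma ad_ideal (D : 'M[K]_q.+1) e x : (forall y, y \in A -> y * D - D * y \in A) ->
  e \in A -> e * e = e -> x \in (A * <[e]> * A)%VS ->
  x * D - D * x \in (A * <[e]> * A)%VS.
Proof.
move=> hD eA ee; pose ad := (amulr D - amull D)%VF.
have adE y : ad y = y * D - D * y by rewrite add_lfunE opp_lfunE !lfunE.
suff sub : (A * <[e]> * A <= ad @^-1: (A * <[e]> * A))%VS.
  by move=> /(subvP sub); rewrite -memv_preim adE.
have eI y z : y \in A -> z \in A -> y * e * z \in (A * <[e]> * A)%VS.
  by move=> yA zA; rewrite !memv_mul ?memv_line.
apply/prodvP => u z uAe zA; rewrite -memv_preim adE.
suff sub : (A * <[e]> <= (ad \o amulr z) @^-1: (A * <[e]> * A))%VS.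
  by move/(subvP sub): uAe; rewrite -memv_preim comp_lfunE adE !lfunE.
apply/prodvP => y _ yA /vlineP[k ->]; rewrite -memv_preim comp_lfunE adE !lfunE /=.
rewrite -scalerAr -!scalerAl -scalerAr -scalerBr memvZ //.
have -> : y * e * z * D - D * (y * e * z) =
    (y * D - D * y) * e * z + y * (e * D - D * e) * z + y * e * (z * D - D * z).
  rewrite !mulrBl !mulrBr !mulrBl !mulrA.
  by rewrite [X in _ = X + _]addrC subrKA [RHS]addrC subrKA.
have eD : e * D - D * e = (e * D - D * e) * e + e * (e * D - D * e).
  rewrite mulrBl mulrBr !mulrA ee -[D * e * e]mulrA ee.
  by rewrite [RHS]addrC subrKA.
rewrite memvD ?memvD ?eI ?hD // eD mulrDr mulrDl memvD //.
  by rewrite mulrA eI // mulA // hD.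
by rewrite mulrA -mulrA eI // mulA // hD.
Qed.

Lemma der_op_stable l : der_op l -> ideal_stable U (ad_op (map_ad phi l)).
Proof.
move=> hl.
have st (V : {vspace 'M[K]_q.+1}) x :
    (forall D, der_mx D -> forall y, y \in V -> y * map_mx phi D - map_mx phi D * y \in V) ->
    x \in V -> ad_op (map_ad phi l) x \in V.
  move=> h; apply: ad_op_stable => _ /mapP[cs csl ->] _ /mapP[D Dcs ->].
  by apply: h; exact: hl csl _ Dcs.
split=> [|x|i x]; first by rewrite linear0.
  by apply: st => D hD y; apply: trace_radical_ad; exact: der_mx_ext.
apply: st => D hD y; apply: ad_ideal; first exact: der_mx_ext.
  exact: munit_mem.
by rewrite munit_mul // eqxx.
Qed.

(** Over the extension, a row of a monomial is the row of its values at the good words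
    in the letters, times a matrix P that expresses R by the letters. So the rank
    is at most the number of good words, up to the number of entries. *)
Lemma upper_bound n k (M : 'M[F]_(k, #|entries n|)) : (N0 <= n)%N -> row_free M ->
  (forall i, exists c (a : 'I_c -> F) (l : 'I_c -> 'I_n -> seq (F * seq 'M[F]_q.+1))
      (s : 'I_c -> 'S_n),
    (forall j p, der_op (l j p)) /\ row i M = \sum_j a j *: monomial_row (l j) (s j)) ->
  (k <= 2 ^ (munit_size U * munit_size U) * (N0 * n.+1 ^ N0 * (\dim J).+1 ^ N0) * d ^ n *
     (q.+1 * q.+1))%N.
Proof.
move=> N0n fM hM.
have /fin_all_exists[cb hcb] : forall b : 'I_m, exists c : letter U -> K,
    map_mx phi (R b) = \sum_z c z *: letter_mx z.
  by move=> b; apply: letter_span; exact: mem_ext_gen.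
pose G := [set g : {ffun 'I_n -> letter U} * ('I_q.+1 * 'I_q.+1) | good_word N0 d g.1].
pose Pf (g : {ffun 'I_n -> letter U} * ('I_q.+1 * 'I_q.+1)) (x : entries n) : K :=
  (g.2 == x.2)%:R * \prod_p cb (x.1 p) (g.1 p).
pose P : 'M[K]_(#|G|, #|entries n|) := \matrix_(g, x) Pf (enum_val g) (enum_val x).
have monoP l s : (forall p, der_op (l p)) -> (map_mx phi (@monomial_row n l s) <= P)%MS.
  move=> hl.
  pose val_ (a : {ffun 'I_n -> letter U}) :=
    \prod_p ad_op (map_ad phi (l p)) (letter_mx (a (s p))).
  pose vf (g : {ffun 'I_n -> letter U} * ('I_q.+1 * 'I_q.+1)) : K := val_ g.1 g.2.1 g.2.2.
  pose v : 'rV[K]_#|G| := \row_g vf (enum_val g).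
  suff -> : map_mx phi (monomial_row l s) = v *m P by exact: submxMl.
  apply/rowP => x; rewrite !mxE; under eq_bigr do rewrite !mxE.
  rewrite /monomial_entry; move: (enum_val x) => [b [i j]] /=.
  have -> : phi ((\prod_p ad_op (l p) (R (b (s p)))) i j) =
      (\sum_(a : {ffun 'I_n -> letter U}) (\prod_p cb (b p) (a p)) *: val_ a) i j.
    have -> : phi ((\prod_p ad_op (l p) (R (b (s p)))) i j) =
        map_mx phi (\prod_p ad_op (l p) (R (b (s p)))) i j by rewrite mxE.
    rewrite map_mx_prod; under eq_bigr => p _ do rewrite map_ad_op hcb.
    by rewrite (prod_linear_expand (fun p => ad_op (map_ad phi (l p))) s (fun p => cb (b p))).
  rewrite summxE (bigID (fun a : {ffun 'I_n -> letter U} => good_word N0 d a)) /=.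
  rewrite [X in _ + X]big1 ?addr0; last first.
    move=> a na; rewrite mxE; suff -> : val_ a = 0 by rewrite mxE mulr0.
    apply: contraNeq na.
    apply: (nonzero_word_good mulA J_nil d_max (T := fun p => ad_op (map_ad phi (l p)))).
    by move=> p; exact: der_op_stable.
  transitivity (\sum_(g in G) vf g * Pf g (b, (i, j))); last by rewrite big_enum_val.
  rewrite (eq_bigl (fun g : {ffun 'I_n -> letter U} * ('I_q.+1 * 'I_q.+1) =>
    good_word N0 d g.1 && true)); last by move=> g; rewrite inE andbT.
  rewrite -(pair_big (fun a : {ffun 'I_n -> letter U} => good_word N0 d a) xpredT
    (fun a ij => vf (a, ij) * Pf (a, ij) (b, (i, j)))) /=.
  apply: eq_bigr => a _; rewrite (bigD1 (i, j)) //= [X in _ + X]big1 ?addr0.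
    by rewrite /vf /Pf /= eqxx mul1r mxE mulrC.
  by move=> ij ne; rewrite /Pf /= (negbTE ne) mul0r mulr0.
have leP : (map_mx phi M <= P)%MS.
  apply/row_subP => i; rewrite -map_row.
  have [c [a [l [s [hl ->]]]]] := hM i.
  rewrite map_mx_lin summx_sub // => j _.
  by rewrite scalemx_sub // monoP.
have := mxrankS leP; rewrite mxrank_map.
move/eqP: fM => ->; move/leq_trans; apply.
apply: leq_trans (rank_leq_row _) _.
have -> : #|G| = #|setX [set a : {ffun 'I_n -> letter U} | good_word N0 d a]
    [set: 'I_q.+1 * 'I_q.+1]|.
  by apply: eq_card => g; rewrite !inE andbT.
rewrite cardsX cardsT card_prod card_ord leq_mul2r; apply/orP; right.
apply: leq_trans (card_good_words _ _ _ N0n) _.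
by rewrite card_prod !card_ord.
Qed.

(** The incidence matrix is obtained from the rows of the ordinary monomials by a
    linear substitution, so its rank is not larger than theirs. *)
Lemma lower_bound n k (M : 'M[F]_(k, #|entries n|)) (W : finType)
    (H : {set 'S_n}) (f : 'S_n -> {set W})
    (v : W -> 'I_n -> 'M[K]_q.+1) (x y : 'M[K]_q.+1) (i j : 'I_q.+1) (z : K) :
  (forall w p, v w p \in A) -> z != 0 ->
  (forall u w, u \in H ->
      (x * (\prod_p v w (u p)) * y) i j = (w \in f u)%:R * z) ->
  (forall s, (monomial_row (fun=> [:: (1, [::])]) s <= M)%MS) ->
  (\rank (incidence_mx K H f) <= k)%N.
Proof.
move=> vA z0 hv hM.
have /fin_all_exists[cc hcc] : forall wp : W * 'I_n, exists c : 'I_m -> K,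
    v wp.1 wp.2 = \sum_b c b *: map_mx phi (R b).
  by move=> wp; apply/ext_spaceP; exact: vA.
pose Qf (e : entries n) (w : W) : K :=
  (\prod_p cc (w, p) (e.1 p)) * (x i e.2.1 * y e.2.2 j).
pose Q : 'M[K]_(#|entries n|, #|W|) := \matrix_(e, w) Qf (enum_val e) (enum_val w).
pose ord_entry u (e : entries n) := monomial_entry (fun=> [:: (1, [::])]) u e.
pose S : 'M[F]_(#|H|, #|entries n|) :=
  \matrix_(u, e) ord_entry (enum_val u) (enum_val e).
have SM : (S <= M)%MS.
  apply/row_subP => u; apply: submx_trans (hM (enum_val u)).
  suff -> : row u S = monomial_row (fun=> [:: (1, [::])]) (enum_val u) by [].
  by apply/rowP => e; rewrite !mxE.
have SQ : z *: incidence_mx K H f = map_mx phi S *m Q.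
  apply/matrixP => u w; rewrite !mxE mulrC -(hv _ _ (enum_valP u)).
  under [RHS]eq_bigr do rewrite !mxE.
  move: (enum_val u) (enum_val w) => {}u {}w.
  rewrite -(big_enum_valT (fun e : entries n => phi (ord_entry u e) * Qf e w)).
  have -> : \prod_p v w (u p) = \sum_(b : {ffun 'I_n -> 'I_m})
      (\prod_p cc (w, p) (b p)) *: map_mx phi (\prod_p R (b (u p))).
    under [LHS]eq_bigr => p _ do rewrite (hcc (w, u p)).
    rewrite (prod_linear_expand
      (fun=> (idfun : {linear 'M[K]_q.+1 -> 'M[K]_q.+1})) u (fun p => cc (w, p))) /=.
    by apply: eq_bigr => b _; rewrite map_mx_prod.
  rewrite mulr_sumr mulr_suml summxE.
  rewrite -(pair_bigA _ (fun (b : {ffun 'I_n -> 'I_m}) ij =>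
    phi (ord_entry u (b, ij)) * Qf (b, ij) w)) /=.
  apply: eq_bigr => b _.
  rewrite -scalerAr -scalerAl mxE [LHS]mulrC.
  rewrite -(pair_bigA _ (fun a a' =>
    phi (ord_entry u (b, (a, a'))) * Qf (b, (a, a')) w)) /=.
  rewrite exchange_big /= mxE mulr_suml; apply: eq_bigr => a' _.
  rewrite mxE !mulr_suml; apply: eq_bigr => a _.
  rewrite mxE /Qf /ord_entry /monomial_entry /=.
  under [in RHS]eq_bigr => p _ do rewrite ad_op_id.
  by ring.
have : (\rank (incidence_mx K H f) <= \rank (map_mx phi S))%N.
  rewrite -(mxrank_scale_nz _ z0) SQ; exact: mxrankM_maxl.
move/leq_trans; apply; rewrite mxrank_map.
by apply: leq_trans (mxrankS SM) (rank_leq_row _).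
Qed.

End Split.

(** The upper bound holds for rows that are combinations of monomials with derivations,
    the lower bound as soon as the ordinary monomials are among the rows. *)
Theorem growth : exists d C : nat, forall n, (C <= n)%N ->
  forall k (M : 'M[F]_(k, #|entries n|)), row_free M ->
  ((forall i, exists c (a : 'I_c -> F) (l : 'I_c -> 'I_n -> seq (F * seq 'M[F]_q.+1))
      (s : 'I_c -> 'S_n),
    (forall j p, der_op (l j p)) /\ row i M = \sum_j a j *: monomial_row (l j) (s j)) ->
   (k <= C * n.+1 ^ C * d ^ n)%N) /\
  ((forall s, (monomial_row (fun=> [:: (1, [::])]) s <= M)%MS) ->
   (d ^ n <= C * n.+1 ^ C * k)%N).
Proof.
have [K [phi [r [e [oe max_e]]]]] := exists_max_idems R.
have charK : [pchar K] =i pred0 by move=> p; rewrite (fmorph_pchar phi) charF.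
pose A := ext_space R phi.
have mulA x y : x \in A -> y \in A -> x * y \in A by exact: ext_mul.
have [eA [e0 ee]] := oe.
have [U] := exists_matrix_units charK mulA eA e0 ee
  (nil_complement mulR oe max_e) (nil_corner mulR charK oe max_e).
have [|x /trace_radicalP[xA hx]|N0 J_nil] := @nil_algebra_nilpotent _ _ (trace_radical A).
- apply/prodvP => x y xJ /trace_radicalP[yA _].
  exact: (trace_radicalMr mulA xJ yA).
- exact: (nil_trace_radical mulR charK xA hx).
have [s0 [us0 rs0 cs0 max_s0]] := exists_best_chain mulA U.
pose d := #|edges (U := U) s0|.
pose C1 := (2 ^ (munit_size U * munit_size U) *
  (N0 * (\dim (trace_radical A)).+1 ^ N0) * (q.+1 * q.+1))%N.
have up n C k (M : 'M[F]_(k, #|entries n|)) : (C1 + N0 <= C)%N -> (C <= n)%N -> row_free M ->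
  (forall i, exists c (a : 'I_c -> F) (l : 'I_c -> 'I_n -> seq (F * seq 'M[F]_q.+1))
      (s : 'I_c -> 'S_n),
    (forall j p, der_op (l j p)) /\ row i M = \sum_j a j *: monomial_row (l j) (s j)) ->
   (k <= C * n.+1 ^ C * d ^ n)%N.
  move=> leC Cn fM hM.
  have N0n : (N0 <= n)%N by apply: leq_trans Cn; apply: leq_trans leC; exact: leq_addl.
  apply: leq_trans (upper_bound J_nil max_s0 N0n fM hM) _; rewrite -/d.
  have assoc a b b' x y : (a * (N0 * b * b') * x * y = a * (N0 * b') * y * b * x)%N by lia.
  rewrite assoc -/C1.
  rewrite leq_mul2r; apply/orP; right; apply: leq_mul.
    by apply: leq_trans leC; exact: leq_addr.
  by rewrite leq_pexp2l //; apply: leq_trans leC; exact: leq_addl.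
(* without idempotents A is nilpotent and d = 0 *)
case szs: (size s0) => [|t].
  exists d, (C1 + N0).+1 => n Cn k M fM; split; first exact: up.
  move=> _; have -> : d = 0%N.
    by rewrite /d (size0nil szs); apply: eq_card0 => x; rewrite !inE andbF.
  by rewrite exp0n //; exact: leq_trans Cn.
have [C2 C2_gt0 ev] := exists_evaluation charK mulA us0 rs0 szs cs0.
pose C3 := (d ^ t.+1 * C2 + C2 + t.+1)%N.
exists d, (C1 + N0 + C3)%N => n Cn k M fM; split; first by apply: up => //; exact: leq_addr.
move=> hM.
have C3n : (C3 <= n)%N by apply: leq_trans Cn; exact: leq_addl.
have [n' nE] : exists n', n = (t + n').+1.
  exists (n - t.+1)%N; rewrite -addSn subnKC //; apply: leq_trans C3n; exact: leq_addl.
move: M fM hM C3n; rewrite nE => M fM hM C3n.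
have [W [H [f [v [x [y [i [j [vA [z z0 hz] rk]]]]]]]]] := ev n'.
have rkk := lower_bound vA z0 hz hM.
have le1 : (d ^ (t + n').+1 <= d ^ t.+1 * (C2 * (t + n').+2 ^ C2 * k))%N.
  rewrite -addSn expnD leq_mul2l; apply/orP; right; apply: leq_trans rk _.
  by rewrite leq_mul2l rkk orbT.
apply: leq_trans le1 _; rewrite !mulnA leq_mul2r; apply/orP; right.
apply: leq_mul; first by rewrite /C3; lia.
by rewrite leq_pexp2l // /C3; lia.
Qed.

End Growth.

(** * Quotient dimensions and the regular representation *)

Section QuotientDimension.
Variables (F : fieldType) (V : lmodType F) (S : set V).
Local Notation P := (span_set S).

Lemma span_set0 : P 0.
Proof. by exists 0%N, (fun=> 0), (fun=> 0); split=> [[]|] //; rewrite big_ord0. Qed.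

Lemma span_setP a v w : P v -> P w -> P (a *: v + w).
Proof.
move=> [n [c [x [xS ->]]]] [m [c' [x' [x'S ->]]]].
exists (n + m)%N,
  (fun i => match fintype.split i with inl j => a * c j | inr j => c' j end),
  (fun i => match fintype.split i with inl j => x j | inr j => x' j end).
split; first by move=> i; case: fintype.split.
rewrite big_split_ord /= scaler_sumr; congr (_ + _); apply: eq_bigr => i _.
  by rewrite (unsplitK (inl _ i)) scalerA.
by rewrite (unsplitK (inr _ i)).
Qed.

Lemma span_set_sum n (c : 'I_n -> F) (e : 'I_n -> V) :
  (forall i, P (e i)) -> P (\sum_i c i *: e i).
Proof.
move=> eP; elim/big_rec: _ => [|i v _ vP]; first exact: span_set0.
exact: span_setP.
Qed.

(** If Q is the kernel in P of a linear map with values in row vectors, then the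
    dimension of P modulo Q is the rank of the map. The rows of M are the images of
    a basis of P modulo Q. *)
Lemma quot_dim_rows c (Phi : {linear V -> 'rV[F]_c}) (Q : set V) :
  (forall v, Q v <-> P v /\ Phi v = 0) ->
  exists M : 'M[F]_(quot_dim P Q, c),
    [/\ row_free M, forall i, exists2 v, P v & row i M = Phi v &
        forall v, P v -> (Phi v <= M)%MS].
Proof.
move=> QE.
have ex : exists n, exists e : 'I_n -> V, quot_basis P Q e.
  (* a basis is a family of maximal size whose images are independent *)
  pose good n := `[< exists e : 'I_n -> V, (forall i, P (e i)) /\
    row_free (\matrix_i Phi (e i)) >].
  have good0 : exists n, good n.
    exists 0%N; apply/asboolP; exists (fun=> 0); split=> [[]|] //.
    by rewrite /row_free; have := rank_leq_row (\matrix_(i < 0) Phi 0); rewrite leqn0.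
  have ub n : good n -> (n <= c)%N.
    by move=> /asboolP[e [_ /eqP <-]]; exact: rank_leq_col.
  have [n /asboolP[e [eP fM]] maxn] := ex_maxnP good0 ub.
  exists n, e; split=> // v vP.
  set M := (\matrix_i Phi (e i)) in fM.
  have vM : (Phi v <= M)%MS.
    apply: contraT => nvM.
    pose e' (i : 'I_(n + 1)) := match fintype.split i with inl j => e j | inr _ => v end.
    suff /maxn : good (n + 1)%N by rewrite addn1 ltnn.
    apply/asboolP; exists e'; split; first by rewrite /e' => i; case: fintype.split.
    have -> : \matrix_i Phi (e' i) = col_mx M (Phi v).
      apply/row_matrixP => i; rewrite rowK; case: (fintype.splitP i) => j ij.
        have -> : i = lshift 1 j by exact: val_inj.
        by rewrite rowKu /e' (unsplitK (inl _ j)) rowK.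
      have -> : i = rshift n j by exact: val_inj.
      rewrite rowKd /e' (unsplitK (inr _ j)).
      by rewrite row_id ?ord1.
    rewrite /row_free -addsmxE addn1 eqn_leq.
    rewrite (leq_trans (mxrank_adds_leqif M (Phi v))) /=; last first.
      by have := leq_add (rank_leq_row M) (rank_leq_row (Phi v)); rewrite addn1.
    have : (M < M + Phi v)%MS.
      by rewrite /ltmx addsmxSl /= addsmx_sub submx_refl.
    by move/rank_ltmx; move/eqP: fM => ->.
  have [u uE] := submxP vM.
  have sumE (a : {ffun 'I_n -> F}) : Phi (\sum_i a i *: e i) = (\row_i a i) *m M.
    rewrite linear_sum mulmx_sum_row; apply: eq_bigr => i _.
    by rewrite linearZ rowK mxE.
  exists [ffun i => u 0 i]; split.
    apply/QE; split.
      rewrite addrC -scaleN1r; apply: span_setP => //; exact: span_set_sum.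
    rewrite linearB /= sumE uE.
    have -> : \row_i [ffun i => u 0 i] i = u by apply/rowP => i; rewrite mxE ffunE.
    by rewrite subrr.
  move=> a /QE[_]; rewrite linearB /= sumE uE => /eqP; rewrite subr_eq0 => /eqP.
  move/(row_free_inj fM) => ->; apply/ffunP => i; rewrite ffunE mxE.
  by [].
have := xgetPex 0%N ex; rewrite -/(quot_dim P Q).
move: (quot_dim P Q) => n [e [eP eB]].
pose M := \matrix_i Phi (e i).
have sumE (a : 'I_n -> F) : Phi (\sum_i a i *: e i) = (\row_i a i) *m M.
  rewrite linear_sum mulmx_sum_row; apply: eq_bigr => i _.
  by rewrite linearZ rowK mxE.
exists M; split.
- rewrite -kermx_eq0; apply/rowV0P => u /sub_kermxP uM.
  have [c0 [_ uniq]] := eB 0 span_set0.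
  have Q0 (a : {ffun 'I_n -> F}) : (\row_i a i) *m M = 0 -> c0 = a.
    move=> aM; apply: uniq; apply/QE; rewrite sub0r linearN /= sumE aM oppr0; split=> //.
    rewrite -scaleN1r -[_ *: _]addr0; apply: span_setP; last exact: span_set0.
    exact: span_set_sum.
  have e1 : c0 = [ffun=> 0].
    by apply: Q0; rewrite (_ : \row_i _ = 0) ?mul0mx //; apply/rowP => i; rewrite !mxE ffunE.
  have e2 : c0 = [ffun i => u 0 i].
    by apply: Q0; rewrite (_ : \row_i _ = u) //; apply/rowP => i; rewrite !mxE ffunE.
  apply/rowP => i; rewrite mxE.
  by move: e2; rewrite e1 => /ffunP /(_ i); rewrite !ffunE.
- by move=> i; exists (e i) => //; rewrite rowK.
- move=> v vP; have [a [/QE[_]]] := eB v vP.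
  rewrite linearB /= sumE => /eqP; rewrite subr_eq0 => /eqP -> _.
  exact: submxMl.
Qed.

End QuotientDimension.

Import VectorInternalTheory.

Section RegularRepresentation.
Section Blocks.
Variables (F : fieldType) (m : nat).

(** The first row is the image of the unit adjoined to A. *)
Definition aff_mx (r : 'rV[F]_m) (M : 'M[F]_m) : 'M[F]_m.+1 :=
  block_mx (0 : 'M_1) r 0 M.

Lemma aff_mx_linear k r r' M M' :
  aff_mx (k *: r + r') (k *: M + M') = k *: aff_mx r M + aff_mx r' M'.
Proof.
apply/matrixP => i j; rewrite !mxE; case: fintype.split => i'; rewrite !mxE;
  by case: fintype.split => j'; rewrite !mxE ?mulr0 ?addr0.
Qed.

Lemma aff_mxM r r' M M' : aff_mx r M * aff_mx r' M' = aff_mx (r *m M') (M *m M').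
Proof.
have := @mulmx_block F 1 m 1 m 1 m 0 r 0 M 0 r' 0 M'.
by rewrite !mul0mx !mulmx0 !addr0 !add0r.
Qed.

Lemma aff_mx_inj r r' M M' : aff_mx r M = aff_mx r' M' -> r = r'.
Proof. by case/(@eq_block_mx _ 1 m 1 m). Qed.

End Blocks.

Variables (F : fieldType) (L : lieAlgType F) (A : fdLAlgType L).
Local Notation m := (dim A).

Definition rmul_row (a : A) (v : 'rV[F]_m) : 'rV[F]_m := v2r (amul (r2v v) a).
Definition dact_row (x : L) (v : 'rV[F]_m) : 'rV[F]_m := v2r (dact (r2v v) x).

Fact rmul_row_linear a : linear (rmul_row a).
Proof. by move=> k u v; rewrite /rmul_row linearP amul_linearl linearP. Qed.
HB.instance Definition _ a :=
  GRing.isLinear.Build F 'rV[F]_m 'rV[F]_m *:%R (rmul_row a) (rmul_row_linear a).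

Fact dact_row_linear x : linear (dact_row x).
Proof. by move=> k u v; rewrite /dact_row linearP dact_linearl linearP. Qed.
HB.instance Definition _ x :=
  GRing.isLinear.Build F 'rV[F]_m 'rV[F]_m *:%R (dact_row x) (dact_row_linear x).

Lemma rmul_rowE a b : rmul_row a (v2r b) = v2r (amul b a).
Proof. by rewrite /rmul_row v2rK. Qed.

Lemma dact_rowE x b : dact_row x (v2r b) = v2r (dact b x).
Proof. by rewrite /dact_row v2rK. Qed.

(** Right multiplications on F + A, in coordinates. The summand F makes this
    representation faithful although A need not have a unit; derivations extend to
    F + A by zero on F. *)
Definition reg_rep (a : A) : 'M[F]_m.+1 :=
  aff_mx (v2r a) (lin1_mx (rmul_row a)).

Definition der_rep (x : L) : 'M[F]_m.+1 :=
  aff_mx 0 (lin1_mx (dact_row x)).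

Lemma reg_rep_linear : linear reg_rep.
Proof.
move=> k a b; rewrite /reg_rep -aff_mx_linear linearP.
congr aff_mx; apply/row_matrixP => i; rewrite !rowE mulmxDr -scalemxAr !mul_rV_lin1 /=.
by rewrite /rmul_row amul_linearr linearP.
Qed.
HB.instance Definition _ :=
  GRing.isLinear.Build F A 'M[F]_m.+1 *:%R reg_rep reg_rep_linear.

Lemma reg_rep_inj : injective reg_rep.
Proof. by move=> a b /aff_mx_inj /v2r_inj. Qed.

Lemma reg_repM a b : reg_rep (amul a b) = reg_rep a * reg_rep b.
Proof.
rewrite /reg_rep aff_mxM mul_rV_lin1 /= rmul_rowE; congr aff_mx.
apply/row_matrixP => i; rewrite !rowE mulmxA !mul_rV_lin1 /= /rmul_row v2rK.
by rewrite amulA.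
Qed.

Lemma reg_rep_der a x :
  reg_rep (dact a x) = reg_rep a * der_rep x - der_rep x * reg_rep a.
Proof.
rewrite /reg_rep /der_rep !aff_mxM mul0mx addrC -scaleN1r -aff_mx_linear.
rewrite scaler0 add0r mul_rV_lin1 /= dact_rowE scaleN1r addrC.
congr aff_mx; apply/row_matrixP => i.
rewrite !rowE mulmxBr !mulmxA !mul_rV_lin1 /= /rmul_row v2rK.
rewrite /dact_row !v2rK -linearB (dact_derivation x).2 addrC addKr.
by [].
Qed.

Definition reg_basis (i : 'I_m) : 'M[F]_m.+1 := reg_rep (r2v (delta_mx 0 i)).

Lemma reg_rep_coord a : reg_rep a = \sum_i v2r a 0 i *: reg_basis i.
Proof.
rewrite -{1}(v2rK a) [X in r2v X]row_sum_delta !linear_sum.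
by apply: eq_bigr => i _; rewrite !linearZ.
Qed.

Lemma reg_basisM i j : exists c : 'I_m -> F,
  reg_basis i * reg_basis j = \sum_k c k *: reg_basis k.
Proof. by rewrite /reg_basis -reg_repM reg_rep_coord; eexists. Qed.

Lemma der_rep_der x : der_mx reg_basis (der_rep x).
Proof. by move=> i; rewrite -reg_rep_der reg_rep_coord; eexists. Qed.

Definition uact_ad (u : uea L) : seq (F * seq 'M[F]_m.+1) :=
  [seq (mcoeff w (urep u), [seq der_rep x | x <- (w : seq L)])
     | w <- finmap.enum_fset (msupp (urep u))].

Lemma reg_rep_word (a : A) (w : seq L) :
  reg_rep (foldl (@dact F L A) a w) = ad_word (reg_rep a) [seq der_rep x | x <- w].
Proof. by elim: w a => [|x w IH] a //=; rewrite IH reg_rep_der. Qed.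

Lemma reg_rep_uact (a : A) (u : uea L) : reg_rep (uact a u) = ad_op (uact_ad u) (reg_rep a).
Proof.
rewrite /uact /free_act /lincomb linear_sum /ad_op /uact_ad big_map.
by apply: eq_bigr => w _; rewrite linearZ /= /word_act reg_rep_word.
Qed.

Lemma uact_ad_der u : der_op reg_basis (uact_ad u).
Proof. by move=> _ /mapP[w _ ->] _ /mapP[x _ ->]; exact: der_rep_der. Qed.

End RegularRepresentation.

(** * Codimensions as ranks *)

Section FreeEvaluation.
Variables (F : fieldType) (X : choiceType).

Lemma mkmalgUM (w1 w2 : fmonom X) (c1 c2 : F) :
  mkmalgU w1 c1 * mkmalgU w2 c2 = mkmalgU (mmul w1 w2) (c1 * c2) :> freeAlg F X.
Proof. by rewrite malgM_def fgmulUU. Qed.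

Lemma prod_fgen (I : Type) (s : seq I) (g : I -> X) :
  exists2 w : fmonom X, \prod_(k <- s) fgen F (g k) = mkmalgU w 1 &
    fmonom_val w = [seq g k | k <- s].
Proof.
elim: s => [|k s [w ws wE]]; first by exists mone; rewrite ?big_nil // fm1.
exists (mmul (fmu (g k)) w); first by rewrite big_cons ws mkmalgUM mulr1.
by rewrite fmM fmU wE.
Qed.

Lemma mcoeff1_prod_fgen n (g : 'I_n -> X) : (0 < n)%N ->
  mcoeff mone (\prod_k fgen F (g k)) = 0.
Proof.
case: n g => // n g _; rewrite big_ord_recl rmorphM /=.
by rewrite mcoeffU -val_eqE /= fmU fm1 mul0r.
Qed.

Variables (L : lieAlgType F) (A : fdLAlgType L).

HB.instance Definition _ (v : X -> A) :=
  GRing.isLinear.Build F (freeAlg F X) A *:%R (free_eval v)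
    (lincomb_linear (word_eval v)).

Lemma free_evalU (v : X -> A) (w : fmonom X) :
  free_eval v (mkmalgU w 1) = word_eval v w.
Proof.
rewrite /free_eval (lincombEw _ msuppU_le) finmap.big_seq_fset1.
by rewrite mcoeffUU scale1r.
Qed.

Lemma reg_rep_word_eval (v : X -> A) (w : fmonom X) : fmonom_val w <> [::] ->
  reg_rep (word_eval v w) = \prod_(x <- fmonom_val w) reg_rep (v x).
Proof.
rewrite /word_eval; case: (fmonom_val w) => // x s _.
rewrite big_cons; move: (v x) => a.
elim: s a => [|y s IH] a /=; first by rewrite big_nil mulr1.
by rewrite IH reg_repM big_cons mulrA.
Qed.

Lemma reg_rep_free_eval (v : X -> A) n (g : 'I_n -> X) : (0 < n)%N ->
  reg_rep (free_eval v (\prod_k fgen F (g k))) = \prod_k reg_rep (v (g k)).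
Proof.
move=> n0; have [w -> wE] := prod_fgen (index_enum 'I_n) g.
rewrite free_evalU reg_rep_word_eval ?wE ?big_map //.
move/(congr1 size); rewrite size_map /index_enum -enumT size_enum_ord /=.
by case: n n0 {g w wE}.
Qed.

End FreeEvaluation.

(** The codimensions and the differential codimensions are instances of one
    construction: the variable with number i and decoration d is evaluated at [op d]
    of the i-th argument. There is only the trivial decoration in the ordinary case,
    and a decoration is an element of the basis of U(L) in the differential case. *)
Section CodimensionBounds.
Variables (F : fieldType) (L : lieAlgType F) (A : fdLAlgType L).
Variables (X : choiceType) (D : Type) (d0 : D) (g : nat -> D -> X).
Variables (ev : (nat -> A) -> X -> A) (op : D -> A -> A).
Variable l : D -> seq (F * seq 'M[F]_((dim A).+1)).
Hypothesis evE : forall a i d, ev a (g i d) = op d (a i).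
Hypothesis opE : forall d x, reg_rep (op d x) = ad_op (l d) (reg_rep x).
Hypothesis op_der : forall d, der_op (@reg_basis F L A) (l d).
Hypothesis op_id : forall x, op d0 x = x.

Local Open Scope classical_set_scope.

Definition decorated_monomials n : set (freeAlg F X) :=
  [set f | exists (s : 'S_n) (d : 'I_n -> D),
     f = \prod_(k < n) fgen F (g (s k : nat) (d k))].

Definition decorated_ids : set (freeAlg F X) :=
  [set f | mcoeff mone f = 0 /\ forall a, free_eval (ev a) f = 0].

(** Variables that do not occur in a monomial of degree n are evaluated at 0. *)
Definition basis_word n (b : {ffun 'I_n -> 'I_(dim A)}) (i : nat) : A :=
  if insub i is Some p then r2v (delta_mx 0 (b p)) else 0.

Lemma basis_wordE n b (p : 'I_n) : basis_word b p = r2v (delta_mx 0 (b p)).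
Proof. by rewrite /basis_word valK. Qed.

Definition eval_row n (f : freeAlg F X) : 'rV[F]_#|entries (dim A) (dim A) n| :=
  \row_k (fun x : entries (dim A) (dim A) n =>
    reg_rep (free_eval (ev (basis_word x.1)) f) x.2.1 x.2.2) (enum_val k).

Lemma eval_rowE n f k : eval_row n f 0 k =
  (fun x : entries (dim A) (dim A) n =>
    reg_rep (free_eval (ev (basis_word x.1)) f) x.2.1 x.2.2) (enum_val k).
Proof. exact: mxE. Qed.

Fact eval_row_linear n : linear (@eval_row n).
Proof.
move=> a f f'; apply/rowP => k; rewrite [RHS]mxE [X in _ = X + _]mxE !eval_rowE /=.
by rewrite (linearP (free_eval _)) linearP [LHS]mxE [X in X + _ = _]mxE.
Qed.
HB.instance Definition _ n :=
  GRing.isLinear.Build F (freeAlg F X) 'rV[F]_#|entries (dim A) (dim A) n| *:%R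
    (@eval_row n) (@eval_row_linear n).

Lemma reg_rep_monomial a n (s : 'S_n) (d : 'I_n -> D) : (0 < n)%N ->
  reg_rep (free_eval (ev a) (\prod_(k < n) fgen F (g (s k : nat) (d k)))) =
  \prod_(k < n) ad_op (l (d k)) (reg_rep (a (s k : nat))).
Proof.
move=> n0; rewrite (reg_rep_free_eval _ (fun k => g (s k : nat) (d k))) //.
by apply: eq_bigr => k _; rewrite evE opE.
Qed.

Lemma eval_row_monomial n (s : 'S_n) (d : 'I_n -> D) : (0 < n)%N ->
  eval_row n (\prod_(k < n) fgen F (g (s k : nat) (d k))) =
  monomial_row (@reg_basis F L A) (fun k => l (d k)) s.
Proof.
move=> n0; apply/rowP => k; rewrite eval_rowE [RHS]mxE reg_rep_monomial // /monomial_entry.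
congr (fun_of_matrix _ _ _); apply: eq_bigr => p _.
by rewrite basis_wordE.
Qed.

Lemma eval_row_monomial_id n (s : 'S_n) : (0 < n)%N ->
  eval_row n (\prod_(k < n) fgen F (g (s k : nat) d0)) =
  monomial_row (@reg_basis F L A) (fun=> [:: (1, [::])]) s.
Proof.
move=> n0; apply/rowP => k; rewrite eval_rowE [RHS]mxE reg_rep_monomial // /monomial_entry.
congr (fun_of_matrix _ _ _); apply: eq_bigr => p _.
by rewrite -opE op_id ad_op_id basis_wordE.
Qed.

(** By multilinearity it suffices to evaluate on a basis. *)
Lemma decorated_ids_eval n f : (0 < n)%N -> span_set (@decorated_monomials n) f ->
  (decorated_ids f <-> eval_row n f = 0).
Proof.
move=> n0 [m [c [w [wM ->]]]].
have /fin_all_exists[s /fin_all_exists[d wE]] : forall i : 'I_m,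
  exists (s : 'S_n) (d : 'I_n -> D),
    w i = \prod_(k < n) fgen F (g (s k : nat) (d k)) by move=> i; exact: wM.
split=> [[_ h]|h].
  by apply/rowP => k; rewrite eval_rowE h linear0 !mxE.
split.
  rewrite raddf_sum big1 //= => i _; rewrite mcoeffZ wE.
  by rewrite (mcoeff1_prod_fgen F (fun k => g (s i k : nat) (d i k))) ?mulr0.
move=> a; apply: (@reg_rep_inj _ _ A); rewrite linear0.
have linS v : reg_rep (free_eval v (\sum_(i < m) c i *: w i)) =
    \sum_(i < m) c i *: reg_rep (free_eval v (w i)).
  rewrite (linear_sum (free_eval v)) linear_sum; apply: eq_bigr => i _.
  by rewrite (linearZ_LR (free_eval v)) linearZ_LR.
pose cf (p : 'I_n) b := v2r (a (p : nat)) 0 b.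
have -> : reg_rep (free_eval (ev a) (\sum_(i < m) c i *: w i)) =
   \sum_(b : {ffun 'I_n -> 'I_(dim A)}) (\prod_p cf p (b p)) *:
      reg_rep (free_eval (ev (basis_word b)) (\sum_(i < m) c i *: w i)).
  rewrite linS; under [RHS]eq_bigr do rewrite linS scaler_sumr.
  rewrite exchange_big /=; apply: eq_bigr => i _.
  rewrite wE reg_rep_monomial //.
  have := prod_linear_expand (fun k => ad_op (l (d i k))) (s i) cf (@reg_basis F L A).
  rewrite /= => expand.
  under eq_bigr => k _ do rewrite reg_rep_coord
    -[X in ad_op _ X]/(\sum_j cf (s i k) j *: reg_basis j).
  rewrite expand scaler_sumr.
  apply: eq_bigr => b _; rewrite reg_rep_monomial // !scalerA mulrC; congr (_ *: _).
  by apply: eq_bigr => k _; rewrite basis_wordE.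
apply: big1 => b _.
suff -> : reg_rep (free_eval (ev (basis_word b)) (\sum_(i < m) c i *: w i)) = 0.
  by rewrite scaler0.
apply/matrixP => i j; have /rowP /(_ (enum_rank (b, (i, j)))) := h.
by rewrite eval_rowE enum_rankK /= => e; rewrite [RHS]mxE e mxE.
Qed.

Lemma decorated_codim_bounds d C n : (0 < n)%N ->
  (forall k (M : 'M[F]_(k, #|entries (dim A) (dim A) n|)), row_free M ->
  ((forall i, exists c (a : 'I_c -> F)
       (l : 'I_c -> 'I_n -> seq (F * seq 'M[F]_((dim A).+1))) (s : 'I_c -> 'S_n),
    (forall j p, der_op (@reg_basis F L A) (l j p)) /\
    row i M = \sum_j a j *: monomial_row (@reg_basis F L A) (l j) (s j)) ->
   (k <= C * n.+1 ^ C * d ^ n)%N) /\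
  ((forall s, (monomial_row (@reg_basis F L A) (fun=> [:: (1, [::])]) s <= M)%MS) ->
   (d ^ n <= C * n.+1 ^ C * k)%N)) ->
  let k := quot_dim (span_set (@decorated_monomials n))
    (span_set (@decorated_monomials n) `&` decorated_ids) in
  (k <= C * n.+1 ^ C * d ^ n)%N /\ (d ^ n <= C * n.+1 ^ C * k)%N.
Proof.
move=> n0 bnd k.
have [f|M [fM rM leM]] := @quot_dim_rows _ _ (@decorated_monomials n) _ (@eval_row n)
    (span_set (@decorated_monomials n) `&` decorated_ids).
  by split=> -[fP fI]; split=> //; apply/(decorated_ids_eval n0 fP).
have [up low] := bnd _ M fM; split.
  apply: up => i; have [f [m [c [w [wM ->]]]] ->] := rM i.
  have /fin_all_exists[s /fin_all_exists[dd wE]] : forall j : 'I_m,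
    exists (s : 'S_n) (d : 'I_n -> D),
      w j = \prod_(k < n) fgen F (g (s k : nat) (d k)) by move=> j; exact: wM.
  exists m, c, (fun j p => l (dd j p)), s; split=> [j p|]; first exact: op_der.
  rewrite linear_sum; apply: eq_bigr => j _.
  by rewrite linearZ wE; congr (_ *: _); exact: eval_row_monomial.
apply: low => s; rewrite -eval_row_monomial_id //; apply: leM.
exists 1%N, (fun=> 1), (fun=> \prod_(k < n) fgen F (g (s k : nat) d0)).
split; last by rewrite big_ord1 scale1r.
by move=> _; exists s, (fun=> d0).
Qed.

End CodimensionBounds.

Lemma codim_growth (F : fieldType) (charF : [pchar F] =i pred0) (L : lieAlgType F)
    (B : uea_basis L) (A : fdLAlgType L) :
  exists d C : nat, forall n, (C < n)%N ->
   [/\ (codim A n <= C * n.+1 ^ C * d ^ n)%N, (d ^ n <= C * n.+1 ^ C * codim A n)%N,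
       (diff_codim B A n <= C * n.+1 ^ C * d ^ n)%N &
       (d ^ n <= C * n.+1 ^ C * diff_codim B A n)%N].
Proof.
have [d [C grow]] := growth charF (@reg_basisM F L A).
exists d, C => n Cn; have n0 : (0 < n)%N by exact: leq_ltn_trans Cn.
have bnd := grow n (ltnW Cn).
have [i0 Bi0] := ub_one B.
pose triv : unit -> seq (F * seq 'M[F]_((dim A).+1)) := fun=> [:: (1, [::])].
have triv_der d' : der_op (@reg_basis F L A) (triv d').
  by move=> cs; rewrite mem_seq1 => /eqP ->.
have setE : [set f : freeAlg F nat |
    exists s : 'S_n, f = \prod_(k < n) fgen F (s k : nat)]%classic =
    @decorated_monomials F nat unit (fun i _ => i) n.
  rewrite predeqE => f; split=> [[s ->]|[s [_ ->]]]; last by exists s.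
  by exists s, (fun=> tt).
have [|||u1 l1] := @decorated_codim_bounds F L A nat unit tt (fun i _ => i) id (fun _ a => a)
  triv _ _ triv_der _ d C n n0 bnd.
- by [].
- by move=> d' x; rewrite ad_op_id.
- by [].
have [|||u2 l2] := @decorated_codim_bounds F L A (nat * ub_index B)%type (ub_index B) i0
  (fun i j => (i, j)) (fun a x => uact (a x.1) (B x.2)) (fun j a => uact a (B j))
  (fun j => uact_ad A (B j)) _ _ (fun j => @uact_ad_der F L A (B j)) _ d C n n0 bnd.
- by [].
- by move=> j x; rewrite reg_rep_uact.
- by move=> x; rewrite Bi0 uact1.
rewrite /codim /multilinear setE.
by split.
Qed.

(** * Limits of roots *)

Section RootLimit.
Variable R : realType.
Local Open Scope classical_set_scope.

(** Since ln y = ln (a y) - ln a < a y - ln a for every positive a, the logarithm grows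
    more slowly than any multiple of y. *)
Lemma cvg_ln_div : (fun n => n%:R^-1 * ln n.+1%:R : R) @ \oo --> (0 : R).
Proof.
apply/cvgr0Pnorm_lt => eps eps_gt0.
pose a := eps / 2; have a_gt0 : 0 < a by rewrite divr_gt0.
near=> n.
have n_gt0 : (0 < n)%N by near: n; exact: nbhs_infty_gt.
have n_gt0' : 0 < n%:R :> R by rewrite ltr0n.
have big : (a - ln a) / a < n%:R by near: n; exact: nbhs_infty_gtr.
have S_gt0 : 0 < n.+1%:R :> R by rewrite ltr0n.
rewrite ger0_norm; last by rewrite mulr_ge0 ?invr_ge0 ?ler0n // ln_ge0 // ler1n.
rewrite mulrC ltr_pdivrMr //.
have h : ln a + ln n.+1%:R < a * n.+1%:R.
  by rewrite -lnM ?posrE // ln_sublinear // mulr_gt0.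
have epsE : eps = a + a by rewrite /a; field.
move: big; rewrite ltr_pdivrMr // => big.
rewrite epsE mulrDl; rewrite -natr1 mulrDr mulr1 in h; rewrite -natr1.
rewrite mulrC in big; lra.
Unshelve. all: by end_near.
Qed.

(** If d > 0, then ln (c n) / n differs from ln d by at most 2 C ln (n + 1) / n. *)
Lemma cvg_root (c : nat -> nat) (d C : nat) :
  (forall n, (C < n)%N -> (c n <= C * n.+1 ^ C * d ^ n)%N /\
                          (d ^ n <= C * n.+1 ^ C * c n)%N) ->
  (fun n => (c n)%:R `^ n%:R^-1 : R) @ \oo --> (d%:R : R).
Proof.
move=> bnd.
have [d0|d_gt0] := posnP d.
  apply: cvg_near_cst; near=> n.
  have Cn : (C < n)%N by near: n; exact: nbhs_infty_gt.
  have n_gt0 : (0 < n)%N by exact: leq_ltn_trans Cn.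
  have [+ _] := bnd n Cn; rewrite d0 exp0n // muln0 leqn0 => /eqP ->.
  by rewrite powR0 // invr_eq0 pnatr_eq0 -lt0n.
pose u n : R := n%:R^-1 * ln (c n)%:R.
pose l n : R := (2 * C)%N%:R * (n%:R^-1 * ln n.+1%:R).
have lncvg : l @ \oo --> (0 : R).
  by rewrite -[X in _ --> X](mulr0 (2 * C)%N%:R); apply: cvgMl_tmp; exact: cvg_ln_div.
have ucvg : u @ \oo --> (ln d%:R : R).
  apply: (@squeeze_cvgr _ _ _ _ (fun n => ln d%:R - l n) (fun n => ln d%:R + l n)).
  - near=> n.
    have Cn : (C < n)%N by near: n; exact: nbhs_infty_gt.
    have n_gt0 : (0 < n)%N by exact: leq_ltn_trans Cn.
    have n_gt0' : 0 < n%:R :> R by rewrite ltr0n.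
    have [up low] := bnd n Cn.
    (* one power of n.+1 absorbs the constant C *)
    have q_le : (C * n.+1 ^ C <= n.+1 ^ (2 * C))%N.
      rewrite mul2n -addnn expnD leq_mul2r; apply/orP; right.
      apply: leq_trans (ltnW (ltn_expl C (ltnSn 1))) _.
      by case: (C) Cn => // C' _; rewrite leq_exp2r.
    have d_pos : (0 < d ^ n)%N by rewrite expn_gt0 d_gt0.
    have c_pos : (0 < c n)%N by move: (leq_trans d_pos low); rewrite muln_gt0 => /andP[].
    have lnE (a b : nat) : (0 < b)%N ->
        ln ((n.+1 ^ a * b)%N%:R : R) = a%:R * ln n.+1%:R + ln b%:R.
      move=> b0; rewrite natrM lnM ?posrE ?ltr0n ?expn_gt0 //.
      by rewrite natrX lnXn ?ltr0n // mulr_natl.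
    have lnd : ln ((d ^ n)%N%:R : R) = n%:R * ln d%:R.
      by rewrite natrX lnXn ?ltr0n // mulr_natl.
    have h1 : ln (c n)%:R <= (2 * C)%N%:R * ln n.+1%:R + n%:R * ln d%:R :> R.
      rewrite -lnd -lnE // ler_ln ?posrE ?ltr0n ?muln_gt0 ?expn_gt0 ?d_gt0 //.
      rewrite ler_nat; apply: leq_trans up _.
      by rewrite leq_mul2r q_le orbT.
    have h2 : n%:R * ln d%:R <= (2 * C)%N%:R * ln n.+1%:R + ln (c n)%:R :> R.
      rewrite -lnd -lnE // ler_ln ?posrE ?ltr0n ?muln_gt0 ?expn_gt0 ?d_gt0 //.
      rewrite ler_nat; apply: leq_trans low _.
      by rewrite leq_mul2r q_le orbT.
    have ldE : ln d%:R = n%:R^-1 * (n%:R * ln d%:R) :> R by rewrite mulKf ?lt0r_neq0.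
    have lE : l n = n%:R^-1 * ((2 * C)%N%:R * ln n.+1%:R) by rewrite /l mulrCA.
    rewrite ldE lE /u -mulrBr -mulrDr !ler_pM2l ?invr_gt0 //.
    by rewrite lerBlDr addrC h2 /= addrC.
  - rewrite -[X in _ --> X]subr0; apply: cvgB => //; exact: cvg_cst.
  - rewrite -[X in _ --> X]addr0; apply: cvgD => //; exact: cvg_cst.
rewrite -[X in _ --> X](@lnK R) ?posrE ?ltr0n //.
have h := @continuous_cvg _ _ _ _ _ u (@expR R) (ln d%:R) (@continuous_expR R _) ucvg.
suff e : {near \oo, expR \o u =1 (fun n => (c n)%:R `^ n%:R^-1)}.
  by move=> X /h; exact: (near_eq_cvg e).
near=> n.
have Cn : (C < n)%N by near: n; exact: nbhs_infty_gt.
have [_ low] := bnd n Cn.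
have c_pos : (0 < c n)%N.
  have d_pos : (0 < d ^ n)%N by rewrite expn_gt0 d_gt0.
  by move: (leq_trans d_pos low); rewrite muln_gt0 => /andP[].
by rewrite /= /powR pnatr_eq0 gtn_eqF.
Unshelve. all: by end_near.
Qed.

End RootLimit.

Theorem theorem3p7 (R : realType) (F : fieldType) (charF : [pchar F]%R =i pred0)
  (L : lieAlgType F) (B : uea_basis L) (A : fdLAlgType L) :
  diff_exponent R B A = exponent R A.
Proof.
have [d [C bnd]] := codim_growth charF B A.
have cvg_d : ((fun n => (diff_codim B A n)%:R `^ n%:R^-1 : R) @ \oo --> (d%:R : R))%classic.
  by apply: (@cvg_root R _ d C) => n Cn; have [] := bnd n Cn.
have cvg_o : ((fun n => (codim A n)%:R `^ n%:R^-1 : R) @ \oo --> (d%:R : R))%classic.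
  by apply: (@cvg_root R _ d C) => n Cn; have [] := bnd n Cn.
rewrite /diff_exponent /exponent (cvg_lim _ cvg_d) ?(cvg_lim _ cvg_o) //; exact: Rhausdorff.
Qed.
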